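(* For any positive integer $J$, the affine-like system $\mathcal{AS}_J$ (defined in the context, from a mask $a$, a dilation matrix $M_0$, filters $b_1,\dots,b_r$, and a $J$-level decomposition tree of matrices $M_\beta$ and filters $a_\beta$ satisfying the perfect reconstruction conditions listed there) is a tight frame for $L^2(\mathbb{R}^d)$, i.e. $\|f\|^2_{L^2(\mathbb{R}^d)}=\sum_{g\in\mathcal{AS}_J}|\langle f,g\rangle|^2$ for all $f\in L^2(\mathbb{R}^d)$.
   Context: **Conventions.** For a finitely supported sequence (mask, filter) $a$ on $\mathbb{Z}^d$, $\hat a(\xi)=\sum_{k\in\mathbb{Z}^d}a(k)e^{-ik\cdot\xi}$. The Fourier transform of functions is $\hat f(\xi)=\int_{\mathbb{R}^d} f(x)e^{-ix\cdot\xi}dx$ (extended to $L^2$). For an invertible integer $d\times d$ matrix $M$, $\Omega_M:=[(M^T)^{-1}\mathbb{Z}^d]\cap[0,1)^d$. $\delta(0)=1$ and $\delta(\omega)=0$ for $\omega\neq0$. For a function $f$, invertible real matrix $U$ and $k\in\mathbb{Z}^d$, $f_{U;k}:=|\det U|^{1/2}f(U\cdot-k)$. A system of functions is regarded as an indexed family (repetitions counted). **Underlying wavelet system.** $M_0$ is a $d\times d$ dilation matrix: an integer matrix all of whose eigenvalues have modulus greater than $1$. $a$ is a finitely supported complex mask on $\mathbb{Z}^d$ with $\hat a(0)=1$ such that $\hat\phi(\xi):=\prod_{j=1}^\infty\hat a((M_0^T)^{-j}\xi)$ defines a function $\phi\in L^2(\mathbb{R}^d)$. $b_1,\dots,b_r$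 are finitely supported complex filters on $\mathbb{Z}^d$ with $$\hat a(\xi)\overline{\hat a(\xi+2\pi\omega)}+\sum_{\ell=1}^r\widehat{b_\ell}(\xi)\overline{\widehat{b_\ell}(\xi+2\pi\omega)}=\delta(\omega),\qquad \omega\in\Omega_{M_0},\ \xi\in\mathbb{R}^d.$$ Define $\psi^1,\dots,\psi^r$ by $\widehat{\psi^\ell}(M_0^T\xi):=\widehat{b_\ell}(\xi)\hat\phi(\xi)$. **Decomposition tree with $J$ levels.** Indices are vectors in $\mathbb{N}_0^J$. Let $\mathcal{L}_0^L=\{\mathbf{0}\}$, $\mathbf 0=(0,\dots,0)$. Recursively for $j=1,\dots,J$: for each $\alpha=(\alpha_1,\dots,\alpha_{j-1},0,\dots,0)\in\mathcal{L}^L_{j-1}$ choose integers $s_\alpha\le r_\alpha$ with $r_\alpha\ge1$, where $s_\alpha\ge0$ if $\alpha=\mathbf 0$ and $s_\alpha\ge1$ otherwise, and put $$\mathcal{L}^L_{j,\alpha}=\{(\alpha_1,\dots,\alpha_{j-1},\ell,0,\dots,0):1\le\ell\le s_\alpha\},\quad \mathcal{L}^H_{j,\alpha}=\{(\alpha_1,\dots,\alpha_{j-1},\ell,0,\dots,0):s_\alpha<\ell\le r_\alpha\},$$ $$\mathcal{L}^L_j=\bigcup_{\alpha\in\mathcal{L}^L_{j-1}}\mathcal{L}^L_{j,\alpha},\qquad \mathcal{L}^H_j=\bigcup_{\alpha\in\mathcal{L}^L_{j-1}}\mathcal{L}^H_{j,\alpha}.$$ To each $\beta\in\bigcup_{j=1}^J(\mathcal{L}^L_j\cup\mathcal{L}^H_j)$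 is assigned a $d\times d$ invertible integer matrix $M_\beta$ and a finitely supported real filter $a_\beta$ on $\mathbb{Z}^d$, such that for every $j\in\{1,\dots,J\}$ and $\alpha\in\mathcal{L}^L_{j-1}$, writing $\mathcal{L}_{j,\alpha}:=\mathcal{L}^L_{j,\alpha}\cup\mathcal{L}^H_{j,\alpha}$, $$\sum_{\beta\in\mathcal{L}_{j,\alpha}\,:\,\omega\in\Omega_{M_\beta}}\widehat{a_\beta}(\xi)\overline{\widehat{a_\beta}(\xi+2\pi\omega)}=\delta(\omega),\qquad \omega\in\bigcup_{\gamma\in\mathcal{L}_{j,\alpha}}\Omega_{M_\gamma},\ \xi\in\mathbb{R}^d.$$ **Functions and matrices on the tree.** Set $\psi^{\mathbf 0}=\phi$. For $\beta\in\mathcal{L}^L_{j}\cup\mathcal{L}^H_{j}$ let $\beta^{(1)}\in\mathcal{L}^L_{j-1}$ be its parent (the $\alpha$ with $\beta\in\mathcal{L}_{j,\alpha}$), $\beta^{(2)}\in\mathcal{L}^L_{j-2}$ the parent of $\beta^{(1)}$, and so on, so that $\beta^{(j)}=\mathbf 0$. Recursively define $\psi^\beta$ by $\widehat{\psi^\beta}(M_\beta^T\xi):=\widehat{a_\beta}(\xi)\,\widehat{\psi^{\beta^{(1)}}}(\xi)$, and set $N_\beta:=M_\beta^{-1}M_{\beta^{(1)}}^{-1}\cdots M_{\beta^{(j-1)}}^{-1}$. **The system.** $$\mathcal{AS}_J:=\{\psi^\ell_{M_0^j;k}: 1\le\ell\le r,\ j\ge J,\ k\in\mathbb{Z}^d\}\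 \cup\ \{\psi^\beta_{N_\beta M_0^J;k}: k\in\mathbb{Z}^d,\ \beta\in\mathcal{L}^L_J\cup\bigcup_{j=1}^J\mathcal{L}^H_j\}.$$ *)

(* Defs.v *)
From HB Require Import structures.
From mathcomp Require Import all_boot all_order all_algebra.
From mathcomp Require Import finmap complex.
From mathcomp Require Import all_classical all_reals all_analysis.

Set Implicit Arguments.
Unset Strict Implicit.
Unset Printing Implicit Defensive.

Import Order.TTheory GRing.Theory Num.Theory.
Import numFieldNormedType.Exports.
Import complex.ComplexField.Normc.

Local Open Scope classical_set_scope.
Local Open Scope ring_scope.
Local Open Scope complex_scope.

(* 'cV[T]_n carries the product sigma-algebra, generated by the coordinate
   maps; for T = R this is the Borel sigma-algebra of R^n. *)
Definition measure_cV_display : measure_display -> measure_display.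
Proof. exact. Qed.

Section measurable_cV.
Context {d} {T : sigmaRingType d} (n : nat).

Let coords : 'I_n -> 'cV[T]_n -> T := fun i x => x i ord0.

Let cV_set0 : g_sigma_preimage coords set0.
Proof. exact: sigma_algebra0. Qed.

Let cV_setC A : g_sigma_preimage coords A -> g_sigma_preimage coords (~` A).
Proof. exact: sigma_algebraC. Qed.

Let cV_bigcup (F : _^nat) : (forall i, g_sigma_preimage coords (F i)) ->
  g_sigma_preimage coords (\bigcup_i F i).
Proof. exact: sigma_algebra_bigcup. Qed.

HB.instance Definition _ := @isMeasurable.Build (measure_cV_display d)
  'cV[T]_n (g_sigma_preimage coords) cV_set0 cV_setC cV_bigcup.

End measurable_cV.

Lemma measurable_coord d (T : sigmaRingType d) n (i : 'I_n) :
  measurable_fun [set: 'cV[T]_n] (fun x : 'cV[T]_n => x i ord0).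
Proof.
move=> _ Y mY; rewrite setTI; apply: sub_sigma_algebra => /=.
rewrite -bigcup_seq/=; exists i => /=; first by rewrite mem_index_enum.
by exists Y => //; rewrite setTI.
Qed.

Lemma measurable_fun_cVP d1 d2 (T1 : measurableType d1)
    (T2 : measurableType d2) n (f : T1 -> 'cV[T2]_n) :
  (forall i, measurable_fun [set: T1] (fun x => f x i ord0)) ->
  measurable_fun [set: T1] f.
Proof.
move=> mf _ A mA; rewrite setTI.
apply: (mA [set B | measurable (f @^-1` B)]); split.
  split=> /=.
  - by rewrite preimage_set0.
  - by move=> B mB; rewrite setTD preimage_setC; exact: measurableC.
  - by move=> F mF; rewrite preimage_bigcup; exact: bigcup_measurable.
move=> B; rewrite -bigcup_seq/= => -[i _ [C mC <-]] /=.
by have := mf i measurableT C mC; rewrite !setTI.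
Qed.

Definition cV_cons (T : Type) n (p : T * 'cV[T]_n) : 'cV[T]_n.+1 :=
  \col_i oapp (fun j => p.2 j ord0) p.1 (unlift ord0 i).

Lemma measurable_cV_cons d (T : measurableType d) n :
  measurable_fun setT (@cV_cons T n).
Proof.
apply: measurable_fun_cVP => i.
case: (unliftP ord0 i) => [j ->|->].
- rewrite (_ : (fun x => _) = (fun x : 'cV[T]_n => x j ord0) \o snd).
    by apply: measurableT_comp => //; exact: measurable_coord.
  by apply/funext => x; rewrite /cV_cons mxE liftK.
- rewrite (_ : (fun x => _) = fst) //.
  by apply/funext => x; rewrite /cV_cons mxE unlift_none.
Qed.

Section lebesgue_cV_step.
Local Open Scope ereal_scope.
Context (R : realType) (n : nat)
  (mu : {sigma_finite_measure set 'cV[R]_n -> \bar R}).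

Definition lebesgue_cV_step : set 'cV[R]_n.+1 -> \bar R :=
  pushforward (lebesgue_measure \x mu) (@cV_cons R n).

HB.instance Definition _ := Measure.copy lebesgue_cV_step
  (measure_function_pushforward__canonical__measure_function_Measure
    (lebesgue_measure \x mu) (@measurable_cV_cons _ R n)).

Let lebesgue_cV_step_sigma_finite : sigma_finite setT lebesgue_cV_step.
Proof.
have /sigma_finiteP[F [FT Fnd Foo]] := sigma_finiteT (@lebesgue_measure R).
have /sigma_finiteP[G [GT Gnd Goo]] := sigma_finiteT mu.
have Kcons : cancel (@cV_cons R n) (fun x : 'cV[R]_n.+1 =>
  (x ord0 ord0, \col_(i < n) x (lift ord0 i) ord0)).
  move=> [t x]; congr pair; first by rewrite mxE unlift_none.
  by apply/colP => i; rewrite !mxE liftK.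
exists (fun k => (fun x : 'cV[R]_n.+1 =>
  (x ord0 ord0, \col_(i < n) x (lift ord0 i) ord0)) @^-1` (F k `*` G k)).
  rewrite predeqE => x; split => // _.
  have : setT (x ord0 ord0) by [].
  rewrite FT => -[k _ Fk].
  have : setT (\col_(i < n) x (lift ord0 i) ord0 : 'cV[R]_n) by [].
  rewrite GT => -[l _ Gl].
  exists (maxn k l) => //; split => /=.
    by move: Fk; exact/subsetPset/Fnd/leq_maxl.
  by move: Gl; exact/subsetPset/Gnd/leq_maxr.
move=> k; have [mF Fk] := Foo k; have [mG Gk] := Goo k; split.
  rewrite -[X in measurable X]setTI.
  apply: measurable_fun_pair (measurableX mF mG) => //.
    exact: measurable_coord.
  apply: measurable_fun_cVP => i.
  rewrite (_ : (fun x => _) = fun x : 'cV[R]_n.+1 => x (lift ord0 i) ord0).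
    exact: measurable_coord.
  by apply/funext => x; rewrite mxE.
rewrite /lebesgue_cV_step /pushforward /= -comp_preimage.
rewrite (_ : _ \o _ = id); last by apply/funext => y /=; rewrite Kcons.
rewrite preimage_id product_measure1E//.
by rewrite lte_mul_pinfty// ge0_fin_numE.
Qed.

HB.instance Definition _ := Measure_isSigmaFinite.Build _ _ _ lebesgue_cV_step
  lebesgue_cV_step_sigma_finite.

End lebesgue_cV_step.

(* Lebesgue measure on the Borel sets of R^n, as an iterated product. *)
Fixpoint lebesgue_cV (R : realType) (n : nat) :
    {sigma_finite_measure set 'cV[R]_n -> \bar R} :=
  match n with
  | 0 => \d_(0 : 'cV[R]_0)
  | m.+1 => lebesgue_cV_step (lebesgue_cV R m)
  end.

Definition cV_box (R : realType) (n : nat) (a b : 'cV[R]_n) : set 'cV[R]_n :=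
  [set x | forall i, x i ord0 \in `[a i ord0, b i ord0]].

Lemma measurable_box (R : realType) (n : nat) (a b : 'cV[R]_n) :
  measurable (cV_box a b).
Proof.
rewrite (_ : cV_box a b = \big[setI/setT]_i
    ((fun x : 'cV[R]_n => x i ord0) @^-1` `[a i ord0, b i ord0])).
  apply: bigsetI_measurable => i _; rewrite -[X in measurable X]setTI.
  exact: measurable_coord.
apply/seteqP; split => [x xab|x].
  by rewrite -bigcap_seq => i _ /=; exact: xab.
by rewrite -bigcap_seq => xab i; apply: xab => /=; rewrite mem_index_enum.
Qed.

Lemma lebesgue_cV_box (R : realType) (n : nat) (a b : 'cV[R]_n) :
  (forall i, a i ord0 <= b i ord0) ->
  lebesgue_cV R n (cV_box a b) = (\prod_i (b i ord0 - a i ord0))%:E.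
Proof.
elim: n a b => [|n IHn] a b ab /=.
  by rewrite big_ord0 diracE mem_set// => -[].
rewrite /lebesgue_cV_step /pushforward.
pose tl (c : 'cV[R]_n.+1) : 'cV[R]_n := \col_(i < n) c (lift ord0 i) ord0.
rewrite (_ : _ @^-1` _ =
    `[a ord0 ord0, b ord0 ord0]%classic `*` cV_box (tl a) (tl b)); last first.
  apply/seteqP; split => -[t x] /=.
    move=> H; split => [|i] /=.
      by have := H ord0; rewrite /cV_cons mxE unlift_none.
    by have := H (lift ord0 i); rewrite /cV_cons !mxE liftK.
  move=> [/= t0 H] i; rewrite /cV_cons mxE.
  case: unliftP => [j ->|->] //=.
  by have := H j; rewrite !mxE.
rewrite product_measure1E//; last exact: measurable_box.
rewrite IHn; last by move=> i; rewrite !mxE.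
rewrite big_ord_recl EFinM; congr (_ * _)%E.
  apply: etrans (lebesgue_measure_itv `[a ord0 ord0, b ord0 ord0]) _.
  rewrite /= lte_fin; have := ab ord0.
  by rewrite le_eqVlt => /orP[/eqP ->|->//]; rewrite ltxx subrr.
by congr EFin; apply: eq_bigr => i _; rewrite !mxE.
Qed.

Section functions_on_Rd.
Context {R : realType} {d : nat}.
Local Notation C := R[i].
Local Notation Rd := 'cV[R]_d.
Local Notation Zd := 'cV[int]_d.
Local Notation mu := (lebesgue_cV R d).

Definition Zd_R (k : Zd) : Rd := map_mx intr k.
Definition mx_R (M : 'M[int]_d) : 'M[R]_d := map_mx intr M.

Definition dotR (x y : Rd) : R := \sum_i x i ord0 * y i ord0.

(* exp (i t) *)
Definition expi (t : R) : C := cos t +i* sin t.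

Definition cmeasurable (f : Rd -> C) : Prop :=
  measurable_fun setT (fun x => complex.Re (f x)) /\
  measurable_fun setT (fun x => complex.Im (f x)).

Definition cintegrable (f : Rd -> C) : Prop :=
  mu.-integrable setT (fun x => (complex.Re (f x))%:E) /\
  mu.-integrable setT (fun x => (complex.Im (f x))%:E).

Definition cintegral (f : Rd -> C) : C :=
  (\int[mu]_x complex.Re (f x)) +i* (\int[mu]_x complex.Im (f x)).

Definition sqnormL2 (f : Rd -> C) : \bar R :=
  (\int[mu]_x (normc (f x) ^+ 2)%:E)%E.

Definition inL2 (f : Rd -> C) : Prop :=
  cmeasurable f /\ (sqnormL2 f < +oo)%E.

Definition innerL2 (f g : Rd -> C) : C :=
  cintegral (fun x => f x * (g x)^*).

Definition fourier_integral (f : Rd -> C) (xi : Rd) : C :=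
  cintegral (fun x => f x * expi (- dotR x xi)).

(* The extension of [fourier_integral] from L^1 n L^2 to L^2 by L^2-continuity:
   g is the L^2-limit of the transforms of an L^1 n L^2 sequence tending to f
   in L^2.  By Plancherel's theorem such a g exists for each f in L^2 and is
   unique up to a null set; [fourier f] is a representative of it. *)
Definition is_fourier (f g : Rd -> C) : Prop :=
  [/\ inL2 f, inL2 g &
    exists fn : nat -> Rd -> C,
      [/\ forall n, cintegrable (fn n) /\ inL2 (fn n),
          sqnormL2 (fun x => fn n x - f x) @[n --> \oo] --> 0%E &
          sqnormL2 (fun xi => fourier_integral (fn n) xi - g xi)
            @[n --> \oo] --> 0%E]].

Definition fourier (f : Rd -> C) : Rd -> C :=
  xget (fun=> 0) [set g | is_fourier f g].

Definition zmask := {fsfun Zd -> C with 0}.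

Definition mask_hat (a : zmask) (xi : Rd) : C :=
  \sum_(k <- finsupp a) a k * expi (- dotR (Zd_R k) xi).

Definition climn (u : nat -> C) : C :=
  limn (fun n => complex.Re (u n)) +i* limn (fun n => complex.Im (u n)).

(* \prod_(j >= 1) mask_hat a ((M^T)^-j xi) *)
Definition mask_product (M : 'M[int]_d) (a : zmask) (xi : Rd) : C :=
  climn (fun n => \prod_(1 <= j < n.+1)
    mask_hat a (invmx ((mx_R M)^T) ^+ j *m xi)).

Definition dilation_matrix (M : 'M[int]_d) : Prop :=
  forall z : C, eigenvalue (map_mx intr M : 'M[C]_d) z -> 1 < `|z|.

Definition Omega (M : 'M[int]_d) : set Rd :=
  [set w | (exists k : Zd, w = invmx ((mx_R M)^T) *m Zd_R k) /\
           forall i, 0 <= w i ord0 < 1].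

Definition dilshift (f : Rd -> C) (U : 'M[R]_d) (k : Zd) : Rd -> C :=
  fun x => (Num.sqrt `|\det U|)%:C * f (U *m x - Zd_R k).

Definition tight_frame (I : choiceType) (D : set I) (g : I -> Rd -> C) : Prop :=
  forall f, inL2 f ->
    sqnormL2 f = \esum_(i in D) (normc (innerL2 f (g i)) ^+ 2)%:E.

End functions_on_Rd.
Arguments zmask : clear implicits.

Section tree.
Context {J : nat}.

Definition tindex := {ffun 'I_J -> nat}.

Definition troot : tindex := [ffun=> 0%N].

(* Entries are numbered from 1: the j-th entry sits at i : 'I_J with i.+1 = j. *)
Definition set_entry (alpha : tindex) (j l : nat) : tindex :=
  [ffun i : 'I_J => if i.+1 == j then l else alpha i].

Definition low_children (s : tindex -> nat) (j : nat) (alpha : tindex) :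
    set tindex :=
  [set set_entry alpha j l | l in [set l : nat | (1 <= l <= s alpha)%N]].

Definition high_children (s r : tindex -> nat) (j : nat) (alpha : tindex) :
    set tindex :=
  [set set_entry alpha j l | l in [set l : nat | (s alpha < l <= r alpha)%N]].

Definition children s r j alpha :=
  low_children s j alpha `|` high_children s r j alpha.

Fixpoint low (s : tindex -> nat) (j : nat) : set tindex :=
  match j with
  | 0 => [set troot]
  | j'.+1 => \bigcup_(alpha in low s j') low_children s j alpha
  end.

Definition high (s r : tindex -> nat) (j : nat) : set tindex :=
  \bigcup_(alpha in low s j.-1) high_children s r j alpha.

(* [alpha] is a node of level j - 1 to be split into its children. *)
Definition split_node (s : tindex -> nat) (j : nat) (alpha : tindex) : Prop :=
  (1 <= j <= J)%N /\ low s j.-1 alpha.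

Definition valid_sizes (s r : tindex -> nat) : Prop :=
  forall j alpha, split_node s j alpha ->
    [/\ (s alpha <= r alpha)%N, (1 <= r alpha)%N &
        alpha != troot -> (1 <= s alpha)%N].

Definition nodes (s r : tindex -> nat) : set tindex :=
  \bigcup_(j in [set j : nat | (1 <= j <= J)%N]) (low s j `|` high s r j).

Definition leaves (s r : tindex -> nat) : set tindex :=
  low s J `|` \bigcup_(j in [set j : nat | (1 <= j <= J)%N]) high s r j.

(* The entries of a node of level j are positive up to the j-th and zero
   afterwards. *)
Definition level (beta : tindex) : nat := #|[pred i | beta i != 0%N]|.

Definition parent (beta : tindex) : tindex := set_entry beta (level beta) 0.

End tree.
Arguments tindex : clear implicits.
Arguments troot : clear implicits.

Section systems.
Context {R : realType} {d : nat}.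
Local Notation C := R[i].
Local Notation Rd := 'cV[R]_d.
Local Notation Zd := 'cV[int]_d.

Definition wavelet_PR (r : nat) (M0 : 'M[int]_d) (a : zmask R d)
    (b : 'I_r -> zmask R d) : Prop :=
  forall omega xi : Rd, Omega M0 omega ->
    mask_hat a xi * (mask_hat a (xi + (2 * pi) *: omega))^* +
    \sum_(l < r) mask_hat (b l) xi *
      (mask_hat (b l) (xi + (2 * pi) *: omega))^* = (omega == 0)%:R.

Definition tree_PR (J : nat) (sT rT : tindex J -> nat)
    (M : tindex J -> 'M[int]_d) (aT : tindex J -> zmask R d) : Prop :=
  forall j alpha, split_node sT j alpha ->
  forall omega xi : Rd,
    (\bigcup_(gamma in children sT rT j alpha) Omega (M gamma)) omega ->
    \sum_(beta \in children sT rT j alpha `&` [set beta | Omega (M beta) omega])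
      mask_hat (aT beta) xi * (mask_hat (aT beta) (xi + (2 * pi) *: omega))^*
    = (omega == 0)%:R.

Definition node_mx (J : nat) (M : tindex J -> 'M[int]_d) (beta : tindex J) :
    'M[R]_d :=
  \prod_(i < level beta) invmx (mx_R (M (iter i parent beta))).

(* inl (l, j, k) stands for psi^l_{M0^j; k}, and inr (beta, k) for
   psi^beta_{N_beta M0^J; k}. *)
Definition AS_index (r J : nat) : choiceType :=
  (('I_r * nat * Zd) + (tindex J * Zd))%type.

Definition AS_range (r J : nat) (sT rT : tindex J -> nat) :
    set (AS_index r J) :=
  [set i | match i with
           | inl (_, j, _) => (J <= j)%N
           | inr (beta, _) => leaves sT rT beta
           end].

Definition AS (r J : nat) (M0 : 'M[int]_d) (psi : 'I_r -> Rd -> C)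
    (M : tindex J -> 'M[int]_d) (psiT : tindex J -> Rd -> C)
    (i : AS_index r J) : Rd -> C :=
  match i with
  | inl (l, j, k) => dilshift (psi l) (mx_R M0 ^+ j) k
  | inr (beta, k) => dilshift (psiT beta) (node_mx M beta *m mx_R M0 ^+ J) k
  end.

End systems.

(* Main.v *)
(* Since phi^ is a bounded limit of trigonometric sums with frequencies in a
   fixed cube, phi has compact support, and its integral is phi^(0) = 1.  For a
   bounded continuous compactly supported f all coefficient sequences are hence
   finite.  The perfect reconstruction conditions, transferred to the lattice
   side, say that the filter bank of a node is an isometry of finitely supported
   sequences, so that the energy sum_k |<f, g_{U;k}>|^2 of a node equals the sum
   of the energies of its children.  Splitting phi_{M0^J} down to the leaves of
   the tree, and phi_{M0^(j+1)} into phi_{M0^j} and psi^l_{M0^j} for j >= J, the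
   total energy is the limit over n of sum_k |<f, phi_{M0^n;k}>|^2.  This is the
   squared norm of f, because the sum is the squared norm of a step function
   which converges to f.  Density gives the result for every f in L^2. *)
Require Import Defs.
From HB Require Import structures.
From mathcomp Require Import all_boot all_order all_algebra.
From mathcomp Require Import fingroup perm.
From mathcomp Require Import finmap complex.
From mathcomp Require Import all_classical all_reals all_analysis.
From mathcomp Require Import measurable_realfun.
From mathcomp Require Import ring lra zify.

Set Implicit Arguments.
Unset Strict Implicit.
Unset Printing Implicit Defensive.

Import Order.TTheory GRing.Theory Num.Theory.
Import numFieldNormedType.Exports.
Import complex.ComplexField.Normc.

Local Open Scope classical_set_scope.
Local Open Scope complex_scope.
Local Open Scope ring_scope.

(** * Lebesgue measure and linear maps *)

Section boxes.
Context {R : realType}.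

(** The hypotheses live on the frequency side and only almost everywhere: [fourier] chooses a
    representative, so no transform can be evaluated at a point. Plancherel's theorem and
    injectivity of the transform on L2 are therefore proved here, and their main use is
    [refinement], which turns each filter relation into a two-scale relation in space; all energies
    are then compared in space. One fact controls the infinite product: the entries of the powers of
    the inverse of [M0] are absolutely summable. It makes the product converge, confines the
    frequencies of its partial products, hence the support of phi, to a cube, and makes the sampling
    cells shrink. Perfect reconstruction at omega = 0 bounds the mask by 1, so the partial products
    stay bounded. Siblings in the tree may have different matrices, hence different lattices;
    weighting the identities by a character and summing over the union of the frequency sets
    separates the nodes again. In the density argument the bound must survive with constant exactly
    1, which is why Young's inequality with a parameter replaces the cruder factor 2 used
    elsewhere. *)

Lemma cV_box_setI n (a b a' b' : 'cV[R]_n) : cV_box a b `&` cV_box a' b' =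
  cV_box (\col_i Num.max (a i ord0) (a' i ord0))
         (\col_i Num.min (b i ord0) (b' i ord0)).
Proof.
apply/seteqP; split => x /=.
  move=> [H H1] i; move: (H i) (H1 i).
  by rewrite !in_itv/= !mxE ge_max le_min => /andP[h1 h2] /andP[h3 h4]; rewrite h1 h2 h3 h4.
move=> H; split => i; have := H i; rewrite !in_itv/= !mxE ge_max le_min;
  by move=> /andP[/andP[h1 h2] /andP[h3 h4]]; rewrite ?h1 ?h2 ?h3 ?h4.
Qed.

Definition cV_boxes n : set (set 'cV[R]_n) :=
  [set B | exists a b : 'cV[R]_n, B = cV_box a b].

(** The closed ball of the sup norm, written as a box so that its measurability and measure come for
    free. It plays the part of balls in every boundedness and support statement. *)
Definition cube n (k : R) : set 'cV[R]_n := cV_box (const_mx (- k)) (const_mx k).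
Arguments cube : clear implicits.

Lemma cubeE n (k : R) (x : 'cV[R]_n) :
  cube n k x <-> forall i, `|x i ord0| <= k.
Proof.
by split=> H i; have := H i; rewrite in_itv/= !mxE ler_norml.
Qed.

Lemma cV_norm_bound n (x : 'cV[R]_n) : exists k : nat, cube n k%:R x.
Proof.
pose s := \sum_i `|x i ord0|.
exists (Num.truncn s).+1; apply/cubeE => i.
have : `|x i ord0| <= s.
  by rewrite /s (bigD1 i)//= lerDl; apply: sumr_ge0 => j _.
move/le_trans; apply; apply/ltW.
by apply: truncnS_gt.
Qed.

Lemma bigcup_cube n : \bigcup_(k : nat) cube n k%:R = setT.
Proof.
by apply/seteqP; split => // x _; have [k xk] := cV_norm_bound x; exists k.
Qed.

(** The product sigma-algebra is generated by preimages of rays under one coordinate, and such a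
    preimage is the countable union of boxes whose other sides are exhausted by [-k, k]. *)
Lemma measurable_cV_boxes n : @measurable _ 'cV[R]_n = <<s @cV_boxes n >>.
Proof.
apply/seteqP; split; last first.
  apply: smallest_sub; first exact: sigma_algebra_measurable.
  by move=> _ [a [b ->]]; exact: measurable_box.
apply: smallest_sub; first exact: smallest_sigma_algebra.
move=> B; rewrite -bigcup_seq/= => -[i _ [C mC <-]]; rewrite setTI.
have mC' : measurable C by [].
move: C mC {mC'}.
have E : @measurable _ (measurableTypeR R) `<=` [set C | <<s @cV_boxes n >>
    ((fun x : 'cV[R]_n => x i ord0) @^-1` C)].
  rewrite RGenCInfty.measurableE; apply: smallest_sub.
    split => /=.
    - by rewrite preimage_set0; exact: sigma_algebra0.
    - move=> C HC; rewrite setTD preimage_setC.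
      by rewrite -[X in <<s _ >> X]setTD; exact: sigma_algebraCD.
    - by move=> F HF; rewrite preimage_bigcup; exact: sigma_algebra_bigcup.
  move=> _ [x ->] /=.
  rewrite (_ : _ @^-1` _ = \bigcup_(k : nat)
    cV_box (\col_j if j == i then x else - k%:R) (const_mx k%:R)).
    apply: sigma_algebra_bigcup => k; apply: sub_sigma_algebra.
    by exists (\col_j (if j == i then x else - k%:R)), (const_mx k%:R).
  apply/seteqP; split => y /=.
    rewrite in_itv/= andbT => xy; have [k /cubeE yk] := cV_norm_bound y.
    exists k => //= j; rewrite in_itv/= !mxE; have := yk j.
    rewrite ler_norml => /andP[h1 h2]; rewrite h2 andbT.
    by case: eqP => [->|].
  by move=> [k _ /(_ i)]; rewrite !in_itv/= !mxE eqxx => /andP[-> _].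
exact: E.
Qed.

Lemma lebesgue_cV_cube_lty n (k : nat) : (lebesgue_cV R n (cube n k%:R) < +oo)%E.
Proof.
rewrite lebesgue_cV_box ?ltry// => i; rewrite !mxE.
by apply: (@le_trans _ _ 0); rewrite ?oppr_le0.
Qed.

Lemma lebesgue_cV_boxE n (a b : 'cV[R]_n) : lebesgue_cV R n (cV_box a b) =
  (if [forall i, a i ord0 <= b i ord0] then
     \prod_i (b i ord0 - a i ord0) else 0)%:E.
Proof.
case: ifPn => [/forallP ab|]; first exact: lebesgue_cV_box.
move=> /forallPn[i ab]; rewrite (_ : cV_box a b = set0) ?measure0//.
rewrite -subset0 => x /(_ i) /=; rewrite in_itv/= => /andP[h1 h2].
by move: ab; rewrite (le_trans h1 h2).
Qed.

(** Boxes form a generating family closed under intersection, and the cubes exhaust the space with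
    finite measure, so the uniqueness theorem for measures applies. *)
Lemma lebesgue_cV_unique n (m : {measure set 'cV[R]_n -> \bar R}) :
  (forall a b, m (cV_box a b) = lebesgue_cV R n (cV_box a b)) ->
  forall A, measurable A -> m A = lebesgue_cV R n A.
Proof.
move=> H A mA; apply/esym.
apply: (@measure_unique _ _ _ (@cV_boxes n) (fun k : nat => cube n k%:R)) => //.
- exact: measurable_cV_boxes.
- move=> _ _ [a [b ->]] [a' [b' ->]]; rewrite cV_box_setI.
  by eexists; eexists; reflexivity.
- by move=> k; eexists; eexists; reflexivity.
- exact: bigcup_cube.
- by move=> _ [a [b ->]]; rewrite H.
- exact: lebesgue_cV_cube_lty.
Qed.

Lemma ge0_integral_cV_cons n (F : 'cV[R]_n.+1 -> \bar R) :
  measurable_fun setT F -> (forall x, 0 <= F x)%E ->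
  (\int[lebesgue_cV R n.+1]_x F x =
   \int[lebesgue_measure]_t \int[lebesgue_cV R n]_x F (cV_cons (t, x)))%E.
Proof.
move=> mF F0.
have -> : (\int[lebesgue_cV R n.+1]_x F x =
   \int[pushforward (lebesgue_measure \x lebesgue_cV R n) (@cV_cons R n)]_x
     F x)%E by [].
have mc := @measurable_cV_cons _ R n.
rewrite ge0_integral_pushforward//= preimage_setT.
rewrite fubini_tonelli1//=.
exact: measurableT_comp.
Qed.

End boxes.
Arguments cube {R} n k.

(** * Change of variables under affine maps *)

Section linear_change_of_variables.
Context {R : realType}.
Local Open Scope ereal_scope.

Lemma measurable_linear m n (U : 'M[R]_(m, n)) (v : 'cV[R]_m) :
  measurable_fun setT (fun x : 'cV[R]_n => (U *m x + v)%R).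
Proof.
apply: measurable_fun_cVP => i.
rewrite (_ : (fun x => _) =
  (fun x : 'cV[R]_n => (\sum_j U i j * x j ord0 + v i ord0)%R)).
  apply: measurable_funD => //; apply: measurable_sum => j.
  by apply: measurable_funM => //; exact: measurable_coord.
by apply/funext => x; rewrite !mxE.
Qed.

Lemma measurable_mulmx m n (U : 'M[R]_(m, n)) :
  measurable_fun setT (fun x : 'cV[R]_n => (U *m x)%R).
Proof.
have := measurable_linear U 0%R.
by under eq_fun do rewrite addr0.
Qed.

Lemma measurable_translation n (v : 'cV[R]_n) :
  measurable_fun setT (fun x : 'cV[R]_n => (x + v)%R).
Proof.
have := measurable_linear 1%:M%R v.
by under eq_fun do rewrite mul1mx.
Qed.

Lemma measurable_preimage d1 d2 (T1 : measurableType d1)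
    (T2 : measurableType d2) (f : T1 -> T2) (A : set T2) :
  measurable_fun setT f -> measurable A -> measurable (f @^-1` A).
Proof. by move=> mf mA; rewrite -[X in measurable X]setTI; exact: mf. Qed.

Lemma lebesgue_cV_translation n (v : 'cV[R]_n) (A : set 'cV[R]_n) :
  measurable A ->
  lebesgue_cV R n ((fun x => x + v)%R @^-1` A) = lebesgue_cV R n A.
Proof.
move=> mA.
pose m := measure_function_pushforward__canonical__measure_function_Measure
  (lebesgue_cV R n) (measurable_translation v).
apply: (@lebesgue_cV_unique _ _ m) => // a b.
rewrite /m /= /pushforward.
rewrite (_ : _ @^-1` _ = cV_box (a - v)%R (b - v)%R); last first.
  by apply/seteqP; split => x /= H i; have := H i;
    rewrite !in_itv/= !mxE lerBlDr lerBrDr.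
rewrite !lebesgue_cV_boxE; congr (_%:E).
have E i : ((a - v)%R i ord0 <= (b - v)%R i ord0)%R = (a i ord0 <= b i ord0)%R.
  by rewrite !mxE lerD2r.
rewrite (eq_forallb E); case: ifP => // _; apply: eq_bigr => i _.
rewrite !mxE; ring.
Qed.

(** Isolated as a predicate because it is stable under products ([scalesM]), so that it can be
    checked on the factors of a matrix decomposition. *)
Definition scales n (U : 'M[R]_n) := forall A, measurable A ->
  lebesgue_cV R n ((fun x => U *m x)%R @^-1` A) =
  (`|\det U|^-1)%:E * lebesgue_cV R n A.

Lemma scalesM n (U V : 'M[R]_n) : scales U -> scales V -> scales (U *m V)%R.
Proof.
move=> hU hV A mA.
rewrite (_ : _ @^-1` _ = (fun x => V *m x)%R @^-1` ((fun x => U *m x)%R @^-1` A)).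
  rewrite hV; last exact: measurable_preimage (measurable_mulmx _) mA.
  by rewrite hU// muleA -EFinM det_mulmx normrM invfM mulrC.
by apply/seteqP; split => x /=; rewrite mulmxA.
Qed.

(** The image measure under [U], multiplied by |det U|, agrees with Lebesgue measure on boxes, hence
    everywhere by [lebesgue_cV_unique]. *)
Lemma scales_boxes n (U : 'M[R]_n) : (\det U != 0)%R ->
  (forall a b, lebesgue_cV R n ((fun x => U *m x)%R @^-1` cV_box a b) =
    (`|\det U|^-1)%:E * lebesgue_cV R n (cV_box a b)) -> scales U.
Proof.
move=> U0 H A mA.
pose m := measure_function_pushforward__canonical__measure_function_Measure
  (lebesgue_cV R n) (measurable_mulmx U).
have [c cE] : exists c : {nonneg R}, c%:num%R = `|\det U|%R.
  by exists (NngNum (normr_ge0 (\det U))).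
pose m' := mscale c m.
have dU : (`|\det U| != 0)%R by rewrite normr_eq0.
have key : m' A = lebesgue_cV R n A.
  apply: lebesgue_cV_unique => // a b.
  transitivity (c%:num%:E *
    lebesgue_cV R n ((fun x => U *m x)%R @^-1` cV_box a b)) => //.
  by rewrite cE H muleA -EFinM divff// mul1e.
have {}key : (`|\det U|)%:E * lebesgue_cV R n ((fun x => U *m x)%R @^-1` A) =
  lebesgue_cV R n A by rewrite -cE; exact: key.
by rewrite -key muleA -EFinM mulVf// mul1e.
Qed.

Lemma scales_perm n (s : 'S_n) : scales (perm_mx s).
Proof.
have d1 : (`|\det (perm_mx s : 'M[R]_n)| = 1)%R by rewrite det_perm normrX normrN1 expr1n.
apply: scales_boxes => [|a b]; first by rewrite -normr_eq0 d1 oner_eq0.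
rewrite d1 invr1 mul1e.
have pE x i : ((perm_mx s : 'M[R]_n) *m x)%R i ord0 = (x : 'cV[R]_n) (s i) ord0.
  by rewrite -row_permE mxE.
rewrite (_ : _ @^-1` _ = cV_box (\col_i a ((s^-1)%g i) ord0)%R (\col_i b ((s^-1)%g i) ord0)%R).
  rewrite !lebesgue_cV_boxE; congr (_%:E).
  have -> : [forall i, ((\col_i a ((s^-1)%g i) ord0)%R i ord0 <= (\col_i b ((s^-1)%g i) ord0)%R i ord0)%R] = [forall i, (a i ord0 <= b i ord0)%R].
    apply/forallP/forallP => H i.
      by have := H (s i); rewrite !mxE permK.
    by rewrite !mxE.
  case: ifP => // _; rewrite [RHS](reindex_inj (@perm_inj _ (s^-1)%g)).
  by apply: eq_bigr => i _; rewrite !mxE.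
apply/seteqP; split => x /= H i.
  by have := H ((s^-1)%g i); rewrite pE permKV !in_itv/= !mxE.
by have := H (s i); rewrite pE !in_itv/= !mxE permK.
Qed.

Lemma scales_diag n (D : 'rV[R]_n) : (forall i, D ord0 i != 0)%R ->
  scales (diag_mx D).
Proof.
move=> D0; apply: scales_boxes => [|a b].
  by rewrite det_diag; apply/prodf_neq0 => i _; exact: D0.
rewrite det_diag.
(* A negative diagonal entry exchanges the two endpoints of a side, whence the minimum and
   maximum. *)
pose lo i := Num.min (a i ord0 / D ord0 i)%R (b i ord0 / D ord0 i)%R.
pose hi i := Num.max (a i ord0 / D ord0 i)%R (b i ord0 / D ord0 i)%R.
have E (ab : [forall i, a i ord0 <= b i ord0]%R) :
    (fun x : 'cV_n => diag_mx D *m x)%R @^-1` cV_box a b =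
    cV_box (\col_i lo i)%R (\col_i hi i)%R.
  have P i (t : R) : (t \in `[lo i, hi i])%R = (D ord0 i * t \in `[a i ord0, b i ord0])%R.
    move/forallP: ab => /(_ i); have := D0 i.
    rewrite !in_itv/= /lo /hi; case: (ltgtP (D ord0 i) 0%R) => // d0 _ ab.
      rewrite minEle maxEle ler_nM2r ?invr_lt0//.
      have [|ba] := boolP (b i ord0 <= a i ord0)%R.
        move=> ba; have -> : a i ord0 = b i ord0 by apply/le_anti; rewrite ab ba.
        by rewrite ler_ndivrMr// ler_ndivlMr// mulrC andbC.
      by rewrite ler_ndivrMr// ler_ndivlMr// mulrC andbC.
    by rewrite minEle maxEle ler_pM2r ?invr_gt0// ab ler_pdivrMr// ler_pdivlMr// mulrC.
  have dE (x : 'cV[R]_n) i : ((diag_mx D *m x) i ord0 = D ord0 i * x i ord0)%R.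
    by rewrite mul_diag_mx mxE.
  by apply/seteqP; split => x /= H i; have := H i; rewrite dE -P !mxE.
case/boolP: [forall i, (a i ord0 <= b i ord0)%R] => ab; last first.
  rewrite [X in _ = _ * X]lebesgue_cV_boxE (negbTE ab) mule0.
  rewrite (_ : _ @^-1` _ = set0) ?measure0//.
  rewrite -subset0 => x /=; move/forallPn: ab => [i ab] /(_ i).
  rewrite in_itv/= => /andP[h1 h2].
  by move: ab; rewrite (le_trans h1 h2).
rewrite E// lebesgue_cV_box; last first.
  by move=> i; rewrite !mxE /lo /hi le_max ge_min lexx.
rewrite lebesgue_cV_boxE ab -EFinM; congr (_%:E).
rewrite normr_prod -prodfV -big_split/=; apply: eq_bigr => i _.
rewrite !mxE /lo /hi; move/forallP: ab => /(_ i) ab.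
have := D0 i; case: (ltgtP (D ord0 i) 0%R) => // d0 _.
  rewrite minEle maxEle ler_nM2r ?invr_lt0//.
  case: ifP => [ba|_].
    have -> : a i ord0 = b i ord0 by apply/le_anti; rewrite ab ba.
    by rewrite !subrr mulr0.
  by rewrite ltr0_norm// invrN; ring.
by rewrite minEle maxEle ler_pM2r ?invr_gt0// ab gtr0_norm//; ring.
Qed.

Lemma integral_indicT d (T : measurableType d) (m : {measure set T -> \bar R})
  (A : set T) : measurable A -> \int[m]_x (\1_A x)%:E = m A.
Proof. by move=> mA; rewrite integral_indic// setIT. Qed.

Lemma indic_preimage T1 T2 (f : T1 -> T2) (A : set T2) x :
  \1_(f @^-1` A) x = \1_A (f x) :> R.
Proof. by rewrite !indicE; congr (_%:R); apply/idP/idP; rewrite !inE. Qed.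

(* Fubini: a unipotent lower triangular map translates each coordinate by a
   function of the previous ones. *)
Lemma scales_lower n (U : 'M[R]_n) :
  (forall i j : 'I_n, (i <= j)%N -> U i j = (i == j)%:R) ->
  forall A, measurable A ->
  lebesgue_cV R n ((fun x => U *m x)%R @^-1` A) = lebesgue_cV R n A.
Proof.
elim: n U => [|n IH] U HU A mA.
  by congr (dirac _ _); apply/seteqP; split => x /=; rewrite [(U *m x)%R]flatmx0 [x]flatmx0.
pose L : 'M[R]_n := \matrix_(i, j) U (lift ord0 i) (lift ord0 j).
pose c : 'cV[R]_n := \col_i U (lift ord0 i) ord0.
have UE t x : (U *m cV_cons (t, x) = cV_cons (t, L *m x + t *: c))%R.
  apply/colP => i; rewrite !mxE big_ord_recl.
  rewrite [X in (_ * X)%R]mxE unlift_none/=.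
  under eq_bigr do rewrite [X in (_ * X)%R]mxE liftK /=.
  case: (unliftP ord0 i) => [j ->|->] /=.
    by rewrite !mxE mulrC addrC; congr (_ + _)%R; apply: eq_bigr => k _; rewrite mxE.
  rewrite HU// eqxx mul1r big1 ?addr0// => k _.
  by rewrite HU// mul0r.
have HL (i j : 'I_n) : (i <= j)%N -> L i j = (i == j)%:R.
  by move=> ij; rewrite mxE HU// (inj_eq lift_inj).
have mU := measurable_preimage (measurable_mulmx U) mA.
rewrite -(integral_indicT _ mU) -(integral_indicT _ mA).
have mi B : measurable B ->
    measurable_fun setT (EFin \o (\1_B : 'cV[R]_n.+1 -> R)).
  by move=> mB; apply/measurable_EFinP.
have i0 (B : set 'cV[R]_n.+1) (x : 'cV[R]_n.+1) : 0 <= (\1_B x : R)%:E by rewrite lee_fin.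
rewrite (ge0_integral_cV_cons (mi _ mU) (i0 _)).
rewrite (ge0_integral_cV_cons (mi _ mA) (i0 _)).
apply: eq_integral => t _.
pose B := (fun x => cV_cons (t, x)) @^-1` A.
have mB : measurable B.
  apply: measurable_preimage => //.
  by apply: measurableT_comp; [exact: measurable_cV_cons|exact: measurable_pair1].
transitivity (lebesgue_cV R n B); last first.
  rewrite -(integral_indicT (lebesgue_cV R n) mB).
  by apply: eq_integral => x _; rewrite /B /comp indic_preimage.
have mB' := measurable_preimage (measurable_translation (t *: c)%R) mB.
rewrite -(lebesgue_cV_translation (t *: c)%R mB) -(IH L HL)//.
rewrite -(integral_indicT (lebesgue_cV R n)
  (measurable_preimage (measurable_mulmx L) mB')).
by apply: eq_integral => x _; rewrite /B /comp !indic_preimage UE.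
Qed.

(* The LUP decomposition reduces to permutations, diagonal and unipotent maps. *)
Lemma scales_unit n (U : 'M[R]_n) : (\det U != 0)%R -> scales U.
Proof.
case: n U => [|n] U U0.
  rewrite [U]flatmx0 => A mA; rewrite det_mx00 normr1 invr1 mul1e.
  by congr (dirac _ _); apply/seteqP; split => x /=; rewrite [(_ *m x)%R]flatmx0 [x]flatmx0.
have lowS (L : 'M[R]_n.+1) : (forall i j : 'I_n.+1, (i <= j)%N -> L i j = (i == j)%:R) -> scales L.
  move=> HL A mA.
  have -> : (\det L = 1)%R.
    rewrite det_trig; last by apply/is_trig_mxP => i j ij; rewrite HL ?(ltnW ij)//; case: eqP ij => // ->; rewrite ltnn.
    by rewrite big1// => i _; rewrite HL ?eqxx.
  by rewrite normr1 invr1 mul1e; exact: scales_lower.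
have := cormen_lup_correct U; have := cormen_lup_perm U.
have := @cormen_lup_lower _ _ U; have := @cormen_lup_upper _ _ U.
case: (cormen_lup U) => [[P L] V] /= HV HL /is_perm_mxP[s Ps] PU.
have UE : U = (perm_mx (s^-1)%g *m (L *m V))%R.
  by rewrite -[(L *m V)%R]PU Ps; rewrite mulmxE mulrA -mulmxE -perm_mxM mulVg perm_mx1 mul1mx.
have dV : (\det V != 0)%R.
  by move: U0; rewrite UE !det_mulmx !mulf_eq0 !negb_or => /and3P[].
have V0 i : (V i i != 0)%R.
  move: dV; rewrite -det_tr det_trig; last by apply/is_trig_mxP => k j kj; rewrite mxE HV.
  by move/prodf_neq0 => /(_ i isT); rewrite mxE.
rewrite UE; apply: scalesM; first exact: scales_perm.
apply: scalesM; first by apply: lowS => i j; exact: HL.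
(* Dividing each row of the upper triangular factor by its diagonal entry leaves a unipotent upper
   triangular matrix [W]. *)
pose D : 'rV[R]_n.+1 := (\row_i V i i)%R.
pose W : 'M[R]_n.+1 := (\matrix_(i, j) (V i j / V i i))%R.
have -> : V = (diag_mx D *m W)%R.
  by apply/matrixP => i j; rewrite mul_diag_mx !mxE mulrC divfK.
apply: scalesM; first by apply: scales_diag => i; rewrite mxE.
(* Reversing the order of the coordinates conjugates the upper unipotent [W] into a lower unipotent
   matrix, to which [lowS] applies. *)
have rI : injective (@rev_ord n.+1) by exact: rev_ord_inj.
pose p := perm rI.
pose L' : 'M[R]_n.+1 := (\matrix_(i, j) W (rev_ord i) (rev_ord j))%R.
have -> : W = (perm_mx p *m (L' *m perm_mx p))%R.
  have pV : (p^-1)%g = p.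
    by apply/permP => k; apply: (@perm_inj _ p); rewrite permKV !permE rev_ordK.
  rewrite -row_permE -{2}pV -col_permE.
  by apply/matrixP => i j; rewrite !mxE !permE !rev_ordK.
apply: scalesM; first exact: scales_perm.
apply: scalesM; last exact: scales_perm.
apply: lowS => i j ij; rewrite !mxE.
have [->|nij] := eqVneq i j; first by rewrite divff.
have {}ij : (i < j)%N.
  by rewrite ltn_neqAle ij andbT; apply: contra nij => /eqP/val_inj ->.
by rewrite HV ?mul0r//=; have := ltn_ord j; lia.
Qed.

Lemma ge0_integral_linear n (U : 'M[R]_n) (v : 'cV[R]_n) (F : 'cV[R]_n -> \bar R) :
  (\det U != 0)%R -> measurable_fun setT F -> (forall x, 0 <= F x) ->
  \int[lebesgue_cV R n]_x F (U *m x + v)%R =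
  (`|\det U|^-1)%:E * \int[lebesgue_cV R n]_x F x.
Proof.
move=> U0 mF F0.
pose m := measure_function_pushforward__canonical__measure_function_Measure
  (lebesgue_cV R n) (measurable_linear U v).
have [c cE] : exists c : {nonneg R}, c%:num%R = (`|\det U|^-1)%R.
  by have h : (0 <= `|\det U|^-1)%R by []; exists (NngNum h).
transitivity (\int[m]_x F x).
  by rewrite /m ge0_integral_pushforward//; exact: measurable_linear.
rewrite (@eq_measure_integral _ _ _ _ (mscale c (lebesgue_cV R n))).
  by rewrite -cE ge0_integral_mscale.
move=> A mA _; transitivity (c%:num%:E * lebesgue_cV R n A) => //.
rewrite cE -(lebesgue_cV_translation v mA) -(scales_unit U0)//.
exact: measurable_preimage (measurable_translation _) mA.
Qed.

End linear_change_of_variables.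

(** * Complex integrals and square-integrable functions *)

Section complex_lemmas.
Context {R : realType}.
Implicit Types z w : R[i].

Lemma ReD z w : complex.Re (z + w) = complex.Re z + complex.Re w.
Proof. by case: z; case: w. Qed.
Lemma ImD z w : complex.Im (z + w) = complex.Im z + complex.Im w.
Proof. by case: z; case: w. Qed.
Lemma ReN z : complex.Re (- z) = - complex.Re z. Proof. by case: z. Qed.
Lemma ImN z : complex.Im (- z) = - complex.Im z. Proof. by case: z. Qed.
Lemma ReM z w : complex.Re (z * w) =
  complex.Re z * complex.Re w - complex.Im z * complex.Im w.
Proof. by case: z; case: w. Qed.
Lemma ImM z w : complex.Im (z * w) =
  complex.Re z * complex.Im w + complex.Im z * complex.Re w.
Proof. by case: z; case: w. Qed.
Lemma ReJ z : complex.Re z^* = complex.Re z. Proof. by case: z. Qed.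
Lemma ImJ z : complex.Im z^* = - complex.Im z. Proof. by case: z. Qed.
Definition ReImE := (ReD, ImD, ReN, ImN, ReM, ImM, ReJ, ImJ).

Lemma cext z w : complex.Re z = complex.Re w -> complex.Im z = complex.Im w ->
  z = w.
Proof. by case: z; case: w => /= a b c d -> ->. Qed.

Lemma conjcM z w : (z * w)^* = z^* * w^*.
Proof. by apply: cext; rewrite !ReImE; ring. Qed.
Lemma conjcD z w : (z + w)^* = z^* + w^*.
Proof. by apply: cext; rewrite !ReImE; ring. Qed.
Lemma conjc_conjc z : (z^*)^* = z.
Proof. exact: conjCK. Qed.
Lemma conjc_sum (I : Type) (r : seq I) (P : pred I) (F : I -> R[i]) :
  (\sum_(i <- r | P i) F i)^* = \sum_(i <- r | P i) (F i)^*.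
Proof.
apply: (big_morph (fun z => z^*)) => [z w|]; [exact: conjcD|].
by apply: cext => /=; rewrite ?oppr0.
Qed.

Lemma normcE2 z : normc z ^+ 2 = complex.Re z ^+ 2 + complex.Im z ^+ 2.
Proof. by case: z => a b /=; rewrite sqr_sqrtr// addr_ge0// sqr_ge0. Qed.

Lemma normc_ge0 z : 0 <= normc z. Proof. by case: z => a b; exact: sqrtr_ge0. Qed.
Hint Resolve normc_ge0 : core.

Lemma normcJ z : normc z^* = normc z.
Proof. by case: z => a b /=; rewrite sqrrN. Qed.

Lemma mulcJ z : z * z^* = (normc z ^+ 2)%:C.
Proof. by apply: cext; rewrite !ReImE normcE2 /=; ring. Qed.

Lemma normc_real (x : R) : normc x%:C = `|x|.
Proof. by rewrite /= expr0n /= addr0 sqrtr_sqr. Qed.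

Lemma Re_le_normc z : `|complex.Re z| <= normc z.
Proof.
rewrite -(ler_pXn2r (n := 2)) ?nnegrE// normcE2 real_normK ?num_real//.
by rewrite lerDl sqr_ge0.
Qed.

Lemma Im_le_normc z : `|complex.Im z| <= normc z.
Proof.
rewrite -(ler_pXn2r (n := 2)) ?nnegrE// normcE2 [X in X <= _]real_normK ?num_real//.
by rewrite lerDr sqr_ge0.
Qed.

Lemma normc_le_ReIm z : normc z <= `|complex.Re z| + `|complex.Im z|.
Proof.
rewrite -(ler_pXn2r (n := 2)) ?nnegrE ?addr_ge0// normcE2 sqrrD.
by rewrite !real_normK ?num_real// -addrA lerD2l lerDr mulrn_wge0// mulr_ge0.
Qed.

Lemma normcB z w : normc (z - w) <= normc z + normc w.
Proof. by rewrite -(normcN w) le_normcD. Qed.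

Lemma normc_sqrD z w : normc (z + w) ^+ 2 <= 2 * normc z ^+ 2 + 2 * normc w ^+ 2.
Proof.
rewrite !normcE2 !ReImE; set a := complex.Re z; set b := complex.Im z.
set c := complex.Re w; set e := complex.Im w.
have := sqr_ge0 (a - c); have := sqr_ge0 (b - e); nra.
Qed.

Lemma normc_sum (I : Type) (r : seq I) (P : pred I) (F : I -> R[i]) :
  normc (\sum_(i <- r | P i) F i) <= \sum_(i <- r | P i) normc (F i).
Proof.
elim/big_ind2: _ => [|x1 x2 y1 y2 h1 h2|//]; first by rewrite normc0.
by apply: le_trans (le_normcD _ _) _; exact: lerD.
Qed.

Lemma Re_sum (I : Type) (r : seq I) (P : pred I) (F : I -> R[i]) :
  complex.Re (\sum_(i <- r | P i) F i) = \sum_(i <- r | P i) complex.Re (F i).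
Proof. by apply: (big_morph (@complex.Re R)) => // z w; exact: ReD. Qed.

Lemma expiD (s t : R) : expi (s + t) = expi s * expi t.
Proof.
apply: cext; rewrite !ReImE /=; first by rewrite cosD.
by rewrite sinD; ring.
Qed.
Lemma expi0 : expi 0 = 1 :> R[i].
Proof. by rewrite /expi cos0 sin0. Qed.
Lemma expiN (t : R) : expi (- t) = (expi t)^*.
Proof. by apply: cext; rewrite /= ?cosN ?sinN. Qed.
Lemma normc_expi (t : R) : normc (expi t) = 1.
Proof. by rewrite /= cos2Dsin2 sqrtr1. Qed.

(** Convergence is put on real and imaginary parts because this is the form in which [climn] and the
    real convergence theorems deliver limits; [ccvgP] gives the equivalent form with the modulus. *)
Definition ccvg (u : nat -> R[i]) (l : R[i]) : Prop :=
  (complex.Re (u n) @[n --> \oo] --> complex.Re l) /\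
  (complex.Im (u n) @[n --> \oo] --> complex.Im l).

Lemma ccvgP u l : ccvg u l <-> (normc (u n - l) @[n --> \oo] --> 0).
Proof.
split.
  move=> [h1 h2].
  have : (`|complex.Re (u n) - complex.Re l| + `|complex.Im (u n) - complex.Im l|) @[n --> \oo] --> (0 : R).
    rewrite -(addr0 0); apply: cvgD; rewrite -(normr0 R); apply: cvg_norm.
      by rewrite -(subrr (complex.Re l)); apply: cvgB => //; exact: cvg_cst.
    by rewrite -(subrr (complex.Im l)); apply: cvgB => //; exact: cvg_cst.
  apply: squeeze_cvgr; last exact: cvg_cst.
  apply: nearW => n; rewrite normc_ge0/=.
  by apply: le_trans (normc_le_ReIm _) _; rewrite !ReImE.
move=> h; split; apply/subr_cvg0; apply/cvgr0Pnorm_lt => e e0;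
  move/cvgr0Pnorm_lt : h => /(_ e e0); apply: filterS => n; apply: le_lt_trans;
  rewrite [leRHS]ger0_norm//.
  by apply: le_trans (Re_le_normc _); rewrite !ReImE.
by apply: le_trans (Im_le_normc _); rewrite !ReImE.
Qed.

Lemma ccvg_cst l : ccvg (fun=> l) l.
Proof. by split; exact: cvg_cst. Qed.
Lemma ccvgD u v l k : ccvg u l -> ccvg v k -> ccvg (fun n => u n + v n) (l + k).
Proof.
move=> [a b] [c e]; split; rewrite ReImE; under eq_fun do rewrite ReImE;
  exact: cvgD.
Qed.
Lemma ccvgN u l : ccvg u l -> ccvg (fun n => - u n) (- l).
Proof.
move=> [a b]; split; rewrite ReImE; under eq_fun do rewrite ReImE; exact: cvgN.
Qed.
Lemma ccvgB u v l k : ccvg u l -> ccvg v k -> ccvg (fun n => u n - v n) (l - k).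
Proof. by move=> a b; apply: ccvgD => //; exact: ccvgN. Qed.
Lemma ccvgM u v l k : ccvg u l -> ccvg v k -> ccvg (fun n => u n * v n) (l * k).
Proof.
move=> [a b] [c e]; split; rewrite ReImE; under eq_fun do rewrite ReImE.
  by apply: cvgB; exact: cvgM.
by apply: cvgD; exact: cvgM.
Qed.
Lemma ccvgJ u l : ccvg u l -> ccvg (fun n => (u n)^*) (l^*).
Proof.
move=> [a b]; split; rewrite ReImE; under eq_fun do rewrite ReImE.
  exact: a.
exact: cvgN.
Qed.
Lemma ccvg_unique u l k : ccvg u l -> ccvg u k -> l = k.
Proof.
by move=> [a b] [c e]; apply: cext;
  [exact: (cvg_unique _ a c)|exact: (cvg_unique _ b e)].
Qed.
Lemma ccvg_normc u l : ccvg u l -> normc (u n) @[n --> \oo] --> normc l.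
Proof.
move=> /ccvgP h; apply/subr_cvg0; apply/cvgr0Pnorm_lt => e e0;
  move/cvgr0Pnorm_lt : h => /(_ e e0); apply: filterS => n; apply: le_lt_trans.
rewrite [leRHS]ger0_norm//; rewrite ler_norml; apply/andP; split.
  rewrite lerNl opprB lerBlDl.
  by rewrite -{1}(subrK (u n) l) addrC; apply: le_trans (le_normcD _ _) _; rewrite lerD2l -normcN opprB.
by rewrite lerBlDl -{1}(subrK l (u n)) addrC; exact: le_normcD.
Qed.
Lemma ccvg_near_eq u v l : (forall n, u n = v n) -> ccvg u l -> ccvg v l.
Proof. by move=> /funext ->. Qed.

End complex_lemmas.
#[global] Hint Resolve normc_ge0 : core.

Lemma abse_normc (R : realType) (z : R[i]) :
  (`|(normc z)%:E| = (normc z)%:E)%E.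
Proof. by rewrite gee0_abs// lee_fin; exact: normc_ge0. Qed.

Section complex_integral.
Context d (T : measurableType d) (R : realType) (m : {measure set T -> \bar R}).
Implicit Types f g : T -> R[i].

(** [cmeas], [cintg] and [cint] are [cmeasurable], [cintegrable] and [cintegral] over an arbitrary
    measure space, and are convertible to them for [lebesgue_cV]. The generality serves products and
    the line. *)
Definition cmeas f : Prop :=
  measurable_fun setT (fun x => complex.Re (f x)) /\
  measurable_fun setT (fun x => complex.Im (f x)).

Definition cintg f : Prop :=
  m.-integrable setT (fun x => (complex.Re (f x))%:E) /\
  m.-integrable setT (fun x => (complex.Im (f x))%:E).

Definition cint f : R[i] :=
  (\int[m]_x complex.Re (f x)) +i* (\int[m]_x complex.Im (f x)).

Lemma cmeas_cst z : cmeas (fun=> z).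
Proof. by split; exact: measurable_cst. Qed.
Lemma cmeasD f g : cmeas f -> cmeas g -> cmeas (fun x => f x + g x).
Proof.
by move=> [a b] [c e]; split; under eq_fun do rewrite ReImE; exact: measurable_funD.
Qed.
Lemma cmeasN f : cmeas f -> cmeas (fun x => - f x).
Proof.
by move=> [a b]; split; under eq_fun do rewrite ReImE; exact: measurableT_comp.
Qed.
Lemma cmeasB f g : cmeas f -> cmeas g -> cmeas (fun x => f x - g x).
Proof. by move=> a b; apply: cmeasD => //; exact: cmeasN. Qed.
Lemma cmeasM f g : cmeas f -> cmeas g -> cmeas (fun x => f x * g x).
Proof.
move=> [a b] [c e]; split; under eq_fun do rewrite ReImE.
  by apply: measurable_funB; exact: measurable_funM.
by apply: measurable_funD; exact: measurable_funM.
Qed.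
Lemma cmeasZ z f : cmeas f -> cmeas (fun x => z * f x).
Proof. by apply: cmeasM; exact: cmeas_cst. Qed.
Lemma cmeasJ f : cmeas f -> cmeas (fun x => (f x)^*).
Proof.
move=> [a b]; split; under eq_fun do rewrite ReImE.
  exact: a.
exact: measurableT_comp.
Qed.
Lemma cmeas_real (h : T -> R) : measurable_fun setT h -> cmeas (fun x => (h x)%:C).
Proof. by move=> mh; split => //=; exact: measurable_cst. Qed.
Lemma cmeas_sum (I : Type) (r : seq I) (P : pred I) (F : I -> T -> R[i]) :
  (forall i, cmeas (F i)) -> cmeas (fun x => \sum_(i <- r | P i) F i x).
Proof.
move=> h; elim: r => [|i r IH].
  by under eq_fun do rewrite big_nil; exact: cmeas_cst.
under eq_fun do rewrite big_cons.
by case: (P i) => //; exact: cmeasD.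
Qed.
Lemma cmeas_expi (h : T -> R) : measurable_fun setT h ->
  cmeas (fun x => expi (h x)).
Proof.
move=> mh; split => /=; apply: measurableT_comp => //;
  apply: continuous_measurable_fun; [exact: continuous_cos|exact: continuous_sin].
Qed.
Lemma cmeas_normc f : cmeas f -> measurable_fun setT (fun x => normc (f x)).
Proof.
move=> [a b].
pose h x := complex.Re (f x) ^+ 2 + complex.Im (f x) ^+ 2.
have mh : measurable_fun setT h.
  by apply: measurable_funD; exact: measurable_funX.
have ms : measurable_fun setT (fun t : R => Num.sqrt t).
  by apply: continuous_measurable_fun; exact: sqrt_continuous.
have -> : (fun x => normc (f x)) = (fun t : R => Num.sqrt t) \o h.
  by apply/funext => x; rewrite /h /=; case: (f x).
exact: measurableT_comp.
Qed.

Lemma cintg_meas f : cintg f -> cmeas f.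
Proof.
move=> [a b]; split; [have := measurable_int _ a|have := measurable_int _ b];
  exact: (@measurable_EFinP _ _ _ _ _).1.
Qed.

Lemma cintg_le f (h : T -> R) : cmeas f -> m.-integrable setT (EFin \o h) ->
  (forall x, normc (f x) <= h x) -> cintg f.
Proof.
move=> [a b] ih fh; split; apply: (le_integrable _ _ _ ih) => //=; try exact/measurable_EFinP.
  move=> x _; rewrite lee_fin (le_trans (Re_le_normc _))// (le_trans (fh x))// ler_norm//.
move=> x _; rewrite lee_fin (le_trans (Im_le_normc _))// (le_trans (fh x))// ler_norm//.
Qed.

Lemma integrable_normc f : cmeas f ->
  (\int[m]_x (normc (f x))%:E < +oo)%E -> m.-integrable setT (fun x => (normc (f x))%:E).
Proof.
move=> mf h; apply/integrableP; split.
  by apply/measurable_EFinP; exact: cmeas_normc.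
by under eq_integral do rewrite abse_normc.
Qed.

Lemma cintgP f : cmeas f -> (\int[m]_x (normc (f x))%:E < +oo)%E -> cintg f.
Proof.
by move=> mf h; apply: (cintg_le mf (integrable_normc mf h)).
Qed.

Lemma cintg_normc f : cintg f -> m.-integrable setT (fun x => (normc (f x))%:E).
Proof.
move=> cf; have mf := cintg_meas cf; case: cf => ia ib.
have h : m.-integrable setT (fun x => `|(complex.Re (f x))%:E| + `|(complex.Im (f x))%:E|)%E.
  by apply: integrableD => //; exact: integrable_abse.
apply: (le_integrable _ _ _ h) => //.
  by apply/measurable_EFinP; exact: cmeas_normc.
move=> x _; rewrite abse_normc /= lee_fin [leRHS]ger0_norm ?addr_ge0//.
exact: normc_le_ReIm.
Qed.

Lemma cintg_normc_lty f : cintg f -> (\int[m]_x (normc (f x))%:E < +oo)%E.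
Proof.
move=> /cintg_normc/integrableP[_]; under eq_integral do rewrite abse_normc.
by [].
Qed.

Lemma cintgD f g : cintg f -> cintg g -> cintg (fun x => f x + g x).
Proof.
by move=> [a b] [c e]; split; under eq_fun do rewrite ReImE EFinD; exact: integrableD.
Qed.
Lemma cintgZ z f : cintg f -> cintg (fun x => z * f x).
Proof.
move=> cf; have mf := cintg_meas cf; apply: cintgP; first exact: cmeasZ.
under eq_integral do rewrite normcM EFinM.
have := integrableZl measurableT (normc z) (cintg_normc cf).
move=> /integrableP[_]; under eq_integral do rewrite abseM !abse_normc.
by [].
Qed.
Lemma cintgN f : cintg f -> cintg (fun x => - f x).
Proof. by move=> /(cintgZ (-1)); under eq_fun do rewrite mulN1r. Qed.
Lemma cintgB f g : cintg f -> cintg g -> cintg (fun x => f x - g x).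
Proof. by move=> a b; apply: cintgD => //; exact: cintgN. Qed.
Lemma cintgJ f : cintg f -> cintg (fun x => (f x)^*).
Proof.
move=> cf; apply: cintgP; first exact/cmeasJ/cintg_meas.
by under eq_integral do rewrite normcJ; exact: cintg_normc_lty.
Qed.
Lemma cintg_sum (I : Type) (r : seq I) (P : pred I) (F : I -> T -> R[i]) :
  (forall i, cintg (F i)) -> cintg (fun x => \sum_(i <- r | P i) F i x).
Proof.
move=> h; elim: r => [|i r IH].
  under eq_fun do rewrite big_nil.
  by split; exact: integrable0.
under eq_fun do rewrite big_cons.
by case: (P i) => //; exact: cintgD.
Qed.

Lemma eq_cint f g : f =1 g -> cint f = cint g.
Proof. by move=> /funext ->. Qed.

Lemma cintD f g : cintg f -> cintg g ->
  cint (fun x => f x + g x) = cint f + cint g.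
Proof.
move=> [a b] [c e]; apply: cext; rewrite !ReImE /=.
  by under eq_Rintegral do rewrite ReImE; rewrite RintegralD.
by under eq_Rintegral do rewrite ReImE; rewrite RintegralD.
Qed.
Lemma integrable_mulr (r : R) (h : T -> R) : m.-integrable setT (EFin \o h) ->
  m.-integrable setT (EFin \o (fun x => r * h x)).
Proof. by move=> ih; exact: (integrableZl measurableT r ih). Qed.

Lemma cintZ z f : cintg f -> cint (fun x => z * f x) = z * cint f.
Proof.
move=> [a b]; apply: cext; rewrite !ReImE /=.
  under eq_Rintegral do rewrite ReImE.
  by rewrite RintegralB ?RintegralZl//; exact: integrable_mulr.
under eq_Rintegral do rewrite ReImE.
by rewrite RintegralD ?RintegralZl//; exact: integrable_mulr.
Qed.
Lemma cintN f : cintg f -> cint (fun x => - f x) = - cint f.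
Proof.
by move=> cf; rewrite -mulN1r -cintZ//; apply: eq_cint => x; rewrite mulN1r.
Qed.
Lemma cintB f g : cintg f -> cintg g ->
  cint (fun x => f x - g x) = cint f - cint g.
Proof. by move=> cf cg; rewrite cintD ?cintN//; exact: cintgN. Qed.
Lemma cint0 : cint (fun=> 0) = 0.
Proof. by apply: cext => /=; rewrite Rintegral_cst// mul0r. Qed.
Lemma cintJ f : cintg f -> cint (fun x => (f x)^*) = (cint f)^*.
Proof.
move=> [a b]; apply: cext; rewrite !ReImE /=.
  by under eq_Rintegral do rewrite ReImE.
under eq_Rintegral do rewrite ReImE -mulN1r.
by rewrite RintegralZl// mulN1r.
Qed.
Lemma cint_sum (I : Type) (r : seq I) (P : pred I) (F : I -> T -> R[i]) :
  (forall i, cintg (F i)) ->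
  cint (fun x => \sum_(i <- r | P i) F i x) = \sum_(i <- r | P i) cint (F i).
Proof.
move=> h; elim: r => [|i r IH].
  by rewrite big_nil -[RHS]cint0; apply: eq_cint => x; rewrite big_nil.
rewrite big_cons; move: IH.
rewrite [in X in _ -> X](_ : (fun x => _) = fun x => if P i then F i x + \sum_(j <- r | P j) F j x else \sum_(j <- r | P j) F j x); last first.
  by apply/funext => x; rewrite big_cons.
case: (P i) => // IH; rewrite cintD ?IH//.
exact: cintg_sum.
Qed.

(** Multiplying [f] by the unimodular constant conj(I)/|I|, where I is the integral, makes the
    integral real and nonnegative; then the real part of the rotated integrand is compared with
    |f|. *)
Lemma cint_normc_le f : cintg f ->
  ((normc (cint f))%:E <= \int[m]_x (normc (f x))%:E)%E.
Proof.
move=> cf; set I := cint f.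
have [->|I0] := eqVneq I 0.
  by rewrite normc0; apply: integral_ge0 => x _; rewrite lee_fin normc_ge0.
have nI : normc I != 0 by apply: contra I0 => /eqP/eq0_normc ->.
pose u := I^* / (normc I)%:C.
have nu : normc u = 1.
  by rewrite /u normcM normcV normcJ normc_real ger0_norm ?normc_ge0// divff.
have E : u * I = (normc I)%:C.
  have nC : (normc I)%:C != 0 :> R[i] by apply: contra nI => /eqP/(congr1 (@complex.Re R))/eqP.
  by rewrite /u mulrAC [I^* * I]mulrC mulcJ expr2 rmorphM mulfK.
have -> : normc I = complex.Re (cint (fun x => u * f x)).
  by rewrite cintZ// -/I E.
rewrite /cint /=.
have [cr _] := cintgZ u cf.
rewrite /Rintegral fineK; last exact: integrable_fin_num.
apply: le_integral => //; first exact: cintg_normc.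
move=> x _; rewrite lee_fin (le_trans (ler_norm _))// (le_trans (Re_le_normc _))//.
by rewrite normcM nu mul1r.
Qed.

Lemma cint_ae f g : cmeas f -> cmeas g -> {ae m, forall x, f x = g x} ->
  cint f = cint g.
Proof.
move=> [a b] [c e] h.
by congr (_ +i* _); rewrite /Rintegral; congr fine;
  apply: ae_eq_integral => //; try exact/measurable_EFinP;
  apply: filterS h => x /= ->.
Qed.

Lemma cint_dct (F : nat -> T -> R[i]) f (h : T -> R) :
  (forall n, cmeas (F n)) -> cmeas f -> m.-integrable setT (EFin \o h) ->
  {ae m, forall x, ccvg (F ^~ x) (f x)} ->
  (forall n x, normc (F n x) <= h x) ->
  ccvg (fun n => cint (F n)) (cint f).
Proof.
move=> mF [ma mb] ih cF Fh; split => /=; apply: fine_cvg.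
  have [|||//||i1 _ i2] := @dominated_convergence _ _ _ m setT measurableT
    (fun n x => (complex.Re (F n x))%:E) (fun x => (complex.Re (f x))%:E) (EFin \o h).
  - by move=> n; apply/measurable_EFinP; case: (mF n).
  - exact/measurable_EFinP.
  - by apply: filterS cF => x [c _] _; exact: cvg_EFin (nearW _ _) c.
  - apply/aeW => x n _; rewrite lee_fin.
    exact: le_trans (Re_le_normc _) (Fh n x).
  by rewrite fineK//; exact: integrable_fin_num.
have [|||//||i1 _ i2] := @dominated_convergence _ _ _ m setT measurableT
  (fun n x => (complex.Im (F n x))%:E) (fun x => (complex.Im (f x))%:E) (EFin \o h).
- by move=> n; apply/measurable_EFinP; case: (mF n).
- exact/measurable_EFinP.
- by apply: filterS cF => x [_ c] _; exact: cvg_EFin (nearW _ _) c.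
- apply/aeW => x n _; rewrite lee_fin.
  exact: le_trans (Im_le_normc _) (Fh n x).
by rewrite fineK//; exact: integrable_fin_num.
Qed.

End complex_integral.

(** * Fubini's theorem for complex integrals *)

Section complex_fubini.
Context d1 d2 (T1 : measurableType d1) (T2 : measurableType d2) (R : realType).
Variable m1 : {sigma_finite_measure set T1 -> \bar R}.
Variable m2 : {sigma_finite_measure set T2 -> \bar R}.

Lemma abse_fine_le (x : \bar R) : (`|(fine x)%:E| <= `|x|)%E.
Proof. by case: x => //= [|]; rewrite normr0 leey. Qed.

(** The inner integral is known to be finite only for almost every [x]. On the exceptional null set
    [fine] may return its default value, which changes neither integrability nor the iterated
    integral. *)
Lemma integrable_Rintegral1 (f : T1 * T2 -> R) :
  (m1 \x m2)%E.-integrable setT (EFin \o f) ->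
  m1.-integrable setT (fun x => (\int[m2]_y f (x, y))%:E) /\
  \int[m1]_x (\int[m2]_y f (x, y)) = \int[(m1 \x m2)%E]_z f z.
Proof.
move=> If; have mF := measurable_fubini_F If.
have h : {ae m1, forall x, setT x ->
    (\int[m2]_y (f (x, y))%:E)%E = (\int[m2]_y f (x, y))%:E}.
  have := ae_integrable1 If; apply: filterS => x ix _.
  by rewrite /Rintegral fineK//; exact: integrable_fin_num.
have mR : measurable_fun setT (fun x => (\int[m2]_y f (x, y))%:E).
  by apply/measurable_EFinP; exact: measurableT_comp.
split.
  apply/integrableP; split => //.
  have mf := measurable_int _ If.
  have h2 : (\int[m1]_x \int[m2]_y `|(f (x, y))%:E| < +oo)%E.
    exact: ((@integrable12ltyP _ _ _ _ _ m1 m2 _ mf).1 If).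
  apply: le_lt_trans h2; apply: ge0_le_integral => //.
  - exact: measurableT_comp.
  - by apply: (measurable_fun_fubini_tonelli_F (abse \o (EFin \o f))) => //=;
      exact: measurableT_comp.
  - move=> x _; apply: le_trans (abse_fine_le _) _.
    apply: le_abse_integral => //.
    exact: (measurableT_comp mf (measurable_pair1 x)).
rewrite /Rintegral; congr fine.
rewrite -(integral12_prod_meas1 If).
apply/esym; apply: ae_eq_integral => //.
Qed.

Lemma integrable_Rintegral2 (f : T1 * T2 -> R) :
  (m1 \x m2)%E.-integrable setT (EFin \o f) ->
  m2.-integrable setT (fun y => (\int[m1]_x f (x, y))%:E) /\
  \int[m2]_y (\int[m1]_x f (x, y)) = \int[(m1 \x m2)%E]_z f z.
Proof.
move=> If; have mF := measurable_fubini_G If.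
have h : {ae m2, forall y, setT y ->
    (\int[m1]_x (f (x, y))%:E)%E = (\int[m1]_x f (x, y))%:E}.
  have := ae_integrable2 If; apply: filterS => x ix _.
  by rewrite /Rintegral fineK//; exact: integrable_fin_num.
have mR : measurable_fun setT (fun y => (\int[m1]_x f (x, y))%:E).
  by apply/measurable_EFinP; exact: measurableT_comp.
split.
  apply/integrableP; split => //.
  have mf := measurable_int _ If.
  have h2 : (\int[m2]_y \int[m1]_x `|(f (x, y))%:E| < +oo)%E.
    exact: ((@integrable21ltyP _ _ _ _ _ m1 m2 _ mf).1 If).
  apply: le_lt_trans h2; apply: ge0_le_integral => //.
  - exact: measurableT_comp.
  - by apply: (measurable_fun_fubini_tonelli_G (abse \o (EFin \o f))) => //=;
      exact: measurableT_comp.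
  - move=> x _; apply: le_trans (abse_fine_le _) _.
    apply: le_abse_integral => //.
    exact: (measurableT_comp mf (measurable_pair2 x)).
rewrite /Rintegral; congr fine.
rewrite -(integral21_prod_meas1 If).
apply/esym; apply: ae_eq_integral => //.
Qed.

Variable F : T1 * T2 -> R[i].
Hypotheses (mF : cmeas F)
  (iF : (\int[m1]_x \int[m2]_y (normc (F (x, y)))%:E < +oo)%E).

Lemma cintg_prod : cintg (m1 \x m2)%E F.
Proof.
apply: cintgP => //; rewrite fubini_tonelli1//.
  by apply/measurable_EFinP; exact: cmeas_normc.
by move=> z; rewrite lee_fin normc_ge0.
Qed.

Lemma cintg_fubini1 : cintg m1 (fun x => cint m2 (fun y => F (x, y))).
Proof.
have [a b] := cintg_prod; split.
  exact: (integrable_Rintegral1 (f := fun z => complex.Re (F z)) a).1.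
exact: (integrable_Rintegral1 (f := fun z => complex.Im (F z)) b).1.
Qed.

Lemma cintg_fubini2 : cintg m2 (fun y => cint m1 (fun x => F (x, y))).
Proof.
have [a b] := cintg_prod; split.
  exact: (integrable_Rintegral2 (f := fun z => complex.Re (F z)) a).1.
exact: (integrable_Rintegral2 (f := fun z => complex.Im (F z)) b).1.
Qed.

Lemma cint_fubini : cint m1 (fun x => cint m2 (fun y => F (x, y))) =
  cint m2 (fun y => cint m1 (fun x => F (x, y))).
Proof.
have [a b] := cintg_prod; apply: cext => /=.
  rewrite (integrable_Rintegral1 (f := fun z => complex.Re (F z)) a).2.
  by rewrite (integrable_Rintegral2 (f := fun z => complex.Re (F z)) a).2.
rewrite (integrable_Rintegral1 (f := fun z => complex.Im (F z)) b).2.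
by rewrite (integrable_Rintegral2 (f := fun z => complex.Im (F z)) b).2.
Qed.

End complex_fubini.

(** * Square-integrable functions and the Cauchy-Schwarz inequality *)

Section square_integrable.
Context d (T : measurableType d) (R : realType) (m : {measure set T -> \bar R}).
Implicit Types f g : T -> R[i].

Definition sq f : \bar R := (\int[m]_x (normc (f x) ^+ 2)%:E)%E.
Definition L2 f : Prop := cmeas f /\ (sq f < +oo)%E.
(** The square of the L2 norm as a real number; outside L2 it is the default value 0. Working with
    squares avoids roots, at the price of the factors 2 in [N2D] and [N2_trian]. *)
Definition N2 f : R := fine (sq f).
Definition inner f g : R[i] := cint m (fun x => f x * (g x)^*).

Lemma sq_ge0 f : (0 <= sq f)%E.
Proof. by apply: integral_ge0 => x _; rewrite lee_fin sqr_ge0. Qed.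
Hint Resolve sq_ge0 : core.

Lemma N2_ge0 f : 0 <= N2 f. Proof. exact: fine_ge0. Qed.

Lemma sqE f : L2 f -> sq f = (N2 f)%:E.
Proof. by move=> [_ h]; rewrite /N2 fineK// ge0_fin_numE. Qed.

Lemma measurable_sq f : cmeas f ->
  measurable_fun setT (fun x => (normc (f x) ^+ 2)%:E).
Proof.
move=> mf; apply/measurable_EFinP; apply: measurable_funX; exact: cmeas_normc.
Qed.
Hint Resolve measurable_sq : core.

Lemma sq_le f g : cmeas f -> cmeas g ->
  (forall x, normc (f x) <= normc (g x)) -> (sq f <= sq g)%E.
Proof.
move=> mf mg h; apply: ge0_le_integral => //; do ?exact: measurable_sq.
- by move=> x _; rewrite lee_fin sqr_ge0.
- by move=> x _; rewrite lee_fin lerXn2r ?nnegrE ?normc_ge0.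
Qed.

Lemma sqZ z f : cmeas f ->
  sq (fun x => z * f x) = ((normc z ^+ 2)%:E * sq f)%E.
Proof.
move=> mf; rewrite /sq -ge0_integralZl//.
- by apply: eq_integral => x _; rewrite normcM exprMn EFinM.
- exact: measurable_sq.
- by move=> x _; rewrite lee_fin sqr_ge0.
- by rewrite lee_fin sqr_ge0.
Qed.

Lemma sqD f g : cmeas f -> cmeas g ->
  (sq (fun x => (f x + g x)%R) <= 2%:E * sq f + 2%:E * sq g)%E.
Proof.
move=> mf mg.
have h (k : T -> R[i]) : cmeas k ->
    (2%:E * sq k = \int[m]_x (2 * normc (k x) ^+ 2)%:E)%E.
  move=> mk; rewrite /sq -ge0_integralZl//.
    exact: measurable_sq.
  by move=> x _; rewrite lee_fin sqr_ge0.
rewrite !h// -ge0_integralD//; last 4 first.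
- by move=> x _; rewrite lee_fin mulr_ge0 ?sqr_ge0.
- by apply/measurable_EFinP/measurable_funM => //; apply: measurable_funX; exact: cmeas_normc.
- by move=> x _; rewrite lee_fin mulr_ge0 ?sqr_ge0.
- by apply/measurable_EFinP/measurable_funM => //; apply: measurable_funX; exact: cmeas_normc.
apply: ge0_le_integral => //.
- by move=> x _; rewrite lee_fin sqr_ge0.
- by apply: measurable_sq; exact: cmeasD.
- by apply: emeasurable_funD; apply/measurable_EFinP/measurable_funM => //; apply: measurable_funX; exact: cmeas_normc.
- by move=> x _; rewrite lee_fin normc_sqrD.
Qed.

Lemma L2D f g : L2 f -> L2 g -> L2 (fun x => f x + g x).
Proof.
move=> [mf lf] [mg lg]; split; first exact: cmeasD.
apply: le_lt_trans (sqD mf mg) _.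
by rewrite lte_add_pinfty// lte_mul_pinfty// lee_fin.
Qed.
Lemma L2Z z f : L2 f -> L2 (fun x => z * f x).
Proof.
move=> [mf lf]; split; first exact: cmeasZ.
by rewrite sqZ// lte_mul_pinfty// lee_fin sqr_ge0.
Qed.
Lemma sqN f : sq (fun x => - f x) = sq f.
Proof. by apply: eq_integral => x _; rewrite normcN. Qed.
Lemma sqJ f : sq (fun x => (f x)^*) = sq f.
Proof. by apply: eq_integral => x _; rewrite normcJ. Qed.
Lemma L2N f : L2 f -> L2 (fun x => - f x).
Proof. by move=> [mf lf]; split; [exact: cmeasN|rewrite sqN]. Qed.
Lemma L2B f g : L2 f -> L2 g -> L2 (fun x => f x - g x).
Proof. by move=> a b; apply: L2D => //; exact: L2N. Qed.
Lemma L2J f : L2 f -> L2 (fun x => (f x)^*).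
Proof. by move=> [mf lf]; split; [exact: cmeasJ|rewrite sqJ]. Qed.
Lemma L2_0 : L2 (fun=> 0).
Proof.
split; first exact: cmeas_cst.
by rewrite /sq; under eq_integral do rewrite normc0 expr0n/=; rewrite integral0.
Qed.
Lemma L2_sum (I : Type) (r : seq I) (P : pred I) (F : I -> T -> R[i]) :
  (forall i, L2 (F i)) -> L2 (fun x => \sum_(i <- r | P i) F i x).
Proof.
move=> h; elim: r => [|i r IH].
  by under eq_fun do rewrite big_nil; exact: L2_0.
under eq_fun do rewrite big_cons.
by case: (P i) => //; exact: L2D.
Qed.
Lemma L2_le f g : cmeas f -> L2 g -> (forall x, normc (f x) <= normc (g x)) -> L2 f.
Proof. by move=> mf [mg lg] h; split => //; apply: le_lt_trans lg; exact: sq_le. Qed.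
Lemma L2_bounded (C : R) f g : cmeas f -> L2 g ->
  (forall x, normc (f x) <= C * normc (g x)) -> L2 f.
Proof.
move=> mf Lg h; apply: (L2_le mf (L2Z C%:C Lg)) => x.
rewrite normcM normc_real (le_trans (h x))// ler_wpM2r ?normc_ge0// ler_norm//.
Qed.

Lemma N2D f g : L2 f -> L2 g ->
  N2 (fun x => f x + g x) <= 2 * N2 f + 2 * N2 g.
Proof.
move=> Lf Lg; rewrite -lee_fin EFinD !EFinM -!sqE//; last exact: L2D.
by apply: sqD; [exact: Lf.1|exact: Lg.1].
Qed.
Lemma N2Z z f : L2 f -> N2 (fun x => z * f x) = normc z ^+ 2 * N2 f.
Proof.
move=> Lf; apply: EFin_inj; rewrite EFinM -!sqE ?sqZ//; first exact: Lf.1.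
exact: L2Z.
Qed.
Lemma N2N f : N2 (fun x => - f x) = N2 f.
Proof. by rewrite /N2 sqN. Qed.
Lemma N2J f : N2 (fun x => (f x)^*) = N2 f.
Proof. by rewrite /N2 sqJ. Qed.
Lemma N2BC f g : N2 (fun x => f x - g x) = N2 (fun x => g x - f x).
Proof.
rewrite -N2N; congr N2; apply/funext => x; rewrite opprB//.
Qed.
Lemma N2B f g : L2 f -> L2 g ->
  N2 (fun x => f x - g x) <= 2 * N2 f + 2 * N2 g.
Proof. by move=> Lf Lg; apply: le_trans (N2D Lf (L2N Lg)) _; rewrite N2N. Qed.
Lemma N2_trian f g h : L2 f -> L2 g -> L2 h -> N2 (fun x => f x - h x) <=
  2 * N2 (fun x => f x - g x) + 2 * N2 (fun x => g x - h x).
Proof.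
move=> Lf Lg Lh.
have := N2D (L2B Lf Lg) (L2B Lg Lh); apply: le_trans.
rewrite le_eqVlt; apply/orP; left; apply/eqP; congr N2.
by apply/funext => x; rewrite addrA subrK.
Qed.

Lemma cintg_mulJ f g : L2 f -> L2 g -> cintg m (fun x => f x * (g x)^*).
Proof.
move=> Lf Lg; have [mf lf] := Lf; have [mg lg] := Lg.
have ii (k : T -> R[i]) : L2 k -> m.-integrable setT (fun x => (normc (k x) ^+ 2)%:E).
  move=> [mk lk]; apply/integrableP; split; first exact: measurable_sq.
  by under eq_integral do rewrite gee0_abs ?lee_fin ?sqr_ge0//.
apply: (@cintg_le _ _ _ _ _ (fun x => normc (f x) ^+ 2 + normc (g x) ^+ 2)).
- by apply: cmeasM => //; exact: cmeasJ.
- exact: (integrableD measurableT (ii _ Lf) (ii _ Lg)).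
- move=> x; rewrite normcM normcJ.
  have := sqr_ge0 (normc (f x) - normc (g x)).
  have := normc_ge0 (f x); have := normc_ge0 (g x); nra.
Qed.
Lemma cintg_mul f g : L2 f -> L2 g -> cintg m (fun x => f x * g x).
Proof.
move=> Lf Lg; have := cintg_mulJ Lf (L2J Lg).
by under eq_fun do rewrite conjc_conjc.
Qed.

Lemma integrable_normM f g : L2 f -> L2 g ->
  m.-integrable setT (fun x => (normc (f x) * normc (g x))%:E).
Proof.
move=> Lf Lg; have := cintg_normc (cintg_mul Lf Lg).
by under eq_fun do rewrite normcM.
Qed.

(** The arithmetic-geometric form of the discriminant criterion. For A > 0 the choice s = x / A
    gives 2x <= x + AB/x at once; for A = 0 the choice s = (B + 1) / x would force 2x <= xB/(B + 1),
    impossible for x > 0. *)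
Lemma discr_le (x A B : R) : 0 <= x -> 0 <= A -> 0 <= B ->
  (forall s, 0 < s -> 2 * x <= s * A + B / s) -> x ^+ 2 <= A * B.
Proof.
move=> x0 A0 B0 h.
have [->|xn0] := eqVneq x 0; first by rewrite expr0n mulr_ge0.
have xp : 0 < x by rewrite lt_neqAle eq_sym xn0.
have [A00|An0] := eqVneq A 0.
  have sp : 0 < (B + 1) / x by rewrite divr_gt0// ltr_wpDl.
  have := h _ sp; rewrite A00 mulr0 add0r invf_div mulrA ler_pdivlMr ?ltr_wpDl//.
  nra.
have Ap : 0 < A by rewrite lt_neqAle eq_sym An0.
have := h _ (divr_gt0 xp Ap); rewrite divfK ?gt_eqF// invf_div mulrA.
have -> : 2 * x = x + x by ring.
rewrite lerD2l ler_pdivlMr// expr2 mulrC [A * B]mulrC; lra.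
Qed.

(** Integrate the pointwise inequality 2pq <= s p^2 + q^2/s and optimise over s by [discr_le]. *)
Lemma int_normM_le f g : L2 f -> L2 g ->
  fine (\int[m]_x (normc (f x) * normc (g x))%:E)%E ^+ 2 <= N2 f * N2 g.
Proof.
move=> Lf Lg; have [mf lf] := Lf; have [mg lg] := Lg.
set I := fine _.
have I0 : 0 <= I.
  by apply: fine_ge0; apply: integral_ge0 => x _; rewrite lee_fin mulr_ge0 ?normc_ge0.
have IE : (I%:E = \int[m]_x (normc (f x) * normc (g x))%:E)%E.
  by rewrite fineK//; apply: integrable_fin_num => //; exact: integrable_normM.
apply: discr_le => //; [exact: N2_ge0|exact: N2_ge0|move=> s s0].
rewrite -lee_fin EFinD !EFinM -!sqE// IE [X in (_ <= _ + X)%E]muleC.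
have s1 : 0 <= s^-1 by rewrite invr_ge0 ltW.
rewrite /sq -!ge0_integralZl//; do ?exact: measurable_sq; do ?[exact: ltW];
  do ?[by rewrite lee_fin ltW]; do ?[by move=> x _; rewrite lee_fin sqr_ge0];
  do ?[by move=> x _; rewrite lee_fin mulr_ge0 ?normc_ge0];
  do ?[by apply/measurable_EFinP/measurable_funM; exact: cmeas_normc].
have mZ (c : R) (k : T -> R[i]) : cmeas k ->
    measurable_fun setT (fun x => (c%:E * (normc (k x) ^+ 2)%:E)%E).
  move=> mk; apply: emeasurable_funM => //; exact: measurable_sq.
have Z0 (c : R) (k : T -> R[i]) (x : T) : 0 <= c ->
    (0 <= c%:E * (normc (k x) ^+ 2)%:E)%E.
  by move=> c0; rewrite mule_ge0 ?lee_fin ?sqr_ge0.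
rewrite -ge0_integralD//; last 4 first.
- by move=> x _; apply: Z0; exact: ltW.
- exact: mZ.
- by move=> x _; apply: Z0; rewrite invr_ge0; exact: ltW.
- exact: mZ.
apply: ge0_le_integral => //.
- by move=> x _; rewrite -EFinM lee_fin !mulr_ge0 ?normc_ge0.
- by apply: emeasurable_funM => //; apply/measurable_EFinP/measurable_funM; exact: cmeas_normc.
- by apply: emeasurable_funD; exact: mZ.
move=> x _; rewrite -!EFinM -EFinD lee_fin.
set p := normc _; set q := normc _.
have -> : s * p ^+ 2 + s^-1 * q ^+ 2 = 2 * (p * q) + s * (p - q / s) ^+ 2.
  by field; rewrite gt_eqF.
by rewrite lerDl mulr_ge0 ?sqr_ge0// ltW.
Qed.

Lemma normc_int_le f g : L2 f -> L2 g ->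
  normc (cint m (fun x => f x * g x)) ^+ 2 <= N2 f * N2 g.
Proof.
move=> Lf Lg; apply: le_trans (int_normM_le Lf Lg).
rewrite lerXn2r ?nnegrE ?normc_ge0//.
  by apply: fine_ge0; apply: integral_ge0 => x _; rewrite lee_fin mulr_ge0 ?normc_ge0.
rewrite -lee_fin fineK; last first.
  by apply: integrable_fin_num => //; exact: integrable_normM.
apply: le_trans (cint_normc_le (cintg_mul Lf Lg)) _.
by under eq_integral do rewrite normcM.
Qed.

Lemma CS f g : L2 f -> L2 g -> normc (inner f g) ^+ 2 <= N2 f * N2 g.
Proof. by move=> Lf Lg; rewrite -(N2J g); apply: normc_int_le => //; exact: L2J. Qed.

Lemma innerBl f g h : L2 f -> L2 g -> L2 h ->
  inner (fun x => f x - g x) h = inner f h - inner g h.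
Proof.
move=> Lf Lg Lh; rewrite /inner -cintB; try exact: cintg_mulJ.
by apply: eq_cint => x; rewrite mulrBl.
Qed.
Lemma innerZr f (z : R[i]) g : L2 f -> L2 g ->
  inner f (fun x => z * g x) = z^* * inner f g.
Proof.
move=> Lf Lg; rewrite /inner -cintZ; last exact: cintg_mulJ.
by apply: eq_cint => x; rewrite conjcM mulrCA.
Qed.
Lemma inner_sumr (I : Type) (r : seq I) f (F : I -> T -> R[i]) :
  L2 f -> (forall i, L2 (F i)) ->
  inner f (fun x => \sum_(i <- r) F i x) = \sum_(i <- r) inner f (F i).
Proof.
move=> Lf LF; rewrite /inner -cint_sum; last by move=> i; exact: cintg_mulJ.
by apply: eq_cint => x; rewrite conjc_sum mulr_sumr.
Qed.
Lemma inner_self f : L2 f -> inner f f = (N2 f)%:C.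
Proof.
move=> Lf; rewrite /inner; under eq_fun do rewrite mulcJ.
by rewrite /cint /=; apply: cext => //=; rewrite Rintegral_cst// mul0r.
Qed.

Lemma sq_ae f g : cmeas f -> cmeas g -> {ae m, forall x, f x = g x} -> sq f = sq g.
Proof.
move=> mf mg h; apply: ae_eq_integral => //; do ?exact: measurable_sq.
by apply: filterS h => x /= ->.
Qed.

Lemma inner_aer f g h : cmeas f -> cmeas g -> cmeas h ->
  {ae m, forall x, g x = h x} -> inner f g = inner f h.
Proof.
move=> mf mg mh e; apply: cint_ae.
- by apply: cmeasM => //; exact: cmeasJ.
- by apply: cmeasM => //; exact: cmeasJ.
- by apply: filterS e => x ->.
Qed.

Lemma N2_eq0 f : L2 f -> N2 f = 0 -> {ae m, forall x, f x = 0}.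
Proof.
move=> Lf N0; have := sqE Lf; rewrite N0 => h.
have := (@ae_eq_integral_abs _ _ _ m setT measurableT (fun x => (normc (f x) ^+ 2)%:E) (measurable_sq Lf.1)).1.
under eq_integral do rewrite gee0_abs ?lee_fin ?sqr_ge0//.
move=> /(_ h); apply: filterS => x /(_ I) /= -[] /eqP.
by rewrite sqrf_eq0 => /eqP/eq0_normc.
Qed.

End square_integrable.
#[global] Hint Resolve sq_ge0 : core.

(** * Density of test functions *)

Section square_dominated.
Context d (T : measurableType d) (R : realType) (m : {measure set T -> \bar R}).

Lemma integrable_sq (h : T -> R[i]) : L2 m h ->
  m.-integrable setT (fun x => (normc (h x) ^+ 2)%:E).
Proof.
move=> [mk lk]; apply/integrableP; split; first exact: measurable_sq.
by under eq_integral do rewrite gee0_abs ?lee_fin ?sqr_ge0//.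
Qed.

Lemma N2_dct (F : nat -> T -> R[i]) (f h : T -> R[i]) :
  (forall n, cmeas (F n)) -> cmeas f -> L2 m h ->
  (forall x, normc (f x) <= normc (h x)) ->
  (forall n x, normc (F n x) <= normc (h x)) ->
  {ae m, forall x, ccvg (F ^~ x) (f x)} ->
  N2 m (fun x => F n x - f x) @[n --> \oo] --> 0.
Proof.
move=> mF mf Lh fh Fh cF; apply: fine_cvg => /=.
(* The dominating function is 4|h|^2, since |F n - f| is at most 2|h|. *)
have := @dominated_convergence _ _ _ m setT measurableT
  (fun n x => (normc (F n x - f x) ^+ 2)%:E) (fun=> 0%E)
  (fun x => (4 * normc (h x) ^+ 2)%:E).
case.
- by move=> n; apply: measurable_sq; exact: cmeasB.
- exact: measurable_cst.
- apply: filterS cF => x /ccvgP c _; apply: cvg_EFin; first exact: nearW.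
  rewrite (_ : _ \o _ = fun n => normc (F n x - f x) * normc (F n x - f x)).
    by rewrite -(mulr0 0); exact: cvgM.
  by apply/funext => n /=; rewrite expr2.
- by have := integrableZl measurableT 4 (integrable_sq Lh).
- apply: aeW => x n _; rewrite gee0_abs ?lee_fin ?sqr_ge0//.
  have := normcB (F n x) (f x); have := fh x; have := Fh n x.
  have := normc_ge0 (F n x - f x); have := normc_ge0 (h x); nra.
by move=> _ _; rewrite integral0.
Qed.

End square_dominated.

Section linear_maps.
Context {R : realType} {d : nat}.
Local Notation Rd := 'cV[R]_d.
Local Notation mu := (lebesgue_cV R d).
Variables (U : 'M[R]_d) (v : Rd).
Hypothesis U0 : \det U != 0.

Lemma cmeas_linear (f : Rd -> R[i]) : cmeas f -> cmeas (fun x => f (U *m x + v)).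
Proof.
by move=> [a b]; split; [apply: measurableT_comp a _|apply: measurableT_comp b _];
  exact: measurable_linear.
Qed.

Lemma sq_linear (f : Rd -> R[i]) : cmeas f ->
  sq mu (fun x => f (U *m x + v)) = ((`|\det U|^-1)%:E * sq mu f)%E.
Proof.
move=> mf.
rewrite /sq (ge0_integral_linear v (F := fun x => (normc (f x) ^+ 2)%:E) U0)//.
  exact: measurable_sq.
by move=> x; rewrite lee_fin sqr_ge0.
Qed.

Lemma L2_linear (f : Rd -> R[i]) : L2 mu f -> L2 mu (fun x => f (U *m x + v)).
Proof.
move=> [mf lf]; split; first exact: cmeas_linear.
by rewrite sq_linear// lte_mul_pinfty// lee_fin invr_ge0.
Qed.

Lemma N2_linear (f : Rd -> R[i]) : L2 mu f ->
  N2 mu (fun x => f (U *m x + v)) = `|\det U|^-1 * N2 mu f.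
Proof.
move=> Lf; apply: EFin_inj.
by rewrite EFinM -!sqE ?sq_linear//; [exact: Lf.1|exact: L2_linear].
Qed.

Lemma Rintegral_linear (h : Rd -> R) :
  mu.-integrable setT (fun x => (h x)%:E) ->
  mu.-integrable setT (fun x => (h (U *m x + v))%:E) /\
  \int[mu]_x h (U *m x + v) = `|\det U|^-1 * \int[mu]_x h x.
Proof.
move=> ih; have mh := measurable_int _ ih.
have mhU : measurable_fun setT (fun x => (h (U *m x + v))%:E).
  by apply: (measurableT_comp mh); exact: measurable_linear.
have ihU : mu.-integrable setT (fun x => (h (U *m x + v))%:E).
  apply/integrableP; split => //.
  rewrite (ge0_integral_linear v (F := fun x => `|(h x)%:E|%E) U0)//.
    move/integrableP : ih => [_ lh].
    by rewrite lte_mul_pinfty// lee_fin invr_ge0.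
  exact: measurableT_comp.
split => //; apply: EFin_inj; rewrite EFinM /Rintegral.
rewrite !fineK; try exact: integrable_fin_num.
rewrite [LHS]integralE [X in (_ * X)%E]integralE.
rewrite muleBr//; last first.
  rewrite fin_num_adde_defr//.
  apply: integrable_fin_num => //; exact: integrable_funepos.
rewrite -(ge0_integral_linear v (F := (fun x => (h x)%:E)^\+%E) U0)//; last exact: measurable_funepos.
rewrite -(ge0_integral_linear v (F := (fun x => (h x)%:E)^\-%E) U0)//; last exact: measurable_funeneg.
by congr (_ - _)%E; apply: eq_integral => x _; rewrite !unlock.
Qed.

Lemma cintg_linear (f : Rd -> R[i]) : cintg mu f -> cintg mu (fun x => f (U *m x + v)).
Proof.
by move=> [a b]; split;
  [exact: (Rintegral_linear (h := fun x => complex.Re (f x)) a).1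
  |exact: (Rintegral_linear (h := fun x => complex.Im (f x)) b).1].
Qed.

Lemma cint_linear (f : Rd -> R[i]) : cintg mu f ->
  cint mu (fun x => f (U *m x + v)) = (`|\det U|^-1)%:C * cint mu f.
Proof.
move=> [a b]; apply: cext; rewrite !ReImE /= mul0r ?subr0 ?addr0.
  exact: (Rintegral_linear (h := fun x => complex.Re (f x)) a).2.
exact: (Rintegral_linear (h := fun x => complex.Im (f x)) b).2.
Qed.

Lemma ae_linear (P : Rd -> Prop) : {ae mu, forall x, P x} ->
  {ae mu, forall x, P (U *m x + v)}.
Proof.
move=> [N [mN N0 PN]].
exists ((fun x => U *m x + v) @^-1` N); split.
- exact: measurable_preimage (measurable_linear _ _) mN.
- have mN' := measurable_preimage (measurable_translation v) mN.
  rewrite (_ : _ @^-1` _ = (fun x => U *m x) @^-1` ((fun x => x + v) @^-1` N))//.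
  by rewrite scales_unit// lebesgue_cV_translation// N0 mule0.
- by move=> x /= nP; exact: PN.
Qed.

End linear_maps.

Section density.
Import HBNNSimple.
Context {R : realType} {d : nat}.
Local Notation Rd := 'cV[R]_d.
Local Notation mu := (lebesgue_cV R d).

(* Test functions are bounded with bounded support and sequentially continuous
   for coordinatewise convergence; only these properties are ever used. *)
Definition seqcont (f : Rd -> R[i]) := forall (u : nat -> Rd) (x : Rd),
  (forall i, u n i ord0 @[n --> \oo] --> x i ord0) -> ccvg (f \o u) (f x).

Definition bsupp (f : Rd -> R[i]) := exists B : R, forall x, ~ cube d B x -> f x = 0.

Definition test_fun (f : Rd -> R[i]) := [/\ cmeas f,
  (exists C : R, forall x, normc (f x) <= C), bsupp f & seqcont f].

Lemma measurable_cube (k : R) : measurable (cube d k).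
Proof. exact: measurable_box. Qed.

Definition cindic (A : set Rd) : Rd -> R[i] := fun x => (\1_A x)%:C.

Lemma cmeas_cindic A : measurable A -> cmeas (cindic A).
Proof. by move=> mA; apply: cmeas_real; exact: measurable_indic. Qed.

Lemma sq_cindic A : measurable A -> sq mu (cindic A) = mu A.
Proof.
move=> mA; rewrite -(integral_indicT mu mA); apply: eq_integral => x _.
by rewrite /cindic normc_real indicE; case: (_ \in _); rewrite ?normr1 ?normr0 ?expr1n ?expr0n.
Qed.

Lemma cube_lty (k : R) : (mu (cube d k) < +oo)%E.
Proof. by rewrite lebesgue_cV_boxE ltry. Qed.

Lemma L2_cindic A : measurable A -> (mu A < +oo)%E -> L2 mu (cindic A).
Proof. by move=> mA lA; split; [exact: cmeas_cindic|rewrite sq_cindic]. Qed.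

Lemma cube_le (k l : R) : k <= l -> cube d k `<=` cube d l.
Proof. by move=> kl x /cubeE h; apply/cubeE => i; exact: le_trans kl. Qed.

Lemma bounded_supp_L2 f : cmeas f -> (exists C : R, forall x, normc (f x) <= C) ->
  bsupp f -> L2 mu f.
Proof.
move=> mf [C fC] [B fB].
apply: (@L2_bounded _ _ _ _ C f (cindic (cube d B))) => //.
  by apply: L2_cindic; [exact: measurable_cube|exact: cube_lty].
move=> x; rewrite /cindic normc_real indicE.
have [xB|/negP xB] := boolP (x \in cube d B).
  by rewrite normr1 mulr1.
by rewrite fB ?normc0 ?normr0 ?mulr0// => xB'; apply: xB; rewrite inE.
Qed.

Lemma L2_bsupp_cintg f : L2 mu f -> bsupp f -> cintg mu f.
Proof.
move=> Lf [B fB].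
have Lc : L2 mu (cindic (cube d B)).
  by apply: L2_cindic; [exact: measurable_cube|exact: cube_lty].
have := cintg_mul Lf Lc; congr cintg; apply/funext => x.
rewrite /cindic indicE; have [xB|/negP xB] := boolP (x \in cube d B).
  by rewrite mulr1.
by rewrite fB ?mul0r// => xB'; apply: xB; rewrite inE.
Qed.

Lemma test_L2 f : test_fun f -> L2 mu f.
Proof. by move=> [a b c _]; exact: bounded_supp_L2. Qed.

Lemma test_cintg f : test_fun f -> cintg mu f.
Proof. by move=> tf; apply: L2_bsupp_cintg; [exact: test_L2|case: tf]. Qed.

Lemma testD f g : test_fun f -> test_fun g -> test_fun (fun x => f x + g x).
Proof.
move=> [a [C b] [B c] e] [a' [C' b'] [B' c'] e']; split.
- exact: cmeasD.
- by exists (C + C') => x; apply: le_trans (le_normcD _ _) _; exact: lerD.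
- exists (Num.max B B') => x xB; rewrite c ?c' ?addr0//.
    by apply: contra_not xB; apply: cube_le; rewrite le_max lexx orbT.
  by apply: contra_not xB; apply: cube_le; rewrite le_max lexx.
- by move=> u x ux; apply: ccvgD; [exact: e|exact: e'].
Qed.

Lemma testZ z f : test_fun f -> test_fun (fun x => z * f x).
Proof.
move=> [a [C b] [B c] e]; split.
- exact: cmeasZ.
- by exists (normc z * C) => x; rewrite normcM ler_wpM2l ?normc_ge0.
- by exists B => x xB; rewrite c ?mulr0.
- by move=> u x ux; apply: ccvgM; [exact: ccvg_cst|exact: e].
Qed.

(** The closure of the test functions in L2. It is enlarged from boxes to measurable sets, to
    nonnegative functions and finally to all of L2 in [L2_appr]. *)
Definition appr (f : Rd -> R[i]) := L2 mu f /\
  forall e : R, 0 < e -> exists g, test_fun g /\ N2 mu (fun x => f x - g x) < e.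

Lemma appr_test f : test_fun f -> appr f.
Proof.
move=> tf; split; first exact: test_L2.
move=> e e0; exists f; split => //.
rewrite /N2 /sq; under eq_integral do rewrite subrr normc0 expr0n/=.
by rewrite integral0.
Qed.

Lemma apprD f g : appr f -> appr g -> appr (fun x => f x + g x).
Proof.
move=> [Lf af] [Lg ag]; split; first exact: L2D.
move=> e e0; have e4 : 0 < e / 4 by rewrite divr_gt0.
have [f' [tf hf]] := af _ e4; have [g' [tg hg]] := ag _ e4.
exists (fun x => f' x + g' x); split; first exact: testD.
have -> : (fun x => f x + g x - (f' x + g' x)) =
    (fun x => (f x - f' x) + (g x - g' x)).
  by apply/funext => x; rewrite opprD addrACA.
have := N2D (L2B Lf (test_L2 tf)) (L2B Lg (test_L2 tg)).
lra.
Qed.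

Lemma apprZ z f : appr f -> appr (fun x => z * f x).
Proof.
move=> [Lf af]; split; first exact: L2Z.
move=> e e0; pose c := normc z ^+ 2 + 1.
have c0 : 0 < c by rewrite ltr_wpDl ?sqr_ge0.
have [f' [tf hf]] := af _ (divr_gt0 e0 c0).
exists (fun x => z * f' x); split; first exact: testZ.
have -> : (fun x => z * f x - z * f' x) = (fun x => z * (f x - f' x)).
  by apply/funext => x; rewrite mulrBr.
rewrite N2Z; last exact: L2B Lf (test_L2 tf).
move: hf; rewrite ltr_pdivlMr// mulrC; apply: le_lt_trans.
by rewrite /c mulrDl mul1r lerDl N2_ge0.
Qed.

Lemma appr_lim (F : nat -> Rd -> R[i]) f : L2 mu f -> (forall n, appr (F n)) ->
  N2 mu (fun x => F n x - f x) @[n --> \oo] --> 0 -> appr f.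
Proof.
move=> Lf aF h; split => // e e0; have e4 : 0 < e / 4 by rewrite divr_gt0.
move/cvgr0Pnorm_lt : h => /(_ _ e4) [n _ /(_ _ (leqnn n))].
rewrite ger0_norm ?N2_ge0// => hn.
have [LF /(_ _ e4) [g [tg hg]]] := aF n; exists g; split => //.
have := N2_trian Lf LF (test_L2 tg); rewrite (N2BC mu f (F n)).
lra.
Qed.

Definition ppart (t : R) := (t + `|t|) / 2.
Lemma ppart_id t : 0 <= t -> ppart t = t.
Proof. by move=> t0; rewrite /ppart ger0_norm//; lra. Qed.
Lemma ppart_eq0 t : t <= 0 -> ppart t = 0.
Proof. by move=> t0; rewrite /ppart ler0_norm// subrr mul0r. Qed.
Lemma ppart_ge0 t : 0 <= ppart t.
Proof. by rewrite /ppart; case: (ger0P t) => ?; lra. Qed.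
Hint Resolve ppart_ge0 : core.
Lemma ppart_cvg (u : nat -> R) (l : R) : u n @[n --> \oo] --> l ->
  ppart (u n) @[n --> \oo] --> ppart l.
Proof. by move=> h; apply: cvgMl; apply: cvgD => //; exact: cvg_norm. Qed.

(** A trapezoid: 1 on [a, b], with slope n + 1 outside, so it vanishes at distance 1/(n + 1) from
    the interval and tends pointwise to its indicator. *)
Definition trap (n : nat) (a b t : R) := ppart (1 - n.+1%:R * (ppart (a - t) + ppart (t - b))).

Lemma trap_le1 n a b t : 0 <= trap n a b t <= 1.
Proof.
rewrite ppart_ge0/= /trap; set q := _ * _.
have q0 : 0 <= q by rewrite mulr_ge0// addr_ge0 ?ppart_ge0.
have [h|h] := leP 0 (1 - q); first by rewrite ppart_id// gerBl.
by rewrite ppart_eq0 ?ltW.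
Qed.

Lemma trap_in n a b t : a <= t <= b -> trap n a b t = 1.
Proof.
move=> /andP[h1 h2]; rewrite /trap (ppart_eq0 (t := a - t)) ?subr_le0//.
by rewrite (ppart_eq0 (t := t - b)) ?subr_le0// addr0 mulr0 subr0 ppart_id.
Qed.

Lemma trap_out n a b t : a <= b -> 1 <= n.+1%:R * Num.max (a - t) (t - b) -> trap n a b t = 0.
Proof.
move=> ab h; apply: ppart_eq0; rewrite subr_le0; apply: le_trans h _.
rewrite ler_wpM2l// ge_max; apply/andP; split.
  have [/ppart_id ->|h] := leP 0 (a - t); first by rewrite lerDl ppart_ge0.
  by apply: (le_trans (ltW h)); rewrite addr_ge0 ?ppart_ge0.
have [/ppart_id ->|h] := leP 0 (t - b); first by rewrite lerDr ppart_ge0.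
by apply: (le_trans (ltW h)); rewrite addr_ge0 ?ppart_ge0.
Qed.

Lemma trap_cvg a b t : a <= b -> trap n a b t @[n --> \oo] --> ((a <= t <= b)%R%:R : R).
Proof.
move=> ab; have [h|h] := boolP (a <= t <= b).
  by under eq_fun do rewrite trap_in//; exact: cvg_cst.
have M0 : 0 < Num.max (a - t) (t - b).
  rewrite lt_max !subr_gt0; move: h; rewrite negb_and -!ltNge.
  by case/orP => ->; rewrite ?orbT.
pose N := Num.truncn (Num.max (a - t) (t - b))^-1.
apply: (@cvg_near_cst _ _ (0:R)); exists N => // n /= Nn.
rewrite trap_out//.
rewrite -ler_pdivrMr// div1r.
apply: (le_trans (ltW (truncnS_gt _))); rewrite ler_nat ltnS//.
Qed.

Lemma trap_seqcont n a b (u : nat -> R) t : u k @[k --> \oo] --> t ->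
  trap n a b (u k) @[k --> \oo] --> trap n a b t.
Proof.
move=> ut; apply: ppart_cvg; apply: cvgB; first exact: cvg_cst.
apply: cvgMr; apply: cvgD; apply: ppart_cvg.
  by apply: cvgB => //; exact: cvg_cst.
by apply: cvgB => //; exact: cvg_cst.
Qed.

Lemma trap_measurable n a b : measurable_fun setT (trap n a b).
Proof.
apply: continuous_measurable_fun.
have pc (f : R -> R) : continuous f -> continuous (fun t => ppart (f t)).
  move=> cf t; apply: cvgMl; apply: cvgD; first exact: cf.
  by apply: cvg_norm; exact: cf.
apply: (pc) => t; apply: cvgB; first exact: cvg_cst.
apply: cvgMr; apply: cvgD; apply: (pc _ _ t) => s.
  by apply: cvgB; [exact: cvg_cst|exact: cvg_id].
by apply: cvgB; [exact: cvg_id|exact: cvg_cst].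
Qed.

Lemma prod_le1 (F : 'I_d -> R) : (forall i, 0 <= F i <= 1) -> 0 <= \prod_i F i <= 1.
Proof.
move=> h; apply/andP; split; first by apply: prodr_ge0 => i _; case/andP: (h i).
apply: (@le_trans _ _ (\prod_(i < d) (1 : R))); last by rewrite big1.
by apply: ler_prod => i _.
Qed.

Lemma cvg_prod_seq (I : Type) (r : seq I) (F : I -> nat -> R) (l : I -> R) :
  (forall i, F i n @[n --> \oo] --> l i) ->
  \prod_(i <- r) F i n @[n --> \oo] --> \prod_(i <- r) l i.
Proof.
move=> h; elim: r => [|i r IH].
  by rewrite big_nil; under eq_fun do rewrite big_nil; exact: cvg_cst.
by rewrite big_cons; under eq_fun do rewrite big_cons; exact: cvgM.
Qed.

(** Products of trapezoids are test functions which converge pointwise to the indicator of the box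
    and live on a common cube, so dominated convergence applies. *)
Lemma appr_box a b : appr (cindic (cV_box a b)).
Proof.
have Lbox : L2 mu (cindic (cV_box a b)).
  by apply: L2_cindic; [exact: measurable_box|rewrite lebesgue_cV_boxE ltry].
have [/forallP ab|nab] := boolP [forall i, a i ord0 <= b i ord0]; last first.
  have := @appr_test (fun=> 0); have -> : cindic (cV_box a b) = fun=> 0.
    apply/funext => x; rewrite /cindic indicE memNset//.
    move/forallPn: nab => [i /negP nab] /(_ i) /=; rewrite in_itv/= => /andP[h1 h2].
    by apply: nab; exact: le_trans h2.
  apply; split.
  - exact: cmeas_cst.
  - by exists 0 => x; rewrite normc0.
  - by exists 0.
  - by move=> u x _; exact: ccvg_cst.
pose F n (x : Rd) : R[i] := (\prod_i trap n (a i ord0) (b i ord0) (x i ord0))%:C.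
have Fn1 n x : normc (F n x) <= 1.
  rewrite /F normc_real ger0_norm; [case/andP: (prod_le1 (fun i => trap_le1 n (a i ord0) (b i ord0) (x i ord0))) => //|].
  by case/andP: (prod_le1 (fun i => trap_le1 n (a i ord0) (b i ord0) (x i ord0))).
have mF n : cmeas (F n).
  apply: cmeas_real; apply: measurable_prod => i _.
  by apply: measurableT_comp; [exact: trap_measurable|exact: measurable_coord].
have [B HB] : exists B : R, forall n x, ~ cube d B x -> F n x = 0.
  (* Outside this cube some coordinate is at distance at least 1 from its interval, where every
     trapezoid is already zero, whatever its slope. *)
  pose B := \sum_i (`|a i ord0| + `|b i ord0|) + 1.
  exists B => n x xB.
  have [i hi] : exists i, B < `|x i ord0|.
    apply: contrapT => /forallNP h; apply: xB; apply/cubeE => i.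
    by rewrite leNgt; apply/negP; exact: h.
  rewrite /F (bigD1 i)//= trap_out ?mul0r//.
  have aB : `|a i ord0| + `|b i ord0| + 1 <= B.
    rewrite lerD2r (bigD1 i)//= lerDl.
    by apply: sumr_ge0 => j _; rewrite addr_ge0 ?ppart_ge0.
  have h1 : 1 <= Num.max (a i ord0 - x i ord0) (x i ord0 - b i ord0).
    rewrite le_max; move: hi aB; have := ler_norm (a i ord0); have := ler_norm (b i ord0).
    have := ler_norm (- a i ord0); have := ler_norm (- b i ord0); rewrite !normrN.
    case: (ger0P (x i ord0)) => ? ? ? ? ? ? ?; apply/orP; [right|left]; lra.
  apply: (le_trans h1); rewrite ler_peMl ?ler1n//.
  exact: le_trans h1.
apply: (@appr_lim F) => //.
  move=> n; apply: appr_test; split => //.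
  - by exists 1.
  - by exists B => x; exact: HB.
  - move=> u x ux; split => /=; last exact: cvg_cst.
    by apply: cvg_prod_seq => i; exact: trap_seqcont.
have box1 x : cV_box a b x -> forall n, F n x = 1.
  move=> xab n; rewrite /F big1// => i _; rewrite trap_in//.
  by have := xab i; rewrite in_itv.
apply: (@N2_dct _ _ _ mu F (cindic (cV_box a b)) (cindic (cube d B))).
- exact: mF.
- exact: cmeas_cindic (measurable_box _ _).
- by apply: L2_cindic; [exact: measurable_cube|exact: cube_lty].
- move=> x; rewrite /cindic !normc_real !indicE.
  have [xab|_] := boolP (x \in cV_box a b); last by rewrite normr0.
  rewrite mem_set//; apply: contrapT => xB; have := HB 0%N x xB.
  have bx : cV_box a b x by rewrite inE in xab.
  by rewrite (box1 x bx) => /eqP; rewrite oner_eq0.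
- move=> n x; have [xB|xB] := pselect (cube d B x).
    by rewrite /cindic normc_real indicE mem_set// normr1.
  by rewrite HB// normc0 normc_ge0.
- apply: aeW => x; split => /=; last exact: cvg_cst.
  have -> : \1_(cV_box a b) x = \prod_i ((a i ord0 <= x i ord0 <= b i ord0)%R%:R : R).
    rewrite indicE; have [xab|xab] := boolP (x \in cV_box a b).
      by rewrite big1// => i _; have := set_mem xab i; rewrite in_itv/= => ->.
    have [i hi] : exists i, ~~ (a i ord0 <= x i ord0 <= b i ord0).
      apply: contrapT => /forallNP h; move/negP: xab; apply; rewrite inE => i.
      by have := h i; rewrite in_itv/= => /negP; rewrite negbK.
    by rewrite (bigD1 i)//= (negbTE hi) mul0r.
  by apply: cvg_prod_seq => i; exact: trap_cvg.
Qed.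

Lemma N2_sub0 (f : Rd -> R[i]) : N2 mu (fun x => f x - f x) = 0.
Proof.
rewrite /N2 /sq; under eq_integral do rewrite subrr normc0 expr0n/=.
by rewrite integral0.
Qed.

Lemma cindic_setI A B x : cindic (A `&` B) x = cindic A x * cindic B x.
Proof. by rewrite /cindic indicI/= rmorphM. Qed.

Lemma cindicC A x : cindic (~` A) x = 1 - cindic A x.
Proof.
rewrite /cindic !indicE in_setC; case: (x \in A) => /=.
  by rewrite subrr.
by rewrite subr0.
Qed.

Lemma normc_cindic_le A B x : A `<=` B -> normc (cindic A x) <= normc (cindic B x).
Proof.
move=> AB; rewrite /cindic !normc_real !indicE.
have [xA|] := boolP (x \in A); last by rewrite normr0.
by rewrite mem_set//; apply: AB; rewrite inE in xA.
Qed.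

(** Dynkin induction from boxes. Intersecting with a cube keeps the measure finite, which is what
    makes complements and countable disjoint unions pass through [apprD] and [appr_lim]. *)
Lemma appr_measurable A : measurable A -> forall k : nat,
  appr (cindic (A `&` cube d k%:R)).
Proof.
rewrite measurable_cV_boxes; move: A.
apply: (dynkin_induction (P := fun A => forall k : nat,
  appr (cindic (A `&` cube d k%:R)))).
- exact: measurable_cV_boxes.
- move=> _ _ [a [b ->]] [a' [b' ->]]; rewrite cV_box_setI.
  by eexists; eexists; reflexivity.
- by move=> k; rewrite setTI; exact: appr_box.
- by move=> _ [a [b ->]] k; rewrite cV_box_setI; exact: appr_box.
- move=> A mA aA k.
  have -> : cindic (~` A `&` cube d k%:R) =
      fun x => cindic (cube d k%:R) x + (-1) * cindic (A `&` cube d k%:R) x.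
    by apply/funext => x; rewrite !cindic_setI cindicC mulN1r mulrBl mul1r.
  by apply: apprD; [exact: appr_box|exact: apprZ].
- move=> F mF tF aF k.
  pose G n := \big[setU/set0]_(i < n) F i.
  have mG n : measurable (G n) by exact: bigsetU_measurable.
  have Lc : L2 mu (cindic (cube d k%:R)).
    by apply: L2_cindic; [exact: measurable_cube|exact: cube_lty].
  have mU : measurable (\bigcup_i F i `&` cube d k%:R).
    by apply: measurableI; [exact: bigcup_measurable|exact: measurable_cube].
  apply: (@appr_lim (fun n => cindic (G n `&` cube d k%:R))).
  - apply: L2_le Lc _; first exact: cmeas_cindic.
    by move=> x; apply: normc_cindic_le => y [].
  - elim=> [|n IH].
      have -> : cindic (G 0%N `&` cube d k%:R) = fun x => 0 * cindic (cube d k%:R) x.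
        by apply/funext => x; rewrite /G big_ord0 set0I mul0r /cindic indicE in_set0.
      by apply: apprZ; exact: appr_box.
    have -> : cindic (G n.+1 `&` cube d k%:R) = fun x =>
       cindic (G n `&` cube d k%:R) x + cindic (F n `&` cube d k%:R) x.
      apply/funext => x; rewrite !cindic_setI -mulrDl; congr (_ * _).
      rewrite /G big_ord_recr/= /cindic -rmorphD/=; congr (_%:C).
      rewrite !indicE in_setU.
      have [xG|xG] := boolP (x \in \big[setU/set0]_(i < n) F i); last by rewrite add0r.
      have [xF|xF] := boolP (x \in F n); last by rewrite addr0.
      exfalso; move: xG xF; rewrite !inE -bigcup_mkord => -[i /= ilt Fi] Fn.
      have := (@trivIsetP _ _ _ _).1 tF i n Logic.I Logic.I.
      rewrite (ltn_eqF ilt) => /(_ isT); rewrite -subset0 => /(_ x); apply.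
      by split.
    exact: apprD.
  - apply: (@N2_dct _ _ _ _ _ _ (cindic (cube d k%:R))) => //.
    + by move=> n; apply: cmeas_cindic; apply: measurableI => //; exact: measurable_cube.
    + exact: cmeas_cindic.
    + by move=> x; apply: normc_cindic_le => y [].
    + by move=> n x; apply: normc_cindic_le => y [].
    + apply: aeW => x.
      have [[i _ Fi]|nF] := pselect ((\bigcup_i F i) x).
        split => /=; last exact: cvg_cst.
        apply: cvg_near_cst; exists i.+1 => // n /= ilt.
        rewrite !indicI/= !indicE; congr (_ * _).
        rewrite !mem_set//; first by exists i.
        by rewrite /G -bigcup_mkord; exists i.
      have -> : (fun n => cindic (G n `&` cube d k%:R) x) =
          fun=> cindic (\bigcup_i F i `&` cube d k%:R) x.
        apply/funext => n; rewrite /cindic !indicE !memNset// => -[Fx _]; apply: nF => //.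
        by move: Fx; rewrite /G -bigcup_mkord => -[i _ ?]; exists i.
      exact: ccvg_cst.
Qed.

Lemma appr_sum (I : Type) (r : seq I) (F : I -> Rd -> R[i]) :
  (forall i, appr (F i)) -> appr (fun x => \sum_(i <- r) F i x).
Proof.
move=> h; elim: r => [|i r IH].
  under eq_fun do rewrite big_nil.
  have := apprZ 0 (@appr_box 0 0); congr appr; apply/funext => x.
  by rewrite mul0r.
by under eq_fun do rewrite big_cons; exact: apprD.
Qed.

(** The increasing simple approximations of [h] are cut off to growing cubes, so each is a finite
    combination of sets covered by [appr_measurable]; [h] itself dominates. *)
Lemma appr_nonneg (h : Rd -> R) : (forall x, 0 <= h x) ->
  L2 mu (fun x => (h x)%:C) -> appr (fun x => (h x)%:C).
Proof.
move=> h0 Lh; have mh : measurable_fun setT (EFin \o h).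
  by apply/measurable_EFinP; exact: Lh.1.1.
pose s := nnsfun_approx measurableT mh.
have s_cvg x : s n x @[n --> \oo] --> h x.
  have h0' y : setT y -> (0%R <= (EFin \o h) y)%E by rewrite lee_fin.
  have H := @cvg_nnsfun_approx _ _ _ _ measurableT _ mh.
  by have /fine_cvg := H h0' x Logic.I.
have s_le n x : s n x <= h x.
  rewrite -(cvg_lim _ (s_cvg x))//.
  apply: (nondecreasing_cvgn_le (u_ := fun n => s n x)).
    by move=> i j ij; have /lefP := nd_nnsfun_approx measurableT mh ij; exact.
  by apply/cvg_ex; exists (h x); exact: s_cvg.
pose F n x : R[i] := (s n x)%:C * cindic (cube d n%:R) x.
have Fle n x : normc (F n x) <= normc (h x)%:C.
  rewrite normcM !normc_real ger0_norm ?fun_ge0// [leRHS]ger0_norm//.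
  apply: le_trans (s_le n x); rewrite ler_piMr ?fun_ge0// indicE.
  by case: (_ \in _); rewrite ?normr1 ?normr0.
have mF n : cmeas (F n).
  apply: cmeasM; first exact: cmeas_real.
  by apply: cmeas_cindic; exact: measurable_cube.
apply: (@appr_lim F) => //.
  move=> n.
  have -> : F n = fun x => \sum_(i < #|` fset_set (range (s n))|)
     ((fset_set (range (s n)))`_i)%:C *
     cindic (s n @^-1` [set (fset_set (range (s n)))`_i] `&` cube d n%:R) x.
    apply/funext => x; rewrite /F fimfunEord rmorph_sum/= mulr_suml.
    by apply: eq_bigr => i _; rewrite cindic_setI rmorphM mulrA.
  by apply: appr_sum => i; apply: apprZ; exact: appr_measurable.
apply: (N2_dct _ _ Lh) => //; first exact: Lh.1.
apply: aeW => x; rewrite -[(h x)%:C]mulr1; apply: ccvgM; first by split => //=; exact: cvg_cst.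
split => /=; last exact: cvg_cst.
apply: cvg_near_cst; have [k xk] := cV_norm_bound x; exists k => // n /= kn.
by rewrite indicE mem_set//; apply: cube_le xk; rewrite ler_nat.
Qed.

Lemma L2_real f (h : Rd -> R) : L2 mu f -> measurable_fun setT h ->
  (forall x, `|h x| <= normc (f x)) -> L2 mu (fun x => (h x)%:C).
Proof.
by move=> Lf mh hf; apply: (L2_le _ Lf) => [|x]; [exact: cmeas_real|rewrite normc_real].
Qed.

Lemma L2_appr f : L2 mu f -> appr f.
Proof.
move=> Lf; have [[mr mi] _] := Lf.
have key (h : Rd -> R) : measurable_fun setT h ->
    (forall x, `|h x| <= normc (f x)) -> appr (fun x => (h x)%:C).
  move=> mh hf.
  have -> : (fun x => (h x)%:C) =
      fun x => (ppart (h x))%:C + (-1) * (ppart (- h x))%:C.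
    apply/funext => x; rewrite mulN1r -rmorphB/=; congr (_%:C).
    by rewrite /ppart normrN; lra.
  have mp (k : Rd -> R) : measurable_fun setT k -> measurable_fun setT (fun x => ppart (k x)).
    move=> mk; apply: measurable_funM => //; apply: measurable_funD => //.
    exact: measurableT_comp.
  have pn t : `|ppart t| <= `|t|.
    rewrite ger0_norm ?ppart_ge0// /ppart; have := ler_norm t; lra.
  apply: apprD; last apply: apprZ; apply: appr_nonneg => [x|]; do ?exact: ppart_ge0.
    by apply: (L2_real Lf); [exact: mp|move=> x; exact: le_trans (pn _) (hf x)].
  apply: (L2_real Lf); first by apply: mp; exact: measurableT_comp.
  by move=> x; apply: le_trans (pn _) _; rewrite normrN.
have -> : f = fun x => (complex.Re (f x))%:C + 'i%C * (complex.Im (f x))%:C.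
  by apply/funext => x; exact: complexE.
apply: apprD; first by apply: key => // x; exact: Re_le_normc.
by apply: apprZ; apply: key => // x; exact: Im_le_normc.
Qed.

End density.

(** * The Fourier transform and Plancherel *)

Section product_integrals.
Context {R : realType}.
Local Notation leb := (@lebesgue_measure R).

Lemma cmeas_comp d1 d2 (T1 : measurableType d1) (T2 : measurableType d2)
  (f : T2 -> R[i]) (g : T1 -> T2) : cmeas f -> measurable_fun setT g ->
  cmeas (fun x => f (g x)).
Proof. by move=> [a b] mg; split; [exact: measurableT_comp a mg|exact: measurableT_comp b mg]. Qed.

Lemma Rintegral_cV_cons n (h : 'cV[R]_n.+1 -> R) : measurable_fun setT h ->
  (\int[leb]_t \int[lebesgue_cV R n]_x `|(h (cV_cons (t, x)))%:E| < +oo)%E ->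
  (lebesgue_cV R n.+1).-integrable setT (fun x => (h x)%:E) /\
  \int[lebesgue_cV R n.+1]_x h x =
  \int[leb]_t \int[lebesgue_cV R n]_x h (cV_cons (t, x)).
Proof.
move=> mh ih.
have mhE : measurable_fun setT (EFin \o h) by exact/measurable_EFinP.
have mc := @measurable_cV_cons _ R n.
have ip : (leb \x lebesgue_cV R n)%E.-integrable setT (EFin \o (fun z => h (cV_cons z))).
  apply/(@integrable12ltyP _ _ _ _ _ leb (lebesgue_cV R n)) => //.
  exact: measurableT_comp mhE mc.
have ih' : (lebesgue_cV R n.+1).-integrable setT (EFin \o h).
  apply/integrableP; split => //.
  by rewrite (ge0_integral_cV_cons (F := fun x => `|(h x)%:E|%E)) //;
    exact: measurableT_comp.
split => //.
rewrite [RHS](integrable_Rintegral1 ip).2 /Rintegral; congr fine.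
have -> : (\int[lebesgue_cV R n.+1]_x (h x)%:E =
  \int[pushforward (leb \x lebesgue_cV R n) (@cV_cons R n)]_x (EFin \o h) x)%E by [].
by rewrite integral_pushforward.
Qed.

Lemma cint_cV_cons n (F : 'cV[R]_n.+1 -> R[i]) : cmeas F ->
  (\int[leb]_t \int[lebesgue_cV R n]_x (normc (F (cV_cons (t, x))))%:E < +oo)%E ->
  cintg (lebesgue_cV R n.+1) F /\
  cint (lebesgue_cV R n.+1) F =
  cint leb (fun t => cint (lebesgue_cV R n) (fun x => F (cV_cons (t, x)))).
Proof.
move=> mF iF; have [mr mi] := mF.
have iF2 : (\int[leb]_t \int[lebesgue_cV R n]_x (normc (F (cV_cons (t, x))))%:E < +oo)%E by [].
have mn := cmeas_normc mF.
have cF : cintg (lebesgue_cV R n.+1) F.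
  apply: cintgP => //.
  rewrite (ge0_integral_cV_cons (F := fun x => (normc (F x))%:E)) //.
    exact/measurable_EFinP.
  by move=> x; rewrite lee_fin normc_ge0.
have key (h : 'cV[R]_n.+1 -> R) : measurable_fun setT h ->
    (forall x, `|h x| <= normc (F x)) ->
    \int[lebesgue_cV R n.+1]_x h x =
    \int[leb]_t \int[lebesgue_cV R n]_x h (cV_cons (t, x)).
  move=> mh hF; apply: (Rintegral_cV_cons mh _).2.
  have ih : (lebesgue_cV R n.+1).-integrable setT (EFin \o h).
    apply: (le_integrable _ _ _ (cintg_normc cF)) => //; first exact/measurable_EFinP.
    by move=> x _; rewrite abse_normc lee_fin.
  move/integrableP : ih => [_].
  by rewrite (ge0_integral_cV_cons (F := fun x => `|(h x)%:E|%E)) //;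
    apply: measurableT_comp => //; exact/measurable_EFinP.
split => //; apply: cext => /=.
  by apply: (key (fun x => complex.Re (F x))) => // x; exact: Re_le_normc.
by apply: (key (fun x => complex.Im (F x))) => // x; exact: Im_le_normc.
Qed.

Lemma cV_cons0 n (t : R) (x : 'cV[R]_n) : cV_cons (t, x) ord0 ord0 = t.
Proof. by rewrite mxE unlift_none. Qed.
Lemma cV_consS n (t : R) (x : 'cV[R]_n) i : cV_cons (t, x) (lift ord0 i) ord0 = x i ord0.
Proof. by rewrite mxE liftK. Qed.

Lemma cmeas_prod_coord n (g : 'I_n -> R -> R[i]) : (forall i, cmeas (g i)) ->
  cmeas (fun x : 'cV[R]_n => \prod_i g i (x i ord0)).
Proof.
move=> mg; elim: (index_enum _) => [|i r IH].
  by under eq_fun do rewrite big_nil; exact: cmeas_cst.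
under eq_fun do rewrite big_cons; apply: cmeasM => //.
by apply: cmeas_comp => //; exact: measurable_coord.
Qed.

(** Induction on the dimension, splitting off the first coordinate by Fubini. In dimension 0 the
    measure is a point mass and the empty product is 1. *)
Lemma cint_prod n (g : 'I_n -> R -> R[i]) : (forall i, cintg leb (g i)) ->
  cintg (lebesgue_cV R n) (fun x => \prod_i g i (x i ord0)) /\
  cint (lebesgue_cV R n) (fun x => \prod_i g i (x i ord0)) =
  \prod_i cint leb (g i).
Proof.
elim: n g => [|n IH] g ig.
  have -> : (fun x : 'cV[R]_0 => \prod_i g i (x i ord0)) = fun=> 1.
    by apply/funext => x; rewrite big_ord0.
  have i1 (r : R) : (\int[lebesgue_cV R 0]_x r%:E = r%:E)%E.
    by rewrite /= integral_dirac// diracT mul1e.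
  rewrite big_ord0; split.
    by split; apply/integrableP; split => //=; rewrite integral_dirac// diracT mul1e ltry.
  by apply: cext; rewrite /cint/= /Rintegral i1.
have mg i : cmeas (g i) := cintg_meas (ig i).
have [ih1 ih2] := IH (fun i => g (lift ord0 i)) (fun i => ig _).
pose G (x : 'cV[R]_n) := \prod_i g (lift ord0 i) (x i ord0).
have mG : cmeas G := cintg_meas ih1.
have FE t x : \prod_i g i (cV_cons (t, x) i ord0) = g ord0 t * G x.
  rewrite big_ord_recl cV_cons0; congr (_ * _).
  by apply: eq_bigr => i _; rewrite cV_consS.
have [|c1 c2] := @cint_cV_cons n (fun x => \prod_i g i (x i ord0)) (cmeas_prod_coord mg).
  have -> : (\int[leb]_t \int[lebesgue_cV R n]_x (normc (\prod_i g i (cV_cons (t, x) i ord0)))%:E)%E =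
    (\int[leb]_t ((normc (g ord0 t))%:E * \int[lebesgue_cV R n]_x (normc (G x))%:E))%E.
    apply: eq_integral => t _; rewrite -ge0_integralZl//.
    - by apply: eq_integral => x _; rewrite FE normcM EFinM.
    - by apply/measurable_EFinP/cmeas_normc.
    - by move=> x _; rewrite lee_fin normc_ge0.
    - by rewrite lee_fin normc_ge0.
  have G0 : (0 <= \int[lebesgue_cV R n]_x (normc (G x))%:E)%E.
    by apply: integral_ge0 => x _; rewrite lee_fin normc_ge0.
  rewrite ge0_integralZr//.
  - apply: lte_mul_pinfty.
    + by apply: integral_ge0 => x _; rewrite lee_fin normc_ge0.
    + rewrite ge0_fin_numE; first exact: cintg_normc_lty (ig _).
      by apply: integral_ge0 => x _; rewrite lee_fin normc_ge0.
    + exact: cintg_normc_lty.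
  - by apply/measurable_EFinP; exact: (cmeas_normc (mg ord0)).
  - by move=> t _; rewrite lee_fin normc_ge0.
split => //; rewrite c2 big_ord_recl -ih2.
rewrite mulrC -cintZ//; apply: eq_cint => t.
rewrite mulrC -cintZ//; apply: eq_cint => x; exact: FE.
Qed.

(** A one-factor instance of [cint_prod] identifies the integral on the line with the integral on
    1-dimensional column vectors, where [cint_linear] applies to the matrix -1. *)
Lemma cint_reflection (g : R -> R[i]) : cintg leb g ->
  cint leb (fun t : R => g (- t)) = cint leb g.
Proof.
move=> ig; have mg := cintg_meas ig.
have [c1 c2] := @cint_prod 1 (fun=> g) (fun=> ig).
have mgN : cmeas (fun t : R => g (- t)).
  by apply: cmeas_comp => //; exact: oppr_measurable.
have igN : cintg leb (fun t : R => g (- t)).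
  have U0 : \det ((-1)%:M : 'M[R]_1) != 0.
    by rewrite det_scalar expr1 oppr_eq0 oner_eq0.
  have := cintg_linear 0 U0 c1; set F := (X in cintg _ X) => cF.
  apply: cintgP => //.
  have := cintg_normc_lty cF.
  rewrite (ge0_integral_cV_cons (F := fun x => (normc (F x))%:E)) //; last 2 first.
  - by apply/measurable_EFinP/cmeas_normc; exact: (cintg_meas cF).
  - by move=> x; rewrite lee_fin normc_ge0.
  apply: le_lt_trans; rewrite le_eqVlt; apply/orP; left; apply/eqP.
  apply: eq_integral => t _; rewrite /= integral_dirac//.
    rewrite diracT mul1e /F big_ord1; congr (normc (g _))%:E.
    by rewrite addr0 mul_scalar_mx scaleN1r mxE cV_cons0.
  apply/measurable_EFinP/cmeas_normc.
  have -> : (fun x : 'cV[R]_0 => F (cV_cons (t, x))) = fun=> F (cV_cons (t, 0)).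
    by apply/funext => x; rewrite [x]flatmx0.
  exact: cmeas_cst.
have [d1 d2] := @cint_prod 1 (fun=> (fun t : R => g (- t))) (fun=> igN).
have U0 : \det ((-1)%:M : 'M[R]_1) != 0.
  by rewrite det_scalar expr1 oppr_eq0 oner_eq0.
move: c2 d2; rewrite !big_ord1 => <- <-.
have := cint_linear 0 U0 c1.
rewrite det_scalar expr1 normrN1 invr1 mul1r => <-.
apply: eq_cint => x; rewrite !big_ord1.
by rewrite addr0 mul_scalar_mx scaleN1r mxE.
Qed.

End product_integrals.

(** * An elementary Fourier pair on the line: exp(-|s|) and 2/(1 + t^2) *)

Section poisson_1d.
Context {R : realType}.
Local Notation leb := (@lebesgue_measure R).

Definition e1 (s : R) : R := expR (- `|s|).

Lemma e1_gt0 s : 0 < e1 s. Proof. exact: expR_gt0. Qed.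
Lemma e1_le1 s : e1 s <= 1.
Proof. by rewrite /e1 -[leRHS]expR0 ler_expR oppr_le0. Qed.

Lemma continuous_e1 : continuous e1.
Proof.
move=> x; apply: (@continuous_comp _ _ _ (fun s : R => - `|s|) expR); last exact: continuous_expR.
by apply: cvgN; apply: cvg_norm; exact: cvg_id.
Qed.

(** The summand 1 next to the cosine makes the integrand nonnegative, as required by the fundamental
    theorem of calculus on a half-line for nonnegative functions. It is subtracted again in
    [cint_pexp]. *)
Lemma e1_half (t : R) :
  (\int[leb]_(s in `[0%R, +oo[) (expR (- s) * (1 + cos (t * s)))%:E =
   (1 + (1 + t ^+ 2)^-1)%:E)%E.
Proof.
have t1 : 1 + t ^+ 2 != 0 by rewrite gt_eqF// ltr_pwDl// sqr_ge0.
(* This antiderivative vanishes at infinity, so the integral is - F 0. *)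
pose F (s : R) := expR (- s) * ((t * sin (t * s) - cos (t * s)) / (1 + t ^+ 2) - 1).
have dF (s : R) : is_derive s (1:R) F (expR (- s) * (1 + cos (t * s))).
  have d1 : is_derive s (1:R) (fun s => expR (- s)) (- expR (- s)).
    have h : is_derive s (1:R) (fun s => - s) (-1) by exact: is_deriveN.
    have := @is_derive1_comp _ expR (fun s => - s) s _ _ (is_derive_expR (- s)) h.
    by rewrite mulrN1.
  have dt : is_derive s (1:R) (fun s => t * s) t.
    have := @is_deriveZ _ _ _ (@idfun R) t s 1 1 (is_derive_id _ _).
    by rewrite /GRing.scale/= mulr1.
  have d2 : is_derive s (1:R) (fun s => sin (t * s)) (cos (t * s) * t).
    exact: (@is_derive1_comp _ sin (fun s => t * s) s _ _ (is_derive_sin _) dt).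
  have d3 : is_derive s (1:R) (fun s => cos (t * s)) (- sin (t * s) * t).
    exact: (@is_derive1_comp _ cos (fun s => t * s) s _ _ (is_derive_cos _) dt).
  have h := is_deriveM d1 (is_deriveB (is_deriveM (is_deriveB (is_deriveM (is_derive_cst (t : R) s (1 : R)) d2) d3) (is_derive_cst ((1 + t ^+ 2)^-1 : R) s (1 : R))) (is_derive_cst (1 : R) s (1 : R))).
  have [h1 h2] := h.
  have FE : F = (fun s => expR (- s)) * ((cst t * (fun s => sin (t * s)) -
    (fun s => cos (t * s))) * cst (1 + t ^+ 2)^-1 - cst 1) by apply/funext.
  rewrite FE; split; first exact: h1.
  apply: (etrans h2).
  transitivity (expR (- s) * ((t * sin (t * s) - cos (t * s)) * 0 +
    (1 + t ^+ 2)^-1 * (t * (cos (t * s) * t) + sin (t * s) * 0 - - sin (t * s) * t) - 0) +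
    ((t * sin (t * s) - cos (t * s)) * (1 + t ^+ 2)^-1 - 1) * - expR (- s)) => //.
  by field.
have cF : continuous F.
  move=> s; have [d _] := dF s.
  by apply/differentiable_continuous; rewrite -derivable1_diffP.
rewrite (@ge0_continuous_FTC2y _ _ F 0 0).
- rewrite /F mulr0 sin0 cos0 oppr0 expR0; congr (_%:E).
  by field.
- move=> x x0; apply: mulr_ge0; first exact: expR_ge0.
  by have := cos_geN1 (t * x); lra.
- apply: continuous_subspaceT => x; apply: cvgM.
    apply: (@continuous_comp _ _ _ (fun s : R => - s) expR); last exact: continuous_expR.
    by apply: cvgN; exact: cvg_id.
  apply: cvgD; first exact: cvg_cst.
  apply: (@continuous_comp _ _ _ (fun s : R => t * s) cos); last exact: continuous_cos.
  by apply: cvgMr; exact: cvg_id.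
- have e0 : expR (- x) @[x --> +oo] --> (0 : R) by exact: cvgr_expR.
  have c0 : (expR (- x) * (`|t| + 2)) @[x --> +oo] --> (0 : R).
    by rewrite -(mul0r (`|t| + 2)); exact: cvgMl.
  apply/cvgr0Pnorm_lt => e ep; move/cvgr0Pnorm_lt : c0 => /(_ e ep).
  apply: filterS => s; apply: le_lt_trans.
  rewrite /F !normrM ler_wpM2l//.
  rewrite [leRHS]ger0_norm ?addr_ge0//.
  apply: le_trans (ler_normB _ _) _; rewrite normr1.
  have -> : `|t| + 2 = (`|t| + 1) + 1 by ring.
  rewrite lerD2r normrM normfV [X in _ / X]ger0_norm ?addr_ge0 ?sqr_ge0//.
  rewrite ler_pdivrMr; last by rewrite ltr_pwDl// sqr_ge0.
  apply: (@le_trans _ _ (`|t| + 1)); last first.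
    by rewrite ler_peMr ?addr_ge0// lerDl sqr_ge0.
  apply: le_trans (ler_normB _ _) _; apply: lerD.
    by rewrite normrM ler_piMr// ler_norml sin_geN1 sin_le1.
  by rewrite ler_norml cos_geN1 cos_le1.
- by move=> x _; case: (dF x).
- by apply: cvg_at_right_filter; exact: cF.
- by move=> x _; rewrite derive1E; apply: derive_val.
Qed.

Lemma e1_cos1 (t : R) :
  (\int[leb]_s (e1 s * (1 + cos (t * s)))%:E =
   (2 * (1 + (1 + t ^+ 2)^-1))%:E)%E.
Proof.
rewrite (@ge0_symfun_integralT _ (fun s => e1 s * (1 + cos (t * s)))).
- rewrite -set_itvcy EFinM -(e1_half t); congr (_ * _)%E.
  apply: eq_integral => s; rewrite inE/= in_itv/= andbT => s0.
  by rewrite /e1 ger0_norm.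
- move=> x; apply: mulr_ge0; first exact: expR_ge0.
  by have := cos_geN1 (t * x); lra.
- move=> x; apply: cvgM; first exact: continuous_e1.
  apply: cvgD; first exact: cvg_cst.
  apply: (@continuous_comp _ _ _ (fun s : R => t * s) cos); last exact: continuous_cos.
  by apply: cvgMr; exact: cvg_id.
- by move=> x /=; rewrite /e1 normrN mulrN cosN.
Qed.

Lemma measurable_e1 : measurable_fun setT e1.
Proof. by apply: continuous_measurable_fun; exact: continuous_e1. Qed.

(** At t = 0 the formula of [e1_cos1] reads 2I = 4; the value I = +oo has to be excluded
    separately. *)
Lemma e1_int : (\int[leb]_s (e1 s)%:E = 2%:E)%E.
Proof.
have := e1_cos1 0.
under eq_integral do rewrite mul0r cos0 mulrC EFinM.
rewrite ge0_integralZl//; last 2 first.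
- by apply/measurable_EFinP; exact: measurable_e1.
- by move=> x _; rewrite lee_fin ltW// e1_gt0.
rewrite expr0n addr0 invr1.
have I0 : (0 <= \int[leb]_s (e1 s)%:E)%E by apply: integral_ge0 => x _; rewrite lee_fin ltW// e1_gt0.
case: (\int[leb]_s (e1 s)%:E)%E I0 => [r _| _|//].
  by move=> [h]; congr (_%:E); move: h; lra.
by rewrite gt0_muley// lte_fin; lra.
Qed.

Definition pexp (t s : R) : R[i] := (e1 s)%:C * expi (- (s * t)).

Lemma cintg_pexp t : cintg leb (pexp t).
Proof.
apply: cintgP.
  apply: cmeasM; first exact: cmeas_real measurable_e1.
  apply: cmeas_expi; apply: measurableT_comp => //; exact: measurable_funM.
under eq_integral do rewrite normcM normc_expi mulr1 normc_real ger0_norm ?ltW ?e1_gt0//.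
by rewrite e1_int ltry.
Qed.

(** The real part is [e1_cos1] minus [e1_int]. The imaginary part is zero because reflection turns
    the integrand into its conjugate. *)
Lemma cint_pexp t : cint leb (pexp t) = (2 / (1 + t ^+ 2))%:C.
Proof.
have ie : leb.-integrable setT (EFin \o e1).
  apply/integrableP; split; first by apply/measurable_EFinP; exact: measurable_e1.
  under eq_integral do rewrite /= ger0_norm ?ltW ?e1_gt0//.
  by rewrite e1_int ltry.
have [ir ii] := cintg_pexp t.
apply: cext => /=.
  have E : \int[leb]_s (e1 s + complex.Re (pexp t s)) = 2 * (1 + (1 + t ^+ 2)^-1).
    rewrite /Rintegral -[RHS]/(fine (2 * (1 + (1 + t ^+ 2)^-1))%:E) -e1_cos1; congr fine.
    apply: eq_integral => s _; congr (_%:E).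
    by rewrite /pexp ReM /= mul0r subr0 cosN mulrDr mulr1 [s * t]mulrC.
  move: E; rewrite RintegralD// {1}/Rintegral e1_int /= mulrDr mulr1.
  by move/addrI => ->.
have : (cint leb (pexp t))^* = cint leb (pexp t).
  rewrite -cintJ; last exact: cintg_pexp.
  rewrite -[RHS]cint_reflection; last exact: cintg_pexp.
  apply: eq_cint => s; rewrite /pexp /e1 normrN mulNr opprK rmorphM/=.
  congr (_ * _); first by apply: cext; rewrite /= ?oppr0.
  by rewrite expiN conjCK.
move/(congr1 (@complex.Im R)); rewrite ImJ /= => h; move: h; lra.
Qed.

Definition cauchy1 (t : R) : R := 2 / (1 + t ^+ 2).
Lemma cauchy1_ge0 t : 0 <= cauchy1 t.
Proof. by rewrite divr_ge0// addr_ge0// sqr_ge0. Qed.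

Lemma cauchy1_int : (\int[leb]_t (cauchy1 t)%:E = (2 * pi)%:E)%E.
Proof.
have cc : continuous cauchy1.
  move=> x; apply: cvgMr; exact: continuous_oneDsqrV.
rewrite (@ge0_symfun_integralT _ cauchy1)//.
- rewrite -set_itvcy /cauchy1.
  under eq_integral do rewrite EFinM.
  rewrite ge0_integralZl//=.
  + have := @integral0y_oneDsqr R; rewrite /oneDsqr => ->.
    by rewrite -!EFinM; congr (_%:E); field.
  + apply/measurable_EFinP; apply: measurable_funTS; apply: continuous_measurable_fun.
    exact: continuous_oneDsqrV.
  + by move=> x _; rewrite lee_fin invr_ge0 addr_ge0// sqr_ge0.
- exact: cauchy1_ge0.
- by move=> x; rewrite /cauchy1/= sqrrN.
Qed.

Lemma measurable_cauchy1 : measurable_fun setT cauchy1.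
Proof.
apply: continuous_measurable_fun => x; apply: cvgMr; exact: continuous_oneDsqrV.
Qed.

End poisson_1d.

Section dot_product.
Context {R : realType} {d : nat}.
Implicit Types x y z : 'cV[R]_d.

Lemma dotRC x y : dotR x y = dotR y x.
Proof. by apply: eq_bigr => i _; rewrite mulrC. Qed.
Lemma dotRDl x y z : dotR (x + y) z = dotR x z + dotR y z.
Proof. by rewrite /dotR -big_split/=; apply: eq_bigr => i _; rewrite mxE mulrDl. Qed.
Lemma dotRDr x y z : dotR z (x + y) = dotR z x + dotR z y.
Proof. by rewrite dotRC dotRDl !(dotRC _ z). Qed.
Lemma dotRZl (c : R) x y : dotR (c *: x) y = c * dotR x y.
Proof. by rewrite /dotR mulr_sumr; apply: eq_bigr => i _; rewrite mxE mulrA. Qed.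
Lemma dotRZr (c : R) x y : dotR x (c *: y) = c * dotR x y.
Proof. by rewrite dotRC dotRZl dotRC. Qed.
Lemma dotRNl x y : dotR (- x) y = - dotR x y.
Proof. by rewrite -scaleN1r dotRZl mulN1r. Qed.
Lemma dotRNr x y : dotR x (- y) = - dotR x y.
Proof. by rewrite dotRC dotRNl dotRC. Qed.
Lemma dotR0r x : dotR x 0 = 0.
Proof. by rewrite -(scale0r x) dotRZr mul0r. Qed.
Lemma dotR_tr (A : 'M[R]_d) x y : dotR (A *m x) y = dotR x (A^T *m y).
Proof.
have E u v : dotR u v = (u^T *m v) 0 0.
  by rewrite mxE; apply: eq_bigr => i _; rewrite mxE.
by rewrite !E trmx_mul -mulmxA.
Qed.
Lemma measurable_dotR d' (T : measurableType d') (f g : T -> 'cV[R]_d) :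
  measurable_fun setT f -> measurable_fun setT g ->
  measurable_fun setT (fun t => dotR (f t) (g t)).
Proof.
move=> mf mg; apply: measurable_sum => i; apply: measurable_funM.
  by apply: (measurableT_comp (measurable_coord i)).
by apply: (measurableT_comp (measurable_coord i)).
Qed.

End dot_product.

Section fourier_core.
Context {R : realType} {d : nat}.
Local Notation Rd := 'cV[R]_d.
Local Notation mu := (lebesgue_cV R d).
Implicit Types f g k : Rd -> R[i].

(** Convertible to [fourier_integral]; [isFP] relies on this. *)
Definition FI f (xi : Rd) : R[i] := cint mu (fun x => f x * expi (- dotR x xi)).
Definition norm1 f : R := fine (\int[mu]_x (normc (f x))%:E)%E.

Lemma cintg_unimod f (u : Rd -> R) : cintg mu f -> measurable_fun setT u ->
  cintg mu (fun x => f x * expi (u x)).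
Proof.
move=> cf mu'; apply: cintgP.
  by apply: cmeasM; [exact: cintg_meas cf|exact: cmeas_expi].
by under eq_integral do rewrite normcM normc_expi mulr1; exact: cintg_normc_lty.
Qed.

Lemma FI_cintg f xi : cintg mu f -> cintg mu (fun x => f x * expi (- dotR x xi)).
Proof.
move=> cf; apply: cintg_unimod => //; apply: measurableT_comp => //.
by apply: measurable_dotR; [exact: measurable_id|exact: measurable_cst].
Qed.

Lemma norm1E f : cintg mu f -> ((norm1 f)%:E = \int[mu]_x (normc (f x))%:E)%E.
Proof. by move=> cf; rewrite fineK//; apply: integrable_fin_num => //; exact: cintg_normc. Qed.

Lemma norm1_ge0 f : 0 <= norm1 f.
Proof. by apply: fine_ge0; apply: integral_ge0 => x _; rewrite lee_fin normc_ge0. Qed.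

Lemma FI_bound f xi : cintg mu f -> normc (FI f xi) <= norm1 f.
Proof.
move=> cf; rewrite -lee_fin norm1E//.
apply: le_trans (cint_normc_le (FI_cintg xi cf)) _.
by under eq_integral do rewrite normcM normc_expi mulr1.
Qed.

Section pair.
Variables f k : Rd -> R[i].
Hypotheses (cf : cintg mu f) (ck : cintg mu k).

Let F (z : Rd * Rd) : R[i] := f z.1 * expi (- dotR z.1 z.2) * k z.2.

Let mF : cmeas F.
Proof.
apply: cmeasM; last exact: cmeas_comp (cintg_meas ck) measurable_snd.
apply: cmeasM; first exact: cmeas_comp (cintg_meas cf) measurable_fst.
by apply: cmeas_expi; apply: measurableT_comp => //; exact: measurable_dotR.
Qed.

Let iF : (\int[mu]_x \int[mu]_y (normc (F (x, y)))%:E < +oo)%E.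
Proof.
have k0 : (0 <= \int[mu]_y (normc (k y))%:E)%E.
  by apply: integral_ge0 => y _; rewrite lee_fin normc_ge0.
under eq_integral => x _.
  under eq_integral => y _ do rewrite /F /= !normcM normc_expi mulr1 EFinM.
  rewrite ge0_integralZl//; last 3 first.
  - by apply/measurable_EFinP/cmeas_normc; exact: cintg_meas ck.
  - by move=> y _; rewrite lee_fin normc_ge0.
  - by rewrite lee_fin normc_ge0.
  over.
rewrite ge0_integralZr//; last 2 first.
- by apply/measurable_EFinP/cmeas_normc; exact: cintg_meas cf.
- by move=> x _; rewrite lee_fin normc_ge0.
apply: lte_mul_pinfty; last exact: cintg_normc_lty.
  by apply: integral_ge0 => x _; rewrite lee_fin normc_ge0.
by rewrite -norm1E.
Qed.

Lemma FIE_pair xi : FI f xi * k xi = cint mu (fun x => F (x, xi)).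
Proof.
rewrite mulrC /FI -cintZ; last exact: FI_cintg.
by apply: eq_cint => x; rewrite /F /=; ring.
Qed.

Lemma FIM_cintg : cintg mu (fun xi => FI f xi * k xi).
Proof.
have := cintg_fubini2 mF iF; congr cintg.
by apply/funext => xi; rewrite FIE_pair.
Qed.

(** The multiplication formula: the double integral of f(x) k(y) exp(-i x.y) in its two orders. It
    is absolutely convergent since both functions are integrable. *)
Lemma FI_mult : cint mu (fun xi => FI f xi * k xi) = cint mu (fun x => f x * FI k x).
Proof.
under eq_fun do rewrite FIE_pair.
rewrite -(cint_fubini mF iF); apply: eq_cint => x.
rewrite /FI -cintZ; last exact: FI_cintg.
by apply: eq_cint => y; rewrite /F /= (dotRC y x); ring.
Qed.

End pair.

Definition exp_kernel (xi : Rd) : R[i] := (\prod_i e1 (xi i ord0))%:C.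
Definition cauchy_kernel (t : Rd) : R[i] := (\prod_i cauchy1 (t i ord0))%:C.

Lemma real_complexM (x y : R) : (x * y)%:C = x%:C * y%:C :> R[i].
Proof. exact: rmorphM. Qed.

Lemma real_complex_prod (F : 'I_d -> R) : (\prod_i F i)%:C = \prod_i (F i)%:C :> R[i].
Proof. by rewrite -[LHS]/(real_complex R _) rmorph_prod. Qed.

Lemma expi_sum (F : 'I_d -> R) : expi (\sum_i F i) = \prod_i expi (F i) :> R[i].
Proof. by apply: (big_morph (@expi R)); [exact: expiD|exact: expi0]. Qed.

Lemma cintg_exp_kernel : cintg mu exp_kernel.
Proof.
have := (cint_prod (n := d) (fun i => cintg_pexp (0 : R))).1; congr cintg.
apply/funext => x; rewrite /exp_kernel real_complex_prod; apply: eq_bigr => i _.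
by rewrite /pexp mulr0 oppr0 expi0 mulr1.
Qed.

Lemma FI_exp_kernel t : FI exp_kernel t = cauchy_kernel t.
Proof.
rewrite /cauchy_kernel real_complex_prod.
under eq_bigr do rewrite /cauchy1 -cint_pexp.
rewrite -(cint_prod (n := d) (fun i => cintg_pexp (t i ord0))).2.
apply: eq_cint => x; rewrite /exp_kernel real_complex_prod /pexp big_split/=; congr (_ * _).
by rewrite -expi_sum; congr expi; rewrite -sumrN.
Qed.

Lemma exp_kernel_ge0 (x : Rd) : 0 <= \prod_i e1 (x i ord0) :> R.
Proof. by apply: prodr_ge0 => i _; exact/ltW/e1_gt0. Qed.
Lemma exp_kernel_le1 (x : Rd) : \prod_i e1 (x i ord0) <= 1 :> R.
Proof.
apply: (@le_trans _ _ (\prod_(i < d) (1 : R))); last by rewrite big1.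
by apply: ler_prod => i _; rewrite ltW ?e1_gt0// e1_le1.
Qed.
Lemma cauchy_kernel_ge0 (x : Rd) : 0 <= \prod_i cauchy1 (x i ord0) :> R.
Proof. by apply: prodr_ge0 => i _; exact: cauchy1_ge0. Qed.

Lemma cint_cauchy_kernel : cintg mu cauchy_kernel /\ cint mu cauchy_kernel = ((2 * pi) ^+ d)%:C.
Proof.
have ic : cintg (@lebesgue_measure R) (fun t : R => (cauchy1 t)%:C).
  apply: cintgP; first exact: cmeas_real measurable_cauchy1.
  under eq_integral do rewrite normc_real ger0_norm ?cauchy1_ge0//.
  by rewrite cauchy1_int ltry.
have [h1 h2] := cint_prod (n := d) (fun i => ic).
have PE : cauchy_kernel = fun x => \prod_i (cauchy1 (x i ord0))%:C.
  by apply/funext => x; rewrite /cauchy_kernel real_complex_prod.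
rewrite PE; split => //; rewrite h2 big_const_ord iter_mulr mulr1.
have -> : cint (@lebesgue_measure R) (fun t : R => (cauchy1 t)%:C) = (2 * pi)%:C.
  by apply: cext => /=; [rewrite /Rintegral cauchy1_int|rewrite Rintegral_cst// mul0r].
by rewrite -[RHS]/(real_complex R _) rmorphXn.
Qed.

(** Fubini gives measurability of [FI f] times any integrable function; taking the strictly positive
    [exp_kernel], one can divide by it again. *)
Lemma cmeas_FI f : cintg mu f -> cmeas (FI f).
Proof.
move=> cf; have h := cintg_meas (FIM_cintg cf cintg_exp_kernel).
have -> : FI f = fun xi => FI f xi * exp_kernel xi * ((\prod_i e1 (xi i ord0))^-1)%:C.
  apply/funext => xi; rewrite -mulrA /exp_kernel -real_complexM divff ?mulr1//.
  by apply/prodf_neq0 => i _; rewrite gt_eqF// e1_gt0.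
apply: cmeasM => //; apply: cmeas_real.
under eq_fun do rewrite -prodfV.
apply: measurable_prod => i _.
under eq_fun do rewrite /e1 -expRN opprK.
apply: measurableT_comp => //; apply: measurableT_comp => //.
exact: measurable_coord.
Qed.

Lemma FI_linear f (U : 'M[R]_d) v xi : \det U != 0 -> cintg mu f ->
  FI (fun x => f (U *m x + v)) xi =
  (`|\det U|^-1)%:C * expi (dotR (invmx U *m v) xi) * FI f ((invmx U)^T *m xi).
Proof.
move=> U0 cf; have Uu : U \in unitmx by rewrite unitmxE unitfE.
pose g y := f y * expi (- dotR (invmx U *m (y - v)) xi).
have E x : f (U *m x + v) * expi (- dotR x xi) = g (U *m x + v).
  by rewrite /g addrK mulKmx.
have cg : cintg mu g.
  apply: cintg_unimod => //; apply: measurableT_comp => //; apply: measurable_dotR => //.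
  apply: (measurableT_comp (measurable_mulmx _)); exact: measurable_translation.
rewrite /FI (eq_cint mu E) (cint_linear v U0 cg).
rewrite -mulrA; congr (_ * _); rewrite -cintZ; last exact: FI_cintg.
apply: eq_cint => x; rewrite mulrCA; congr (_ * _).
rewrite -expiD; congr expi; rewrite mulmxBr dotRDl dotRNl opprD opprK addrC.
by rewrite (dotR_tr _ x).
Qed.

Lemma FID f g xi : cintg mu f -> cintg mu g ->
  FI (fun x => f x + g x) xi = FI f xi + FI g xi.
Proof.
move=> cf cg; rewrite /FI -cintD; try exact: FI_cintg.
by apply: eq_cint => x; rewrite mulrDl.
Qed.
Lemma FIZ (z : R[i]) f xi : cintg mu f -> FI (fun x => z * f x) xi = z * FI f xi.
Proof.
move=> cf; rewrite /FI -cintZ; last exact: FI_cintg.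
by apply: eq_cint => x; rewrite mulrA.
Qed.

Lemma FI_modulate f eta xi : FI (fun x => f x * expi (dotR x eta)) xi = FI f (xi - eta).
Proof.
apply: eq_cint => x; rewrite -mulrA -expiD; congr (_ * expi _).
by rewrite dotRDr dotRNr; ring.
Qed.

End fourier_core.

(** * Plancherel's theorem by a convergence factor *)

Section plancherel.
Context {R : realType} {d : nat}.
Local Notation Rd := 'cV[R]_d.
Local Notation mu := (lebesgue_cV R d).
Implicit Types f g k : Rd -> R[i].

Lemma translateE (f : Rd -> R[i]) (s : Rd) :
  (fun x => f (x + s)) = (fun x => f (1%:M *m x + s)).
Proof. by apply/funext => x; rewrite mul1mx. Qed.

Lemma det1_neq0 : \det (1%:M : 'M[R]_d) != 0.
Proof. by rewrite det1 oner_eq0. Qed.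

Lemma L2_translate f s : L2 mu f -> L2 mu (fun x => f (x + s)).
Proof. by move=> Lf; rewrite translateE; apply: L2_linear => //; exact: det1_neq0. Qed.

Lemma N2_translate f s : L2 mu f -> N2 mu (fun x => f (x + s)) = N2 mu f.
Proof.
move=> Lf; rewrite translateE N2_linear//; last exact: det1_neq0.
by rewrite det1 normr1 invr1 mul1r.
Qed.

(** Continuity of translation in L2. For a test function it is dominated convergence, and the bound
    [K] on the shifts supplies a single dominating cube; the general case follows by approximation
    and translation invariance. *)
Lemma translate_cvg f (s : nat -> Rd) (K : R) : L2 mu f ->
  (forall n, cube d K (s n)) ->
  (forall i, s n i ord0 @[n --> \oo] --> 0) ->
  N2 mu (fun x => f (x + s n) - f x) @[n --> \oo] --> 0.
Proof.
move=> Lf sK s0; apply/cvgr0Pnorm_lt => e e0.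
(* Two uses of [N2_trian] add the three errors with weights 2, 4 and 4, that is 10/16 of [e]. *)
have e16 : 0 < e / 16 by rewrite divr_gt0.
have [_ /(_ _ e16) [g [tg hg]]] := L2_appr Lf.
have Lg := test_L2 tg.
have [mg [C gC] [B gB] sg] := tg.
have tc : N2 mu (fun x => g (x + s n) - g x) @[n --> \oo] --> 0.
  pose h x := C%:C * cindic (cube d (B + `|K|)) x.
  have Lh : L2 mu h.
    by apply: L2Z; apply: L2_cindic; [exact: measurable_cube|exact: cube_lty].
  have C0 : 0 <= C by apply: le_trans (gC 0); exact: normc_ge0.
  have gh (x y : Rd) : g y != 0 -> (forall i, `|x i ord0 - y i ord0| <= `|K|) ->
      normc (g y) <= normc (h x).
    move=> gy0 xy; rewrite /h normcM !normc_real indicE mem_set.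
      by rewrite normr1 mulr1; apply: le_trans (gC y) _; exact: ler_norm.
    have yB : cube d B y.
      by apply: contrapT => /gB/eqP; rewrite (negbTE gy0).
    apply/cubeE => i; move/cubeE : yB => /(_ i) yB.
    have := xy i; have := ler_normD (y i ord0) (x i ord0 - y i ord0).
    rewrite addrC subrK; move: yB; lra.
  apply: (@N2_dct _ _ _ mu _ g h) => //.
  - by move=> n; exact: (L2_translate (s n) Lg).1.
  - move=> x; have [->|g0] := eqVneq (g x) 0; first by rewrite normc0 normc_ge0.
    by apply: gh => // i; rewrite subrr normr0.
  - move=> n x; have [->|g0] := eqVneq (g (x + s n)) 0; first by rewrite normc0 normc_ge0.
    apply: gh => // i; rewrite mxE opprD addrA subrr add0r normrN.
    by have /cubeE := sK n; move=> /(_ i) h1; apply: le_trans h1 (ler_norm _).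
  - apply: aeW => x; apply: sg => i.
    rewrite -[X in _ --> X]addr0; under eq_fun do rewrite mxE.
    by apply: cvgD; [exact: cvg_cst|exact: s0].
move/cvgr0Pnorm_lt : tc => /(_ _ e16); apply: filterS => n.
rewrite !ger0_norm ?N2_ge0// => hn.
have Lfs := L2_translate (s n) Lf; have Lgs := L2_translate (s n) Lg.
have h1 := N2_trian Lfs Lgs Lf.
have h2 := N2_trian Lgs Lg Lf.
have h3 := N2_translate (s n) (L2B Lf Lg).
rewrite (N2BC mu g f) in h2.
move: h1 h2 h3 => /=; lra.
Qed.

Lemma inner_bound f g : L2 mu f -> L2 mu g ->
  normc (inner mu f g) <= N2 mu f + N2 mu g.
Proof.
move=> Lf Lg; have := CS Lf Lg; have := N2_ge0 mu f; have := N2_ge0 mu g.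
have := normc_ge0 (inner mu f g); nra.
Qed.

Section correlation.
Variables (f g k : Rd -> R[i]) (c : R).
Hypotheses (Lf : L2 mu f) (Lg : L2 mu g) (ck : cintg mu k).

Let F (z : Rd * Rd) : R[i] := k z.1 * (f z.2 * (g (z.2 + c *: z.1))^*).

Lemma cmeas_correlation : cmeas F.
Proof.
apply: cmeasM; first exact: cmeas_comp (cintg_meas ck) measurable_fst.
apply: cmeasM; first exact: cmeas_comp Lf.1 measurable_snd.
apply: cmeasJ; apply: cmeas_comp Lg.1 _.
apply: measurable_fun_cVP => i.
under eq_fun do rewrite !mxE.
apply: measurable_funD; first by apply: (measurableT_comp (measurable_coord i)).
by apply: measurable_funM => //; apply: (measurableT_comp (measurable_coord i)).
Qed.

Lemma integrable_correlation :
  (\int[mu]_x \int[mu]_y (normc (F (x, y)))%:E < +oo)%E.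
Proof.
pose C := N2 mu f + N2 mu g.
have C0 : 0 <= C by rewrite addr_ge0// N2_ge0.
apply: (@le_lt_trans _ _ (\int[mu]_x (C%:E * (normc (k x))%:E)))%E; last first.
  rewrite ge0_integralZl//.
  - by apply: lte_mul_pinfty => //; exact: cintg_normc_lty.
  - by apply/measurable_EFinP/cmeas_normc; exact: cintg_meas ck.
  - by move=> x _; rewrite lee_fin normc_ge0.
apply: ge0_le_integral => //.
- by move=> x _; apply: integral_ge0 => y _; rewrite lee_fin normc_ge0.
- apply: (measurable_fun_fubini_tonelli_F (fun z => (normc (F z))%:E)).
    by apply/measurable_EFinP/cmeas_normc; exact: cmeas_correlation.
  by move=> z; rewrite lee_fin normc_ge0.
- apply: emeasurable_funM => //.
  by apply/measurable_EFinP/cmeas_normc; exact: cintg_meas ck.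
move=> x _; pose gx y := g (y + c *: x).
have Lgx : L2 mu gx by exact: L2_translate.
under eq_integral do rewrite /F /= !normcM normcJ EFinM.
rewrite ge0_integralZl//; last 3 first.
- apply/measurable_EFinP/measurable_funM; apply: cmeas_normc; [exact: Lf.1|exact: Lgx.1].
- by move=> y _; rewrite lee_fin mulr_ge0// normc_ge0.
- by rewrite lee_fin normc_ge0.
rewrite muleC; apply: lee_wpmul2r; first by rewrite lee_fin normc_ge0.
have ifg := integrable_normM Lf Lgx.
rewrite -[X in (X <= _)%E]fineK; last exact: integrable_fin_num.
rewrite lee_fin.
have h1 := int_normM_le Lf Lgx; rewrite (N2_translate _ Lg) in h1.
have h2 : 0 <= fine (\int[mu]_x0 (normc (f x0) * normc (gx x0))%:E)%E.
  by apply: fine_ge0; apply: integral_ge0 => y _; rewrite lee_fin mulr_ge0// normc_ge0.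
have := N2_ge0 mu f; have := N2_ge0 mu g; move: h1 h2; rewrite /C /gx.
move: (fine _) => q; nra.
Qed.

Lemma correlationE s :
  k s * inner mu f (fun x => g (x + c *: s)) = cint mu (fun x => F (s, x)).
Proof. by rewrite /inner -cintZ//; apply: cintg_mulJ => //; exact: L2_translate. Qed.

Lemma cintg_correlation : cintg mu (fun s => k s * inner mu f (fun x => g (x + c *: s))).
Proof.
under eq_fun do rewrite correlationE.
exact: cintg_fubini1 cmeas_correlation integrable_correlation.
Qed.

Lemma cint_correlation : cint mu (fun s => k s * inner mu f (fun x => g (x + c *: s))) =
  cint mu (fun x => cint mu (fun s => k s * (f x * (g (x + c *: s))^*))).
Proof.
under eq_fun do rewrite correlationE.
exact: cint_fubini cmeas_correlation integrable_correlation.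
Qed.

End correlation.

(** The usual approximate identity with the scaling moved from the kernel to the shift: the shifts
    s/(n + 1) tend to 0 for fixed s, and Cauchy-Schwarz with [translate_cvg] gives pointwise
    convergence under the s-integral. *)
Lemma approx_identity f g k : L2 mu f -> L2 mu g -> cintg mu k ->
  ccvg (fun n => cint mu (fun s => k s * inner mu f (fun x => g (x + n.+1%:R^-1 *: s))))
       (cint mu k * inner mu f g).
Proof.
move=> Lf Lg ck.
have -> : cint mu k * inner mu f g = cint mu (fun s => k s * inner mu f g).
  by rewrite mulrC -cintZ//; apply: eq_cint => s; rewrite mulrC.
pose C := N2 mu f + N2 mu g.
apply: (@cint_dct _ _ _ mu _ _ (fun s => C * normc (k s))).
- by move=> n; exact: cintg_meas (cintg_correlation _ Lf Lg ck).
- under eq_fun do rewrite mulrC; apply: cmeasZ; exact: cintg_meas ck.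
- by apply: integrable_mulr; exact: cintg_normc.
- apply: aeW => s; apply: ccvgM; first exact: ccvg_cst.
  have [K hK] := cV_norm_bound s.
  have tc := @translate_cvg g (fun n => n.+1%:R^-1 *: s) K%:R Lg.
  have {}tc : N2 mu (fun x => g (x + n.+1%:R^-1 *: s) - g x) @[n --> \oo] --> 0.
    apply: tc => [n|i].
      apply/cubeE => i; move/cubeE : hK => /(_ i); apply: le_trans.
      rewrite mxE normrM ler_piMl// ger0_norm ?invr_ge0// invf_le1// ler1n//.
    under eq_fun do rewrite mxE.
    rewrite -(mul0r (s i ord0)); apply: cvgMl; exact: cvg_harmonic.
  apply/ccvgP.
  have h2 : (N2 mu f * N2 mu (fun x => g (x + n.+1%:R^-1 *: s) - g x)) @[n --> \oo] --> 0.
    by rewrite -(mulr0 (N2 mu f)); exact: cvgMr.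
  apply/cvgr0Pnorm_lt => e e0.
  have e2 : 0 < e ^+ 2 by rewrite exprn_gt0.
  move/cvgr0Pnorm_lt : h2 => /(_ _ e2); apply: filterS => n hn.
  rewrite ger0_norm ?normc_ge0// -(ltr_pXn2r (n := 2)) ?nnegrE ?normc_ge0 ?ltW//.
  apply: le_lt_trans hn; rewrite [leRHS]ger0_norm; last by rewrite mulr_ge0// N2_ge0.
  have Lgn := L2_translate (n.+1%:R^-1 *: s) Lg.
  apply: le_trans (CS Lf (L2B Lgn Lg)).
  rewrite le_eqVlt; apply/orP; left; apply/eqP; congr (normc _ ^+ 2).
  rewrite /inner -cintB; try exact: cintg_mulJ.
  by apply: eq_cint => x; rewrite rmorphB mulrBr.
- move=> n s; rewrite normcM mulrC ler_wpM2r ?normc_ge0//.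
  apply: le_trans (inner_bound Lf (L2_translate _ Lg)) _.
  by rewrite N2_translate.
Qed.

(** The convergence factor: integrable for each n, increasing to 1, with a transform that is a
    rescaled [cauchy_kernel]. *)
Definition En (n : nat) (xi : Rd) : R[i] := exp_kernel (n.+1%:R^-1 *: xi).

Lemma scal_det_neq0 (c : R) : c != 0 -> \det (c%:M : 'M[R]_d) != 0.
Proof. by move=> c0; rewrite det_scalar expf_neq0. Qed.

Lemma EnE n : En n = fun xi => exp_kernel ((n.+1%:R^-1)%:M *m xi + 0).
Proof. by apply/funext => xi; rewrite mul_scalar_mx addr0. Qed.

Lemma nV_neq0 n : n.+1%:R^-1 != 0 :> R. Proof. by rewrite invr_eq0. Qed.

Lemma cintg_En n : cintg mu (En n).
Proof.
by rewrite EnE; apply: cintg_linear; [exact: scal_det_neq0 (nV_neq0 n)|exact: cintg_exp_kernel].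
Qed.

Lemma FI_En n t : FI (En n) t = (n.+1%:R ^+ d)%:C * cauchy_kernel (n.+1%:R *: t).
Proof.
rewrite EnE FI_linear; [|exact: scal_det_neq0 (nV_neq0 n)|exact: cintg_exp_kernel].
rewrite mulmx0 (_ : dotR 0 t = 0); last by rewrite dotRC dotR0r.
rewrite expi0 mulr1 FI_exp_kernel det_scalar exprVn normfV invrK ger0_norm ?exprn_ge0//.
by rewrite invmx_scalar invrK tr_scalar_mx mul_scalar_mx.
Qed.

Lemma normc_exp_kernel (x : Rd) : normc (exp_kernel x : R[i]) <= 1.
Proof. by rewrite normc_real ger0_norm ?exp_kernel_ge0// exp_kernel_le1. Qed.

Lemma cintg_boundedM (C : R) f k : cmeas f -> (forall x, normc (f x) <= C) ->
  cintg mu k -> cintg mu (fun x => f x * k x).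
Proof.
move=> mf fC ck; apply: (@cintg_le _ _ _ _ _ (fun x => C * normc (k x))).
- by apply: cmeasM => //; exact: cintg_meas ck.
- by apply: integrable_mulr; exact: cintg_normc.
- by move=> x; rewrite normcM ler_wpM2r ?normc_ge0.
Qed.

Lemma conjEn n x : (En n x)^* = En n x.
Proof. by apply: cext; rewrite /= ?oppr0. Qed.

Lemma conj_cauchy_kernel (x : Rd) : (cauchy_kernel x : R[i])^* = cauchy_kernel x.
Proof. by apply: cext; rewrite /= ?oppr0. Qed.

(* The Gaussian of the usual proof is replaced by prod_i exp(-|x_i|), whose
   transform prod_i 2 / (1 + t_i^2) is elementary. *)
Lemma smoothed_plancherel f g n : cintg mu f -> L2 mu f -> cintg mu g -> L2 mu g ->
  cint mu (fun xi => FI f xi * (FI g xi)^* * En n xi) =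
  cint mu (fun s => cauchy_kernel s * inner mu f (fun x => g (x + n.+1%:R^-1 *: s))).
Proof.
move=> cf Lf cg Lg.
pose u xi := (FI g xi)^* * En n xi.
have cu : cintg mu u.
  apply: (@cintg_boundedM (norm1 g)); [exact/cmeasJ/cmeas_FI| |exact: cintg_En].
  by move=> x; rewrite normcJ FI_bound.
have -> : (fun xi => FI f xi * (FI g xi)^* * En n xi) = (fun xi => FI f xi * u xi).
  by apply/funext => xi; rewrite mulrA.
rewrite (FI_mult cf cu) (cint_correlation _ Lf Lg cint_cauchy_kernel.1).
apply: eq_cint => x.
pose kx y := En n y * expi (dotR y x).
have ckx : cintg mu kx.
  apply: cintg_unimod; first exact: cintg_En.
  by apply: measurable_dotR; [exact: measurable_id|exact: measurable_cst].
have uE : FI u x = (cint mu (fun xi => FI g xi * kx xi))^*.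
  rewrite -cintJ; last exact: FIM_cintg.
  apply: eq_cint => xi; by rewrite /u /kx !conjcM conjEn -expiN mulrA.
rewrite uE (FI_mult cg ckx).
have kxE y : FI kx y = (n.+1%:R ^+ d)%:C * cauchy_kernel (n.+1%:R *: (y - x)).
  by rewrite /kx FI_modulate FI_En.
under eq_fun do rewrite kxE.
have n0 : n.+1%:R != 0 :> R by rewrite pnatr_eq0.
have cgP : cintg mu (fun s => g (x + n.+1%:R^-1 *: s) * cauchy_kernel s).
  under eq_fun do rewrite mulrC.
  apply: (@cintg_boundedM (2 ^+ d)).
  - exact: cintg_meas cint_cauchy_kernel.1.
  - move=> y; rewrite normc_real ger0_norm ?cauchy_kernel_ge0//.
    have -> : 2 ^+ d = \prod_(i < d) (2 : R) by rewrite prodr_const card_ord.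
    apply: ler_prod => i _; rewrite cauchy1_ge0/= /cauchy1.
    by rewrite ler_pdivrMr ?ltr_pwDl ?sqr_ge0// ler_peMr// lerDl sqr_ge0.
  have := cintg_linear x (scal_det_neq0 (nV_neq0 n)) cg.
  by congr cintg; apply/funext => s; rewrite mul_scalar_mx addrC.
(* The substitution s = (n + 1)(y - x), whose Jacobian absorbs the factor (n + 1)^d. *)
have -> : cint mu (fun y => g y * ((n.+1%:R ^+ d)%:C * cauchy_kernel (n.+1%:R *: (y - x)))) =
    cint mu (fun s => g (x + n.+1%:R^-1 *: s) * cauchy_kernel s).
  have := cint_linear (- (n.+1%:R *: x)) (scal_det_neq0 n0) cgP.
  move=> /(congr1 (fun z => (n.+1%:R ^+ d)%:C * z)).
  rewrite mulrA -real_complexM det_scalar ger0_norm ?exprn_ge0// divff ?expf_neq0// mul1r => <-.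
  rewrite -cintZ.
    apply: eq_cint => y.
    have -> : (n.+1%:R)%:M *m y - n.+1%:R *: x = n.+1%:R *: (y - x).
      by rewrite mul_scalar_mx scalerBr.
    by rewrite scalerA mulVf// scale1r [x + _]addrC subrK mulrCA.
  have := cintg_linear (- (n.+1%:R *: x)) (scal_det_neq0 n0) cgP; exact.
rewrite -cintJ// -cintZ; last exact: cintgJ.
apply: eq_cint => s; rewrite conjcM conj_cauchy_kernel; ring.
Qed.

Lemma En_cvg xi : ccvg (En ^~ xi) 1.
Proof.
split => /=; last exact: cvg_cst.
have : \prod_i e1 ((n.+1%:R^-1 *: xi) i ord0) @[n --> \oo] --> \prod_(i < d) (1 : R); last by rewrite big1.
apply: cvg_prod_seq => i; rewrite -[X in _ --> X](expR0 R).
apply: (@cvg_comp _ _ _ (fun n => - `|(n.+1%:R^-1 *: xi) i ord0|) expR _ (nbhs (0 : R))); last exact: continuous_expR.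
rewrite -oppr0; apply: cvgN; rewrite -(normr0 R); apply: cvg_norm.
under eq_fun do rewrite mxE.
by rewrite -(mul0r (xi i ord0)); apply: cvgMl; exact: cvg_harmonic.
Qed.

Lemma FI_sq f : cintg mu f -> L2 mu f ->
  sq mu (FI f) = ((2 * pi) ^+ d * N2 mu f)%:E.
Proof.
move=> cf Lf; have mF := cmeas_FI cf.
pose G n xi := (normc (FI f xi) ^+ 2 * \prod_i e1 ((n.+1%:R^-1 *: xi) i ord0)).
have GE n xi : FI f xi * (FI f xi)^* * En n xi = (G n xi)%:C.
  by rewrite mulcJ -real_complexM.
have G0 n xi : 0 <= G n xi by rewrite mulr_ge0 ?sqr_ge0// exp_kernel_ge0.
have cG n : cintg mu (fun xi => FI f xi * (FI f xi)^* * En n xi).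
  apply: (@cintg_boundedM (norm1 f * norm1 f)).
  - by apply: cmeasM => //; exact: cmeasJ.
  - by move=> x; rewrite normcM normcJ ler_pM ?normc_ge0// FI_bound.
  - exact: cintg_En.
have mG n : measurable_fun setT (fun xi => (G n xi)%:E).
  apply/measurable_EFinP; have := (cintg_meas (cG n)).1.
  by under eq_fun do rewrite GE.
have := approx_identity Lf Lf cint_cauchy_kernel.1.
rewrite inner_self// cint_cauchy_kernel.2 -real_complexM.
under eq_fun do rewrite -smoothed_plancherel//.
move=> [+ _]; rewrite /=.
have IE n : (\int[mu]_xi complex.Re (FI f xi * (FI f xi)^* * En n xi))%:E =
    (\int[mu]_xi (G n xi)%:E)%E.
  have [a _] := cG n; rewrite /Rintegral fineK; last exact: integrable_fin_num.
  by apply: eq_integral => xi _; rewrite GE.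
move=> h; have {}h : (\int[mu]_xi (G n xi)%:E)%E @[n --> \oo] --> ((2 * pi) ^+ d * N2 mu f)%:E.
  under eq_fun do rewrite -IE.
  by apply: cvg_EFin => //; exact: nearW.
have e1le (m n : nat) (t : R) : (n <= m)%N -> e1 (n.+1%:R^-1 * t) <= e1 (m.+1%:R^-1 * t).
  move=> nm; rewrite /e1 ler_expR lerN2 !normrM ler_wpM2r// !ger0_norm ?invr_ge0//.
  by rewrite lef_pV2 ?posrE// ler_nat ltnS.
have nd xi : setT xi -> nondecreasing_seq (fun n => (G n xi)%:E).
  move=> _ n m nm; rewrite lee_fin /G ler_wpM2l ?sqr_ge0//.
  by apply: ler_prod => i _; rewrite !mxE ltW ?e1_gt0//= e1le.
have mc := @cvg_monotone_convergence _ _ _ mu setT measurableT _ mG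
  (fun n xi _ => G0 n xi) nd.
rewrite -(cvg_unique _ mc h)//; apply: eq_integral => xi _; apply/esym/cvg_lim => //.
apply: cvg_EFin; first exact: nearW.
rewrite -[normc _ ^+ 2]mulr1; apply: cvgMr.
by have [] := En_cvg xi.
Qed.

Lemma FI_L2 f : cintg mu f -> L2 mu f -> L2 mu (FI f).
Proof. by move=> cf Lf; split; [exact: cmeas_FI|rewrite FI_sq// ltry]. Qed.

Lemma FI_N2 f : cintg mu f -> L2 mu f -> N2 mu (FI f) = (2 * pi) ^+ d * N2 mu f.
Proof. by move=> cf Lf; rewrite /N2 FI_sq. Qed.

Lemma plancherel f g : cintg mu f -> L2 mu f -> cintg mu g -> L2 mu g ->
  inner mu (FI f) (FI g) = ((2 * pi) ^+ d)%:C * inner mu f g.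
Proof.
move=> cf Lf cg Lg.
have h := approx_identity Lf Lg cint_cauchy_kernel.1; rewrite cint_cauchy_kernel.2 in h.
apply: ccvg_unique h; under eq_fun do rewrite -smoothed_plancherel//.
have cfg : cintg mu (fun xi => FI f xi * (FI g xi)^*).
  by apply: cintg_mulJ; exact: FI_L2.
apply: (@cint_dct _ _ _ mu _ _ (fun xi => normc (FI f xi * (FI g xi)^* ))).
- move=> n; apply: cmeasM; first exact: cintg_meas cfg.
  exact: cintg_meas (cintg_En n).
- exact: cintg_meas cfg.
- exact: cintg_normc.
- apply: aeW => xi; rewrite -[X in ccvg _ X]mulr1; apply: ccvgM; first exact: ccvg_cst.
  exact: En_cvg.
- by move=> n xi; rewrite normcM ler_piMr ?normc_ge0//; exact: normc_exp_kernel.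
Qed.

End plancherel.

(** * Completeness of L2 *)

Section riesz_fischer.
Context d (T : measurableType d) (R : realType) (m : {measure set T -> \bar R}).

Lemma N2_le0_eq (f : T -> R[i]) : N2 m f <= 0 -> N2 m f = 0.
Proof. by move=> h; apply/le_anti; rewrite h N2_ge0. Qed.

Lemma geometric_cvg (u : nat -> R) (C : R) :
  (forall n, `|u n.+1 - u n| <= C * 2^-1 ^+ n) -> cvgn u.
Proof.
move=> h.
have -> : u = (fun n => u 0%N + series (fun n => u n.+1 - u n) n).
  apply/funext => n; rewrite /series /= telescope_sumr//.
  by rewrite addrC subrK.
apply: is_cvgD; first exact: is_cvg_cst.
apply: normed_cvg; apply: (@series_le_cvg _ _ (geometric C 2^-1)).
- by move=> n; exact: normr_ge0.
- move=> n; rewrite /geometric/=; apply: le_trans (h n).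
  exact: normr_ge0.
- exact: h.
- by apply: is_cvg_geometric_series; rewrite ger0_norm; lra.
Qed.

Lemma riesz_fischer (F : nat -> T -> R[i]) : (forall n, L2 m (F n)) ->
  (forall n k, (n <= k)%N -> N2 m (fun x => F n x - F k x) <= 8^-1 ^+ n) ->
  exists2 g, L2 m g & N2 m (fun x => F n x - g x) @[n --> \oo] --> 0.
Proof.
move=> LF hF.
(* The weight 4^n balances two demands: 4^n 8^-n = 2^-n is summable, so the total is finite almost
   everywhere, and where it is finite the increments are at most a constant times 2^-n. *)
pose D n x : \bar R := (4 ^+ n * normc (F n x - F n.+1 x) ^+ 2)%:E.
have D0 n x : (0 <= D n x)%E by rewrite lee_fin; apply: mulr_ge0; [exact: exprn_ge0|exact: sqr_ge0].
have mD n : measurable_fun setT (D n).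
  apply/measurable_EFinP/measurable_funM => //; apply: measurable_funX.
  by apply: cmeas_normc; apply: cmeasB; [exact: (LF n).1|exact: (LF n.+1).1].
pose S x := (\sum_(n <oo) D n x)%E.
have mS : measurable_fun setT S by apply: ge0_emeasurable_sum => [n x _ _|n _].
have iD n : (\int[m]_x D n x <= (2^-1 ^+ n)%:E)%E.
  rewrite /D; under eq_integral do rewrite EFinM.
  rewrite ge0_integralZl//.
  - rewrite -/(sq m (fun x => F n x - F n.+1 x)) sqE; last exact: L2B.
    rewrite -EFinM lee_fin.
    have -> : (2^-1 : R) ^+ n = 4 ^+ n * 8^-1 ^+ n.
      by rewrite -exprMn; congr (_ ^+ n); lra.
    by rewrite ler_wpM2l ?exprn_ge0// hF.
  - apply: measurable_sq; apply: cmeasB; [exact: (LF n).1|exact: (LF n.+1).1].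
  - by move=> x _; rewrite lee_fin sqr_ge0.
have iS : m.-integrable setT S.
  apply/integrableP; split => //.
  under eq_integral => x _ do rewrite gee0_abs ?nneseries_ge0//.
  rewrite integral_nneseries//.
  apply: (@le_lt_trans _ _ (\sum_(n <oo) (2^-1 ^+ n)%:E)%E).
    apply: lee_nneseries => n _ //.
    by move=> _; apply: integral_ge0.
  have cg : series (geometric (1:R) 2^-1) @ \oo --> (1 : R) * (1 - 2^-1)^-1.
    by apply: cvg_geometric_series; rewrite ger0_norm; lra.
  have -> : (\sum_(n <oo) ((2^-1 : R) ^+ n)%:E)%E = ((1 : R) * (1 - 2^-1)^-1)%:E.
    apply/cvg_lim => //; apply: cvg_EFin; first by apply: nearW => n; rewrite sumEFin.
    apply: cvg_trans cg; apply: near_eq_cvg; apply: nearW => n.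
    rewrite /= sumEFin/= /series /=; apply: eq_bigr => i _; by rewrite mul1r.
  exact: ltry.
have aS := integrable_ae measurableT iS.
(* Setting the functions to zero off this set of full measure makes the sequence converge at every
   point, so that the limit is measurable. *)
pose A := [set x | (S x < +oo)%E].
have mA : measurable A.
  by have := emeasurable_fun_infty_o measurableT mS +oo%E; rewrite setTI.
pose F' n x := F n x * (\1_A x)%:C.
have mF' n : cmeas (F' n).
  apply: cmeasM; first exact: (LF n).1.
  by apply: cmeas_real; exact: measurable_indic.
have aF n : {ae m, forall x, F n x = F' n x}.
  apply: filterS aS => x /(_ I) Sx; rewrite /F' indicE mem_set ?mulr1//.
  by rewrite /A/= ltey; apply: contraTN Sx => /eqP ->.
have LF' n : L2 m (F' n).
  apply: (L2_le (mF' n) (LF n)) => x; rewrite /F' normcM normc_real indicE.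
  by case: (_ \in _); rewrite ?normr1 ?normr0 ?mulr1 ?mulr0 ?normc_ge0.
have bnd x : exists C : R, forall n, normc (F' n x - F' n.+1 x) <= C * 2^-1 ^+ n.
  rewrite /F' indicE; have [xA|] := boolP (x \in A); last first.
    by move=> _; exists 0 => n; rewrite !mulr0 subrr normc0 mul0r.
  rewrite inE /A/= in xA.
  have S0 : (0 <= S x)%E by exact: nneseries_ge0.
  have SE : S x = (fine (S x))%:E by rewrite fineK// ge0_fin_numE.
  exists (Num.sqrt (fine (S x))) => n; rewrite !mulr1.
  have hD : (D n x <= (fine (S x))%:E)%E.
    rewrite -SE.
    have := @nneseries_lim_ge _ (fun k => D k x) xpredT 0 n.+1 (fun k _ _ => D0 k x).
    apply: le_trans; rewrite big_nat_recr//= leeDr//.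
    by apply: sume_ge0 => k _.
  rewrite /D lee_fin in hD; set r := fine (S x) in hD *.
  have r0 : 0 <= r by exact: fine_ge0.
  rewrite -(ler_pXn2r (n := 2)) ?nnegrE ?normc_ge0 ?mulr_ge0 ?sqrtr_ge0 ?exprn_ge0//.
  rewrite exprMn sqr_sqrtr// -exprM mulnC exprM.
  have -> : (2^-1 ^+ 2) ^+ n = (4 ^+ n)^-1 :> R by rewrite -exprVn; congr (_ ^+ n); lra.
  by rewrite ler_pdivlMr ?exprn_gt0// mulrC.
pose g x : R[i] := limn (fun n => complex.Re (F' n x)) +i* limn (fun n => complex.Im (F' n x)).
have F'g x : ccvg (F' ^~ x) (g x).
  have [C hC] := bnd x.
  split => /=; apply: (@geometric_cvg _ C) => n; apply: le_trans (hC n);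
    rewrite distrC -?ReN -?ImN.
    by apply: le_trans (Re_le_normc _); rewrite !ReImE.
  by apply: le_trans (Im_le_normc _); rewrite !ReImE.
have mg : cmeas g.
  split.
    by apply: (@measurable_fun_cvg _ _ _ _ (fun n x => complex.Re (F' n x))) => [n|x _];
      [exact: (mF' n).1|exact: (F'g x).1].
  by apply: (@measurable_fun_cvg _ _ _ _ (fun n x => complex.Im (F' n x))) => [n|x _];
    [exact: (mF' n).2|exact: (F'g x).2].
(* Fatou's lemma in the second index turns the Cauchy estimate into a rate of convergence to the
   limit. *)
have fat n : (sq m (fun x => (F' n x - g x)%R) <= (8^-1 ^+ n)%:E)%E.
  have mm k : measurable_fun setT (fun x => (normc (F' n x - F' k x) ^+ 2)%:E).
    by apply: measurable_sq; exact: cmeasB.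
  have := @fatou _ _ _ m setT measurableT (fun k x => (normc (F' n x - F' k x) ^+ 2)%:E) mm.
  have p0 k x : setT x -> (0 <= (normc (F' n x - F' k x) ^+ 2)%:E)%E by rewrite lee_fin sqr_ge0.
  move=> /(_ p0).
  have -> : (\int[m]_x limn_einf (fun k => (normc (F' n x - F' k x) ^+ 2)%:E))%E =
      sq m (fun x => F' n x - g x).
    apply: eq_integral => x _.
    have c : (normc (F' n x - F' k x) ^+ 2)%:E @[k --> \oo] --> (normc (F' n x - g x) ^+ 2)%:E.
      apply: cvg_EFin; first exact: nearW.
      have h := ccvg_normc (ccvgB (ccvg_cst (F' n x)) (F'g x)).
      by rewrite expr2; under eq_fun do rewrite /= expr2; exact: cvgM.
    rewrite is_cvg_limn_einfE; [exact: cvg_lim|by apply/cvg_ex; eexists; exact: c].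
  move/le_trans; apply; rewrite limn_einf_lim; apply: lime_le.
    exact: is_cvg_einfs.
  apply: nearW => k; apply: (@le_trans _ _ (sq m (fun x => F' n x - F' (maxn n k) x))).
    by apply: ereal_inf_lbound; exists (maxn n k) => //=; exact: leq_maxr.
  rewrite sqE; last exact: L2B.
  rewrite lee_fin; apply: le_trans (hF n (maxn n k) (leq_maxl _ _)).
  rewrite le_eqVlt; apply/orP; left; apply/eqP; congr fine.
  apply: sq_ae; [exact: cmeasB|apply: cmeasB; [exact: (LF _).1|exact: (LF _).1]|].
  by apply: filterS2 (aF n) (aF (maxn n k)) => x -> ->.
have Lg : L2 m g.
  have LFg : L2 m (fun x => F' 0%N x - g x).
    split; first exact: cmeasB.
    by apply: le_lt_trans (fat 0%N) _; rewrite ltry.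
  have := L2B (LF' 0%N) LFg; congr L2; apply/funext => x.
  by rewrite opprB addrC subrK.
exists g => //.
have N2le n : N2 m (fun x => F n x - g x) <= 8^-1 ^+ n.
  rewrite -lee_fin -sqE; last exact: L2B.
  apply: le_trans (fat n); rewrite le_eqVlt; apply/orP; left; apply/eqP.
  apply: sq_ae; [apply: cmeasB => //; exact: (LF n).1|exact: cmeasB|].
  by apply: filterS (aF n) => x ->.
apply: (squeeze_cvgr _ (cvg_cst 0) (@cvg_expr _ (8^-1) _)).
  by apply: nearW => n; rewrite N2_ge0 N2le.
by rewrite ger0_norm; lra.
Qed.

End riesz_fischer.

(** * The Fourier transform on L2 and two-scale relations *)

Section fourier_transform.
Context {R : realType} {d : nat}.
Local Notation Rd := 'cV[R]_d.
Local Notation mu := (lebesgue_cV R d).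
Implicit Types f g k : Rd -> R[i].

Lemma sq_cvg0 (F : nat -> Rd -> R[i]) : (forall n, L2 mu (F n)) ->
  (sq mu (F n) @[n --> \oo] --> 0%E) <-> (N2 mu (F n) @[n --> \oo] --> 0).
Proof.
move=> LF; split => h; first exact: fine_cvg.
under eq_fun do rewrite sqE//.
by apply: cvg_EFin => //; exact: nearW.
Qed.

Definition isF f g := [/\ L2 mu f, L2 mu g & exists fn : nat -> Rd -> R[i],
  [/\ forall n, cintg mu (fn n) /\ L2 mu (fn n),
      N2 mu (fun x => fn n x - f x) @[n --> \oo] --> 0 &
      N2 mu (fun xi => FI (fn n) xi - g xi) @[n --> \oo] --> 0]].

Lemma isFP f g : is_fourier f g <-> isF f g.
Proof.
split=> -[Lf Lg [fn [h1 h2 h3]]].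
  have L1 n : L2 mu (fun x => fn n x - f x) by apply: L2B => //; exact: (h1 n).2.
  have L3 n : L2 mu (fun x => FI (fn n) x - g x).
    by apply: L2B => //; apply: FI_L2; [exact: (h1 n).1|exact: (h1 n).2].
  split => //; exists fn; split => //; first exact/(sq_cvg0 L1).
  exact/(sq_cvg0 L3).
have L1 n : L2 mu (fun x => fn n x - f x) by apply: L2B => //; exact: (h1 n).2.
have L3 n : L2 mu (fun x => FI (fn n) x - g x).
  by apply: L2B => //; apply: FI_L2; [exact: (h1 n).1|exact: (h1 n).2].
by split => //; exists fn; split => //; [exact/(sq_cvg0 L1)|exact/(sq_cvg0 L3)].
Qed.

Lemma twopi_gt0 : 0 < (2 * pi : R) ^+ d.
Proof. by rewrite exprn_gt0// mulr_gt0// pi_gt0. Qed.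

Lemma FIB f g xi : cintg mu f -> cintg mu g ->
  FI (fun x => f x - g x) xi = FI f xi - FI g xi.
Proof.
move=> cf cg.
have -> : (fun x => f x - g x) = (fun x => f x + -1 * g x).
  by apply/funext => x; rewrite mulN1r.
by rewrite FID ?FIZ ?mulN1r//; exact: cintgZ.
Qed.

Lemma FI_N2B f g : cintg mu f -> L2 mu f -> cintg mu g -> L2 mu g ->
  N2 mu (fun xi => FI f xi - FI g xi) = (2 * pi) ^+ d * N2 mu (fun x => f x - g x).
Proof.
move=> cf Lf cg Lg; rewrite -FI_N2; [|exact: cintgB|exact: L2B].
by congr (N2 mu _); apply/funext => xi; rewrite FIB.
Qed.

Lemma isF_exists f : L2 mu f -> exists g, isF f g.
Proof.
move=> Lf; pose c : R := (2 * pi) ^+ d; have c0 : 0 < c by exact: twopi_gt0.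
(* Two errors of this size, each doubled by [N2_trian] and multiplied by c in Plancherel's formula,
   add up to the 8^-n required by [riesz_fischer]. *)
have e0 n : 0 < 8^-1 ^+ n / (4 * c) by rewrite divr_gt0 ?exprn_gt0 ?mulr_gt0.
have {e0} H n : {g | test_fun g /\ N2 mu (fun x => f x - g x) < 8^-1 ^+ n / (4 * c)}.
  by apply: cid; have [_] := L2_appr Lf; apply; exact: e0.
pose fn n := sval (H n).
have tf n : test_fun (fn n) by case: (svalP (H n)).
have hf n : N2 mu (fun x => f x - fn n x) < 8^-1 ^+ n / (4 * c) by case: (svalP (H n)).
have Lfn n := test_L2 (tf n); have cfn n := test_cintg (tf n).
have [] := @riesz_fischer _ _ _ mu (fun n => FI (fn n)).
- by move=> n; exact: FI_L2.
- move=> n k nk; rewrite FI_N2B//.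
  have h := N2_trian (Lfn n) Lf (Lfn k); rewrite (N2BC mu (fn n) f) in h.
  have h1 := hf n; have h2 := hf k.
  have h3 : 8^-1 ^+ k / (4 * c) <= 8^-1 ^+ n / (4 * c) :> R.
    rewrite ler_wpM2r ?invr_ge0 ?mulr_ge0 ?(ltW c0)//.
    by apply: ler_wiXn2l => //; lra.
  have h4 : N2 mu (fun x => fn n x - fn k x) <= 4 * (8^-1 ^+ n / (4 * c)) by lra.
  apply: le_trans (_ : c * (4 * (8^-1 ^+ n / (4 * c))) <= _).
    by rewrite ler_wpM2l ?(ltW c0).
  by rewrite le_eqVlt; apply/orP; left; apply/eqP; field; rewrite gt_eqF.
move=> g Lg hg; exists g; split => //; exists fn; split => //.
apply: (squeeze_cvgr _ (cvg_cst 0) (h := fun n => 8^-1 ^+ n / (4 * c))).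
  by apply: nearW => n; rewrite N2_ge0/= N2BC ltW.
rewrite -(mul0r (4 * c)^-1); apply: cvgMl.
by apply: cvg_expr; rewrite ger0_norm; lra.
Qed.

Lemma fourierP f : L2 mu f -> isF f (fourier f).
Proof.
move=> Lf; have [g /isFP gP] := isF_exists Lf.
by apply/isFP; rewrite /fourier; apply: (@xgetPex _ (fun=> 0) [set g | is_fourier f g]); exists g.
Qed.

(** For the approximating sequence Plancherel bounds the norm of [fn n] by that of its transform,
    which tends to [g], that is to 0. This is injectivity of the transform once applied to a
    difference. *)
Lemma isF_eq0 f g : isF f g -> N2 mu g = 0 -> N2 mu f = 0.
Proof.
move=> [Lf Lg [fn [h1 h2 h3]]] g0.
have bnd n : N2 mu f <= 2 * N2 mu (fun x => fn n x - f x) +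
    4 / (2 * pi) ^+ d * N2 mu (fun xi => FI (fn n) xi - g xi).
  have [cn Ln] := h1 n; have LF := FI_L2 cn Ln.
  have a1 := N2B Ln (L2B Ln Lf).
  have a2 := N2D (L2B LF Lg) Lg.
  have E1 : (fun x => fn n x - (fn n x - f x)) = f.
    by apply/funext => x; rewrite opprB addrC subrK.
  have E2 : (fun x => FI (fn n) x - g x + g x) = FI (fn n).
    by apply/funext => x; rewrite subrK.
  rewrite E1 in a1; rewrite E2 g0 mulr0 addr0 FI_N2// in a2.
  have a3 : 2 * N2 mu (fn n) <= 4 / (2 * pi) ^+ d * N2 mu (fun xi => FI (fn n) xi - g xi).
    rewrite mulrAC ler_pdivlMr ?twopi_gt0//; lra.
  lra.
have lim0 : (2 * N2 mu (fun x => fn n x - f x) +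
    4 / (2 * pi) ^+ d * N2 mu (fun xi => FI (fn n) xi - g xi)) @[n --> \oo] --> (0 : R).
  rewrite -[X in _ --> X]addr0 -{1}(mulr0 2) -[X in _ --> _ + X](mulr0 (4 / (2 * pi) ^+ d)).
  by apply: cvgD; apply: cvgMr.
apply: N2_le0_eq; rewrite -(cvg_lim _ lim0)//; apply: limr_ge.
  by apply/cvg_ex; eexists; exact: lim0.
by apply: nearW => n; exact: bnd.
Qed.

Lemma isF_FI f : cintg mu f -> L2 mu f -> isF f (FI f).
Proof.
move=> cf Lf; split => //; first exact: FI_L2.
exists (fun=> f); split => //.
  by under eq_fun do rewrite N2_sub0; exact: cvg_cst.
by under eq_fun do rewrite N2_sub0; exact: cvg_cst.
Qed.

Lemma cvg0_le (u v : nat -> R) : (forall n, 0 <= u n <= v n) ->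
  v n @[n --> \oo] --> 0 -> u n @[n --> \oo] --> 0.
Proof. by move=> h hv; apply: (squeeze_cvgr _ (cvg_cst 0) hv); exact: nearW. Qed.

Lemma isFD f g f' g' : isF f g -> isF f' g' ->
  isF (fun x => f x + f' x) (fun x => g x + g' x).
Proof.
move=> [Lf Lg [fn [h1 h2 h3]]] [Lf' Lg' [fn' [h1' h2' h3']]].
split; [exact: L2D|exact: L2D|exists (fun n x => fn n x + fn' n x); split].
- move=> n; have [a b] := h1 n; have [a' b'] := h1' n.
  by split; [exact: cintgD|exact: L2D].
- apply: (@cvg0_le _ (fun n => 2 * N2 mu (fun x => fn n x - f x) + 2 * N2 mu (fun x => fn' n x - f' x))).
    move=> n; rewrite N2_ge0/=.
    have := N2D (L2B (h1 n).2 Lf) (L2B (h1' n).2 Lf'); apply: le_trans.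
    rewrite le_eqVlt; apply/orP; left; apply/eqP; congr (N2 mu _).
    by apply/funext => x; rewrite opprD addrACA.
  rewrite -[X in _ --> X]addr0 -{1}(mulr0 2) -[X in _ --> _ + X](mulr0 2).
  by apply: cvgD; apply: cvgMr.
- apply: (@cvg0_le _ (fun n => 2 * N2 mu (fun x => FI (fn n) x - g x) + 2 * N2 mu (fun x => FI (fn' n) x - g' x))).
    move=> n; rewrite N2_ge0/=; have [a b] := h1 n; have [a' b'] := h1' n.
    have := N2D (L2B (FI_L2 a b) Lg) (L2B (FI_L2 a' b') Lg'); apply: le_trans.
    rewrite le_eqVlt; apply/orP; left; apply/eqP; congr (N2 mu _).
    by apply/funext => x; rewrite FID// opprD addrACA.
  rewrite -[X in _ --> X]addr0 -{1}(mulr0 2) -[X in _ --> _ + X](mulr0 2).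
  by apply: cvgD; apply: cvgMr.
Qed.

Lemma isFZ z f g : isF f g -> isF (fun x => z * f x) (fun x => z * g x).
Proof.
move=> [Lf Lg [fn [h1 h2 h3]]].
split; [exact: L2Z|exact: L2Z|exists (fun n x => z * fn n x); split].
- by move=> n; have [a b] := h1 n; split; [exact: cintgZ|exact: L2Z].
- have E n : N2 mu (fun x => z * fn n x - z * f x) = normc z ^+ 2 * N2 mu (fun x => fn n x - f x).
    rewrite -N2Z; last by apply: L2B => //; exact: (h1 n).2.
    by congr (N2 mu _); apply/funext => x; rewrite mulrBr.
  under eq_fun do rewrite E; rewrite -(mulr0 (normc z ^+ 2)); exact: cvgMr.
- have E n : N2 mu (fun x => FI (fun x => z * fn n x) x - z * g x) = normc z ^+ 2 * N2 mu (fun x => FI (fn n) x - g x).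
    have [a b] := h1 n; rewrite -N2Z; last by apply: L2B => //; exact: FI_L2.
    by congr (N2 mu _); apply/funext => x; rewrite FIZ// mulrBr.
  under eq_fun do rewrite E; rewrite -(mulr0 (normc z ^+ 2)); exact: cvgMr.
Qed.

Lemma isF0 : isF (fun=> 0) (fun=> 0).
Proof.
have [g gP] := isF_exists (L2_0 mu).
by have := isFZ 0 gP; congr isF; apply/funext => x; rewrite mul0r.
Qed.

Lemma isF_sum (I : Type) (r : seq I) (F G : I -> Rd -> R[i]) :
  (forall i, isF (F i) (G i)) ->
  isF (fun x => \sum_(i <- r) F i x) (fun x => \sum_(i <- r) G i x).
Proof.
move=> h; elim: r => [|i r IH].
  by under eq_fun do rewrite big_nil; under [X in isF _ X]eq_fun do rewrite big_nil; exact: isF0.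
under eq_fun do rewrite big_cons; under [X in isF _ X]eq_fun do rewrite big_cons.
exact: isFD.
Qed.

Lemma L2_unimod f (u : Rd -> R) : L2 mu f -> measurable_fun setT u ->
  L2 mu (fun x => expi (u x) * f x).
Proof.
move=> Lf mu'; apply: (L2_le _ Lf).
  by apply: cmeasM; [exact: cmeas_expi|exact: Lf.1].
by move=> x; rewrite normcM normc_expi mul1r.
Qed.

Lemma N2_unimod f (u : Rd -> R) : N2 mu (fun x => expi (u x) * f x) = N2 mu f.
Proof.
by congr fine; apply: eq_integral => x _; rewrite normcM normc_expi mul1r.
Qed.

Lemma isF_linear f g (U : 'M[R]_d) v : \det U != 0 -> isF f g ->
  isF (fun x => f (U *m x + v))
      (fun xi => (`|\det U|^-1)%:C * (expi (dotR (invmx U *m v) xi) * g ((invmx U)^T *m xi))).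
Proof.
move=> U0 [Lf Lg [fn [h1 h2 h3]]].
have V0 : \det ((invmx U)^T) != 0 by rewrite det_tr det_inv invr_eq0.
have me : measurable_fun setT (fun xi : Rd => dotR (invmx U *m v) xi).
  by apply: measurable_dotR; [exact: measurable_cst|exact: measurable_id].
have Lg' k : L2 mu k -> L2 mu (fun xi => k ((invmx U)^T *m xi)).
  by move=> Lk; have := L2_linear 0 V0 Lk; under eq_fun do rewrite addr0.
have Ng' k : L2 mu k -> N2 mu (fun xi => k ((invmx U)^T *m xi)) = `|\det (invmx U)^T|^-1 * N2 mu k.
  by move=> Lk; have := N2_linear 0 V0 Lk; under eq_fun do rewrite addr0.
split; [exact: L2_linear|by apply: L2Z; apply: L2_unimod => //; exact: Lg'|].
exists (fun n x => fn n (U *m x + v)); split.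
- by move=> n; have [a b] := h1 n; split; [exact: cintg_linear|exact: L2_linear].
- have E n : N2 mu (fun x => fn n (U *m x + v) - f (U *m x + v)) =
      `|\det U|^-1 * N2 mu (fun x => fn n x - f x).
    by rewrite -(N2_linear v U0)//; apply: L2B => //; exact: (h1 n).2.
  by under eq_fun do rewrite E; rewrite -(mulr0 `|\det U|^-1); exact: cvgMr.
- pose c := normc (`|\det U|^-1)%:C ^+ 2 * `|\det (invmx U)^T|^-1.
  have E n : N2 mu (fun xi => FI (fun x => fn n (U *m x + v)) xi -
       (`|\det U|^-1)%:C * (expi (dotR (invmx U *m v) xi) * g ((invmx U)^T *m xi))) =
      c * N2 mu (fun xi => FI (fn n) xi - g xi).
    have [a b] := h1 n; have LF := FI_L2 a b.
    rewrite /c -mulrA -Ng'; last exact: L2B.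
    have L0 : L2 mu (fun xi => FI (fn n) ((invmx U)^T *m xi) - g ((invmx U)^T *m xi)).
      exact: (Lg' (fun xi => FI (fn n) xi - g xi) (L2B LF Lg)).
    pose K xi := expi (dotR (invmx U *m v) xi) *
      (FI (fn n) ((invmx U)^T *m xi) - g ((invmx U)^T *m xi)).
    have LK : L2 mu K := L2_unimod L0 me.
    transitivity (N2 mu (fun xi => (`|\det U|^-1)%:C * K xi)).
      by congr (N2 mu _); apply/funext => xi; rewrite /K FI_linear//; ring.
    by rewrite N2Z// /K N2_unimod.
  by under eq_fun do rewrite E; rewrite -(mulr0 c); exact: cvgMr.
Qed.

(** Both sides of [FI_mult] are continuous in L2 by Cauchy-Schwarz, so the formula passes to the
    limit. *)
Lemma isF_duality f g k : isF f g -> cintg mu k -> L2 mu k ->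
  cint mu (fun xi => g xi * k xi) = cint mu (fun x => f x * FI k x).
Proof.
move=> [Lf Lg [fn [h1 h2 h3]]] ck Lk; have LFk := FI_L2 ck Lk.
have key (u : nat -> Rd -> R[i]) v w : (forall n, L2 mu (u n)) -> L2 mu v -> L2 mu w ->
    N2 mu (fun x => u n x - v x) @[n --> \oo] --> 0 ->
    ccvg (fun n => cint mu (fun x => u n x * w x)) (cint mu (fun x => v x * w x)).
  move=> Lu Lv Lw h; apply/ccvgP.
  have h' : (N2 mu (fun x => u n x - v x) * N2 mu w) @[n --> \oo] --> 0.
    by rewrite -(mul0r (N2 mu w)); exact: cvgMl.
  apply/cvgr0Pnorm_lt => e e0; have e2 : 0 < e ^+ 2 by rewrite exprn_gt0.
  move/cvgr0Pnorm_lt : h' => /(_ _ e2); apply: filterS => n hn.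
  rewrite ger0_norm ?normc_ge0// -(ltr_pXn2r (n := 2)) ?nnegrE ?normc_ge0 ?ltW//.
  apply: le_lt_trans hn; rewrite [leRHS]ger0_norm; last by rewrite mulr_ge0// N2_ge0.
  apply: le_trans (normc_int_le (L2B (Lu n) Lv) Lw).
  rewrite le_eqVlt; apply/orP; left; apply/eqP; congr (normc _ ^+ 2).
  rewrite -cintB; try exact: cintg_mul.
  by apply: eq_cint => x; rewrite mulrBl.
have a1 := key _ _ _ (fun n => FI_L2 (h1 n).1 (h1 n).2) Lg Lk h3.
have a2 := key _ _ _ (fun n => (h1 n).2) Lf LFk h2.
apply: ccvg_unique a1 _; apply: ccvg_near_eq a2 => n.
by rewrite (FI_mult (h1 n).1 ck).
Qed.

Lemma isF_inj f g f' g' : isF f g -> isF f' g' -> {ae mu, forall xi, g xi = g' xi} ->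
  {ae mu, forall x, f x = f' x}.
Proof.
move=> h h' gg'.
have hB : isF (fun x => f x + -1 * f' x) (fun x => g x + -1 * g' x).
  by apply: isFD => //; exact: isFZ.
have [Lf Lg _] := hB.
have g0 : N2 mu (fun x => g x + -1 * g' x) = 0.
  have -> : N2 mu (fun x => g x + -1 * g' x) = N2 mu (fun=> (0 : R[i])).
    congr fine; apply: sq_ae; [exact: Lg.1|exact: cmeas_cst|].
    by apply: filterS gg' => x ->; rewrite mulN1r subrr.
  by rewrite /N2 /sq; under eq_integral do rewrite normc0 expr0n/=; rewrite integral0.
have := N2_eq0 Lf (isF_eq0 hB g0); apply: filterS => x /eqP.
by rewrite mulN1r subr_eq0 => /eqP.
Qed.

(** The combination of shifts on the right has a transform computed by [isF_linear], which agrees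
    almost everywhere with that of [psi] after the substitution of M^-T xi; injectivity
    concludes. *)
Lemma refinement (M : 'M[int]_d) (b : zmask R d) phi psi :
  \det (mx_R M : 'M[R]_d) != 0 -> L2 mu phi -> L2 mu psi ->
  {ae mu, forall xi, fourier psi ((mx_R M)^T *m xi) = mask_hat b xi * fourier phi xi} ->
  {ae mu, forall x, psi x = (`|\det (mx_R M : 'M[R]_d)|)%:C *
     \sum_(k <- finsupp b) b k * phi (mx_R M *m x - Zd_R k)}.
Proof.
set U : 'M[R]_d := mx_R M => U0 Lphi Lpsi h.
have Uu : U \in unitmx by rewrite unitmxE unitfE.
have hphi := fourierP Lphi; have hpsi := fourierP Lpsi.
pose G xi := (`|\det U|)%:C * \sum_(k <- finsupp b) b k *
  ((`|\det U|^-1)%:C * (expi (dotR (invmx U *m - Zd_R k) xi) *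
     fourier phi ((invmx U)^T *m xi))).
have hG : isF (fun x => (`|\det U|)%:C * \sum_(k <- finsupp b) b k * phi (U *m x - Zd_R k)) G.
  apply: isFZ; apply: isF_sum => k; apply: isFZ; exact: isF_linear.
apply: (isF_inj hpsi hG).
have V0 : \det ((invmx U)^T) != 0 by rewrite det_tr det_inv invr_eq0.
have := ae_linear 0 V0 h; apply: filterS => xi.
rewrite addr0 trmx_inv mulKVmx ?unitmx_tr// => ->.
rewrite /G /mask_hat mulr_suml mulr_sumr; apply: eq_bigr => k _.
rewrite -trmx_inv mulmxN dotRNl dotR_tr.
have dC : (`|\det U|)%:C * (`|\det U|^-1)%:C = 1 :> R[i].
  by rewrite -real_complexM divff// normr_eq0.
transitivity (((`|\det U|)%:C * (`|\det U|^-1)%:C) * (b k * expi (- dotR (Zd_R k) ((invmx U)^T *m xi)) * fourier phi ((invmx U)^T *m xi))).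
  by rewrite dC mul1r.
ring.
Qed.

End fourier_transform.

(** * Refinable functions *)

Section bounded_sums.
Context {R : realType} {n : nat}.
Implicit Types A B : 'M[R[i]]_n.+1.

Definition mnorm A : R := \sum_i \sum_j normc (A i j).

Lemma mnorm_ge0 A : 0 <= mnorm A.
Proof. by apply: sumr_ge0 => i _; apply: sumr_ge0 => j _; exact: normc_ge0. Qed.

Lemma mnormD A B : mnorm (A + B) <= mnorm A + mnorm B.
Proof.
rewrite /mnorm -big_split/=; apply: ler_sum => i _; rewrite -big_split/=.
by apply: ler_sum => j _; rewrite mxE le_normcD.
Qed.

Lemma mnormZ z A : mnorm (z *: A) = normc z * mnorm A.
Proof.
rewrite /mnorm mulr_sumr; apply: eq_bigr => i _; rewrite mulr_sumr.
by apply: eq_bigr => j _; rewrite mxE normcM.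
Qed.

Definition bsum (u : nat -> 'M[R[i]]_n.+1) :=
  exists C : R, forall k, \sum_(j < k) mnorm (u j) <= C.

(** With S the partial sum of norms, the triangle inequality gives S <= |u 0| + |z| S + C, which is
    solved for S because |z| < 1. *)
Lemma bsum_step (u : nat -> 'M[R[i]]_n.+1) z : normc z < 1 ->
  bsum (fun j => u j.+1 - z *: u j) -> bsum u.
Proof.
move=> z1 [C hC]; exists ((mnorm (u 0%N) + C) / (1 - normc z)) => k.
rewrite ler_pdivlMr ?subr_gt0//.
set S := \sum_(j < k) _.
have h1 : S <= \sum_(j < k.+1) mnorm (u j) by rewrite big_ord_recr/= lerDl mnorm_ge0.
have h2 : \sum_(j < k.+1) mnorm (u j) <= mnorm (u 0%N) + (normc z * S + C).
  rewrite big_ord_recl/= lerD2l; apply: (@le_trans _ _ (\sum_(j < k) (normc z * mnorm (u j) + mnorm (u j.+1 - z *: u j)))).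
    apply: ler_sum => j _; rewrite -mnormZ.
    by rewrite -{1}(subrK (z *: u j) (u j.+1)) addrC; exact: mnormD.
  by rewrite big_split/= -mulr_sumr; apply: lerD => //; exact: hC.
have := mnorm_ge0 (u 0%N); nra.
Qed.

Lemma bsum_poly A B (s : seq R[i]) : (forall z, z \in s -> normc z < 1) ->
  bsum (fun j => A ^+ j * (\prod_(z <- s) (A - z%:M) * B)) -> bsum (fun j => A ^+ j * B).
Proof.
elim: s B => [|z s IH] B hs; first by rewrite big_nil mul1r.
move=> h; apply: IH => [w ws|]; first by apply: hs; rewrite inE ws orbT.
apply: (@bsum_step _ z); first by apply: hs; rewrite inE eqxx.
move: h; congr bsum; apply/funext => j; rewrite big_cons.
rewrite exprSr -!mulrA mulrBl -scalemx1 mulrBr; congr (_ - _).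
by rewrite -[z *: 1%:M * _]/((z *: 1%:M) *m _) -scalemxAl mul1mx
  -[A ^+ j * (z *: _)]/(A ^+ j *m (z *: _)) -scalemxAr.
Qed.

(* By Cayley-Hamilton A^j annihilates prod_z (A - z) over the eigenvalues z;
   the factors are removed one at a time, each costing a geometric series. *)
Lemma bsum_powers A : (forall z, eigenvalue A z -> normc z < 1) ->
  bsum (fun j => A ^+ j).
Proof.
move=> hA; have [s hs] := closed_field_poly_normal (char_poly A).
have {}hs : char_poly A = \prod_(z <- s) ('X - z%:P).
  by rewrite hs (monicP (char_poly_monic A)) scale1r.
have hz z : z \in s -> normc z < 1.
  move=> zs; apply: hA; rewrite eigenvalue_root_char hs.
  by rewrite root_prod_XsubC.
suff : bsum (fun j => A ^+ j * 1).
  by congr bsum; apply/funext => j; rewrite mulr1.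
apply: (@bsum_poly A 1 s hz).
have -> : \prod_(z <- s) (A - z%:M) = 0.
  rewrite -(Cayley_Hamilton A) hs rmorph_prod/=; apply: eq_bigr => z _.
  by rewrite rmorphB/= horner_mx_X horner_mx_C.
exists 0 => k; rewrite big1// => j _.
by rewrite mul0r mulr0 /mnorm big1// => i _; rewrite big1// => l _; rewrite mxE normc0.
Qed.

End bounded_sums.

Section dilation.
Context {R : realType} {n : nat}.
Variable M : 'M[int]_n.+1.
Hypothesis dM : dilation_matrix (R := R) M.
Local Notation U := (mx_R M : 'M[R]_n.+1).

Lemma map_intr_complex : (map_mx intr M : 'M[R[i]]_n.+1) = map_mx (real_complex R) U.
Proof. by apply/matrixP => i j; rewrite !mxE rmorph_int. Qed.

Lemma dilation_unit : U \in unitmx.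
Proof.
apply: contraT => nu.
have : ~~ row_free (map_mx (real_complex R) U).
  by rewrite row_free_unit map_unitmx.
rewrite -kermx_eq0 => k0.
have : eigenvalue (map_mx intr M : 'M[R[i]]_n.+1) 0.
  by rewrite /eigenvalue /eigenspace map_intr_complex raddf0 subr0.
by move/dM; rewrite normr0 ltr10.
Qed.

(** An eigenvalue of the inverse is the inverse of an eigenvalue of [M], hence of modulus less than
    1. This bound is the only quantitative information on the dilation used below. *)
Lemma dilation_bsum : exists C : R, forall k,
  \sum_(j < k) \sum_i \sum_l `|(invmx U ^+ j) i l| <= C.
Proof.
have Uu := dilation_unit.
pose A : 'M[R[i]]_n.+1 := map_mx (real_complex R) (invmx U).
have [|C hC] := @bsum_powers R n A.
  move=> z /eigenvalueP[v vA v0].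
  have vM : v = z *: (v *m map_mx (real_complex R) U).
    by rewrite scalemxAl -vA -mulmxA /A -map_mxM mulVmx// map_mx1 mulmx1.
  have z0 : z != 0.
    by apply: contra v0 => /eqP z0; rewrite vM z0 scale0r.
  have : eigenvalue (map_mx intr M : 'M[R[i]]_n.+1) z^-1.
    apply/eigenvalueP; exists v => //.
    by rewrite map_intr_complex [in RHS]vM scalerA mulVf// scale1r.
  move/dM; rewrite normfV => h.
  have zn : `|z| = (normc z)%:C by rewrite normc_def; case: (z).
  have nz : 0 < normc z.
    rewrite lt_neqAle normc_ge0 andbT eq_sym.
    by apply: contra z0 => /eqP/eq0_normc ->.
  have : `|z| < 1 by rewrite -invf_gt1 ?normr_gt0.
  by rewrite zn -(rmorph1 (real_complex R)) ltcR.
exists C => k; apply: le_trans (hC k); apply: ler_sum => j _.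
rewrite /mnorm; apply: ler_sum => i _; apply: ler_sum => l _.
by rewrite /A -rmorphXn/= mxE normc_real.
Qed.

End dilation.

Section mask_bounds.
Context {R : realType} {d : nat}.
Local Notation Rd := 'cV[R]_d.
Implicit Types xi : Rd.

Lemma sin_le_abs (x : R) : `|sin x| <= `|x|.
Proof.
wlog x0 : x / 0 < x.
  move=> H; have [x0|x0|->] := ltgtP x 0; last by rewrite sin0.
    by rewrite -normrN -sinN -(normrN x); apply: H; rewrite oppr_gt0.
  exact: H.
have [c _] := @MVT R sin cos 0 x x0 (fun y _ => is_derive_sin y)
  (continuous_subspaceT (@continuous_sin R)).
rewrite sin0 !subr0 => ->; rewrite normrM ler_piMl//.
by rewrite ler_norml cos_geN1 cos_le1.
Qed.

(** The squared modulus is 2 - 2 cos t = 4 sin(t/2)^2, and |sin x| <= |x|. *)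
Lemma normc_expi_sub1 (t : R) : normc (expi t - 1) <= `|t|.
Proof.
rewrite -(ler_pXn2r (n := 2)) ?nnegrE ?normc_ge0// normcE2 !ReImE /=.
have E : cos t = 1 - 2 * sin (t / 2) ^+ 2.
  have -> : cos t = cos (t / 2 + t / 2) by congr cos; lra.
  rewrite cosD; have := cos2Dsin2 (t / 2); rewrite !expr2; lra.
have h := cos2Dsin2 t.
have h2 : `|sin (t / 2)| <= `|t| * 2^-1.
  by have := sin_le_abs (t / 2); rewrite normrM [X in _ <= _ * X]ger0_norm.
have h3 : sin (t / 2) ^+ 2 <= (`|t| * 2^-1) ^+ 2.
  by rewrite -[leLHS]real_normK ?num_real// lerXn2r ?nnegrE ?mulr_ge0.
rewrite exprMn real_normK ?num_real// in h3.
rewrite [leRHS]real_normK ?num_real//.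
move: h h3; rewrite subr0 {1 2}E; move: (sin (t / 2)) (sin t) => p q; rewrite !expr2 => h h3.
nra.
Qed.

(** The l1 norm, dual to the sup norm measured by [cube], as used in [dotR_le]. *)
Definition onorm (x : Rd) : R := \sum_i `|x i ord0|.
Lemma onorm_ge0 x : 0 <= onorm x. Proof. by apply: sumr_ge0. Qed.
Lemma coord_le_onorm (x : Rd) i : `|x i ord0| <= onorm x.
Proof. by rewrite /onorm (bigD1 i)//= lerDl; apply: sumr_ge0. Qed.

Lemma dotR_le (x y : Rd) (K : R) : cube d K x -> `|dotR x y| <= K * onorm y.
Proof.
move=> /cubeE xK; apply: le_trans (ler_norm_sum _ _ _) _.
rewrite mulr_sumr; apply: ler_sum => i _.
by rewrite normrM ler_wpM2r.
Qed.

Lemma mask_cube (a : zmask R d) : exists2 K : R, 0 <= K &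
  forall k, k \in finsupp a -> cube d K (Zd_R k).
Proof.
exists (\sum_(k <- finsupp a) onorm (Zd_R k : Rd)).
  by apply: sumr_ge0 => k _; exact: onorm_ge0.
move=> k ka; apply/cubeE => i; apply: le_trans (coord_le_onorm _ i) _.
rewrite (big_rem k ka)/= lerDl; apply: sumr_ge0 => l _; exact: onorm_ge0.
Qed.

Lemma mask_hat_lip (a : zmask R d) : mask_hat a 0 = 1 -> exists2 C : R, 0 <= C &
  forall xi, normc (mask_hat a xi - 1) <= C * onorm xi.
Proof.
move=> a0; have [K K0 hK] := mask_cube a.
exists (\sum_(k <- finsupp a) normc (a k) * K).
  by apply: sumr_ge0 => k _; rewrite mulr_ge0 ?normc_ge0.
move=> xi; rewrite -a0 /mask_hat -sumrB.
apply: le_trans (normc_sum _ _ _) _; rewrite mulr_suml.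
rewrite big_seq [leRHS]big_seq; apply: ler_sum => k ka.
rewrite dotR0r oppr0 expi0 -mulrBr normcM -mulrA ler_wpM2l ?normc_ge0//.
apply: le_trans (normc_expi_sub1 _) _.
by rewrite normrN dotR_le//; exact: hK.
Qed.

Lemma Omega0 (M : 'M[int]_d) : Omega M (0 : Rd).
Proof.
split; last by move=> i; rewrite mxE lexx ltr01.
by exists 0; rewrite /Zd_R map_mx0 mulmx0.
Qed.

(** At omega = 0 perfect reconstruction says that the squared moduli of all the masks add up to
    1. *)
Lemma wavelet_mask_le1 r (M : 'M[int]_d) (a : zmask R d) (b : 'I_r -> zmask R d) xi :
  wavelet_PR M a b -> normc (mask_hat a xi) <= 1.
Proof.
move=> /(_ 0 xi (Omega0 M)); rewrite scaler0 addr0 eqxx => h.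
rewrite -(ler_pXn2r (n := 2)) ?nnegrE ?normc_ge0// expr1n.
move/(congr1 (@complex.Re R)): h; rewrite ReD mulcJ Re_sum /=.
under eq_bigr do rewrite mulcJ.
rewrite /= => <-; rewrite lerDl; apply: sumr_ge0 => l _; exact: sqr_ge0.
Qed.

End mask_bounds.

(** * Partial products of the mask along the dilation *)

Section refinable_product.
Context {R : realType} {n : nat}.
Local Notation d := n.+1.
Local Notation Rd := 'cV[R]_d.
Variables (M : 'M[int]_d) (a : zmask R d).
Hypothesis dM : dilation_matrix (R := R) M.
Hypothesis a0 : mask_hat a (0 : Rd) = 1.
Hypothesis a1 : forall xi : Rd, normc (mask_hat a xi) <= 1.
Local Notation U := (mx_R M : 'M[R]_d).
Local Notation N := (invmx (U^T)).

Definition pprod (m : nat) (xi : Rd) : R[i] :=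
  \prod_(1 <= j < m.+1) mask_hat a (N ^+ j *m xi).

Lemma powN j : N ^+ j = (invmx U ^+ j)^T.
Proof.
elim: j => [|j IH]; first by rewrite !expr0 trmx1.
by rewrite exprS IH exprSr -trmx_inv -[_ * invmx U]/(_ *m invmx U) trmx_mul.
Qed.

Definition dsum (xi : Rd) m : R := \sum_(j < m) onorm (N ^+ j *m xi).

Lemma dsum_bound : exists2 C : R, 0 <= C & forall xi m, dsum xi m <= C * onorm xi.
Proof.
have [C hC] := dilation_bsum dM.
have C0 : 0 <= C by have := hC 0%N; rewrite big_ord0.
exists C => // xi m.
apply: (@le_trans _ _ ((\sum_(j < m) \sum_i \sum_l `|(invmx U ^+ j) i l|) * onorm xi)); last first.
  by rewrite ler_wpM2r ?onorm_ge0.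
rewrite mulr_suml; apply: ler_sum => j _.
rewrite /onorm exchange_big/= mulr_suml; apply: ler_sum => i _.
rewrite powN mxE; apply: le_trans (ler_norm_sum _ _ _) _.
rewrite mulr_suml; apply: ler_sum => l _.
by rewrite normrM mxE ler_wpM2l// coord_le_onorm.
Qed.

Lemma pprod0 xi : pprod 0 xi = 1.
Proof. by rewrite /pprod big_geq. Qed.

Lemma pprodS m xi : pprod m.+1 xi = pprod m xi * mask_hat a (N ^+ m.+1 *m xi).
Proof. by rewrite /pprod big_nat_recr. Qed.

Lemma pprod_le1 m xi : normc (pprod m xi) <= 1.
Proof.
elim: m => [|m IH]; first by rewrite pprod0 normc1.
by rewrite pprodS normcM mulr_ile1 ?normc_ge0.
Qed.

Lemma ccvg_bounded_variation (u : nat -> R[i]) (C : R) :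
  (forall m, \sum_(j < m) normc (u j.+1 - u j) <= C) -> exists l, ccvg u l.
Proof.
move=> hC.
have key (v : nat -> R) : (forall j, `|v j.+1 - v j| <= normc (u j.+1 - u j)) -> cvgn v.
  move=> hv.
  have -> : v = (fun n => v 0%N + series (fun n => v n.+1 - v n) n).
    apply/funext => k; rewrite /series /= telescope_sumr//.
    by rewrite addrC subrK.
  apply: is_cvgD; first exact: is_cvg_cst.
  apply: normed_cvg; apply: nondecreasing_is_cvgn.
    by apply: nondecreasing_series => k _ _; exact: normr_ge0.
  exists C => _ [k _ <-]; apply: le_trans (hC k).
  apply: (@le_trans _ _ (\sum_(0 <= j < k) `|v j.+1 - v j|)) => //.
  by rewrite big_mkord; apply: ler_sum => j _; exact: hv.
have c1 := key (fun k => complex.Re (u k)); have c2 := key (fun k => complex.Im (u k)).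
exists (limn (fun k => complex.Re (u k)) +i* limn (fun k => complex.Im (u k))).
split => /=.
  by apply: c1 => j; apply: le_trans (Re_le_normc _); rewrite !ReImE.
by apply: c2 => j; apply: le_trans (Im_le_normc _); rewrite !ReImE.
Qed.

(** An increment is a partial product, of modulus at most 1, times the mask minus 1, which is
    Lipschitz at the origin; the arguments are summable by [dsum_bound]. Linearity of the bound in
    xi gives both convergence and closeness to 1 near the origin. *)
Lemma pprod_variation : exists2 C : R, 0 <= C &
  forall xi m, \sum_(j < m) normc (pprod j.+1 xi - pprod j xi) <= C * onorm xi.
Proof.
have [C C0 hC] := dsum_bound; have [L L0 hL] := mask_hat_lip a0.
exists (L * C); first exact: mulr_ge0.
move=> xi m; rewrite -mulrA.
apply: (@le_trans _ _ (L * dsum xi m.+1)); last by rewrite ler_wpM2l.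
rewrite /dsum big_ord_recl mulrDr.
apply: (@le_trans _ _ (L * \sum_(j < m) onorm (N ^+ lift ord0 j *m xi))); last first.
  by rewrite lerDr mulr_ge0 ?onorm_ge0.
rewrite mulr_sumr.
apply: ler_sum => j _; rewrite pprodS -{2}(mulr1 (pprod j xi)) -mulrBr normcM.
apply: le_trans (_ : _ <= 1 * normc (mask_hat a (N ^+ j.+1 *m xi) - 1)) _.
  by rewrite ler_wpM2r ?normc_ge0// pprod_le1.
by rewrite mul1r hL.
Qed.

Lemma pprod_cvg xi : ccvg (pprod ^~ xi) (mask_product M a xi).
Proof.
have [C C0 hC] := pprod_variation.
have [l hl] := ccvg_bounded_variation (u := pprod ^~ xi) (hC xi).
rewrite /mask_product /climn; have [h1 h2] := hl.
have <- : l = limn (fun n => complex.Re (pprod n xi)) +i* limn (fun n => complex.Im (pprod n xi)).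
  by apply: cext => /=; apply/esym/cvg_lim.
exact: hl.
Qed.

Lemma mask_product_near1 : exists2 C : R, 0 <= C &
  forall xi, normc (mask_product M a xi - 1) <= C * onorm xi.
Proof.
have [C C0 hC] := pprod_variation; exists C => // xi.
have bnd m : normc (pprod m xi - 1) <= C * onorm xi.
  apply: le_trans (hC xi m).
  have -> : pprod m xi - 1 = \sum_(j < m) (pprod j.+1 xi - pprod j xi).
    by rewrite -(big_mkord xpredT (fun j => pprod j.+1 xi - pprod j xi)) telescope_sumr// pprod0.
  exact: normc_sum.
have := ccvg_normc (ccvgB (pprod_cvg xi) (ccvg_cst 1)) => h.
rewrite -(cvg_lim _ h)//; apply: limr_le; first by apply/cvg_ex; eexists; exact: h.
exact: nearW.
Qed.

(* The Fourier transforms of the finitely supported measures on a cube. *)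
Definition exp_sum (rho : R) (F : Rd -> R[i]) := exists s : seq (R[i] * Rd),
  (forall p, p \in s -> cube d rho p.2) /\
  forall xi, F xi = \sum_(p <- s) p.1 * expi (- dotR p.2 xi).

Lemma exp_sumM r1 r2 F G : exp_sum r1 F -> exp_sum r2 G ->
  exp_sum (r1 + r2) (fun xi => F xi * G xi).
Proof.
move=> [s [hs Fs]] [t [ht Gt]].
exists [seq (p.1 * q.1, p.2 + q.2) | p <- s, q <- t]; split.
  move=> _ /allpairsP[[p q] /= [ps qt ->]]; apply/cubeE => i /=; rewrite mxE.
  apply: le_trans (ler_normD _ _) _; apply: lerD.
    by have /cubeE := hs _ ps; exact.
  by have /cubeE := ht _ qt; exact.
move=> xi; rewrite Fs Gt big_allpairs_dep mulr_suml; apply: eq_bigr => p _.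
rewrite mulr_sumr; apply: eq_bigr => q _ /=.
by rewrite dotRDl opprD expiD; ring.
Qed.

(** Multiplying exponential sums adds their frequencies. The j-th factor has frequencies of size at
    most the norm of the j-th inverse power times that of the mask support, and these sizes have a
    sum bounded independently of m. *)
Lemma pprod_exp_sum : exists rho : R, forall m, exp_sum rho (pprod m).
Proof.
have [K K0 hK] := mask_cube a; have [C hC] := dilation_bsum dM.
pose nj j := \sum_i \sum_l `|(invmx U ^+ j) i l|.
have nj0 j : 0 <= nj j by apply: sumr_ge0 => i _; apply: sumr_ge0.
have factor j : exp_sum (nj j * K) (fun xi => mask_hat a (N ^+ j *m xi)).
  exists [seq (a k, invmx U ^+ j *m Zd_R k) | k <- finsupp a]; split.
    move=> _ /mapP[k ka ->] /=; apply/cubeE => i; rewrite mxE.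
    apply: le_trans (ler_norm_sum _ _ _) _.
    apply: (@le_trans _ _ ((\sum_l `|(invmx U ^+ j) i l|) * K)).
      rewrite mulr_suml; apply: ler_sum => l _; rewrite normrM ler_wpM2l//.
      by have /cubeE := hK _ ka; exact.
    rewrite ler_wpM2r// /nj [leRHS](bigD1 i)//= lerDl.
    by apply: sumr_ge0 => k' _; apply: sumr_ge0.
  move=> xi; rewrite big_map /mask_hat; apply: eq_bigr => k _ /=.
  by rewrite dotR_tr powN.
have weaken r1 r2 F : r1 <= r2 -> exp_sum r1 F -> exp_sum r2 F.
  move=> r12 [s [hs Fs]]; exists s; split => // p ps.
  exact: cube_le r12 _ (hs p ps).
(* The range starts at 0 whereas the product starts at j = 1; the extra term only enlarges the cube
   and lets the induction peel off the last index. *)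
have step m : exp_sum ((\sum_(j < m.+1) nj j) * K) (pprod m).
  elim: m => [|m IH].
    exists [:: (1, 0)]; split.
      move=> p; rewrite inE => /eqP -> /=; apply/cubeE => i.
      by rewrite mxE normr0 mulr_ge0// sumr_ge0.
    by move=> xi; rewrite pprod0 big_seq1 /= dotRC dotR0r oppr0 expi0 mulr1.
  rewrite big_ord_recr mulrDl.
  have := exp_sumM IH (factor m.+1); congr exp_sum.
  by apply/funext => xi; rewrite pprodS.
exists (C * K) => m; apply: weaken (step m).
by rewrite ler_wpM2r// hC.
Qed.

End refinable_product.

(** * Compact support and integral of a refinable function *)

Section compact_support.
Context {R : realType} {d' : nat}.
Local Notation d := d'.+1.
Local Notation Rd := 'cV[R]_d.
Local Notation mu := (lebesgue_cV R d).
Implicit Types f g k : Rd -> R[i].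

Definition csupp f := exists rho : R, {ae mu, forall x, ~ cube d rho x -> f x = 0}.

(** A kernel of mass 1 with bounded support; its contractions are the bumps that shrink to a point
    mass. *)
Definition ubox : set Rd := cV_box 0 (const_mx 1).

Lemma ubox_L2 : L2 mu (cindic ubox).
Proof. by apply: L2_cindic; [exact: measurable_box|rewrite lebesgue_cV_boxE ltry]. Qed.

Lemma ubox_bsupp : bsupp (cindic ubox).
Proof.
exists 1 => x x1; rewrite /cindic indicE memNset// => xu; apply: x1; apply/cubeE => i.
by have := xu i; rewrite in_itv/= !mxE => /andP[h1 h2]; rewrite ger0_norm.
Qed.

Lemma ubox_cintg : cintg mu (cindic ubox).
Proof. exact: L2_bsupp_cintg ubox_L2 ubox_bsupp. Qed.

Lemma ubox_cint : cint mu (cindic ubox) = 1.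
Proof.
have m1 : mu ubox = 1%:E.
  rewrite lebesgue_cV_box; last by move=> i; rewrite !mxE.
  by congr (_%:E); rewrite big1// => i _; rewrite !mxE subr0.
apply: cext => /=; last by rewrite Rintegral_cst// mul0r.
have mu1 : measurable ubox by exact: measurable_box.
rewrite /Rintegral (_ : (\int[mu]_x (\1_ubox x)%:E)%E = 1%:E)//.
by rewrite -m1; exact: integral_indicT.
Qed.

Lemma FI_translate f v xi : cintg mu f ->
  FI (fun x => f (x + v)) xi = expi (dotR v xi) * FI f xi.
Proof.
move=> cf; rewrite translateE FI_linear//; last exact: det1_neq0.
by rewrite det1 normr1 invr1 invmx1 mul1mx trmx1 mul1mx -[1%:C]/(1 : R[i]) mul1r.
Qed.

Lemma cintg_translate f v : cintg mu f -> cintg mu (fun x => f (x + v)).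
Proof. by move=> cf; rewrite translateE; apply: cintg_linear => //; exact: det1_neq0. Qed.

(* A distributional Paley-Wiener argument: [g] is a bounded limit of transforms
   of measures on the cube of size [rho], so it is orthogonal to the product of
   FI h1 and the conjugate of FI h2, whose transform is the correlation of h1 and h2,
   as soon as this correlation vanishes on that cube.  Letting h1 shrink to a
   point mass and h2 be a truncation of [phi] gives phi = 0 off the cube. *)
Section weak_support.
Variables (phi g : Rd -> R[i]) (P : nat -> Rd -> R[i]) (rho : R).
Hypothesis phig : isF phi g.
Hypothesis Pexp : forall m, exp_sum rho (P m).
Hypothesis P1 : forall m xi, normc (P m xi) <= 1.
Hypothesis Pg : {ae mu, forall xi, ccvg (P ^~ xi) (g xi)}.

Let Lphi : L2 mu phi. Proof. by case: phig. Qed.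
Let Lg : L2 mu g. Proof. by case: phig. Qed.

Lemma exp_sum_meas (F : Rd -> R[i]) : exp_sum rho F -> cmeas F.
Proof.
move=> [s [_ Fs]]; have -> : F = fun xi => \sum_(p <- s) p.1 * expi (- dotR p.2 xi).
  by apply/funext.
apply: cmeas_sum => p; apply: cmeasZ; apply: cmeas_expi; apply: measurableT_comp => //.
by apply: measurable_dotR; [exact: measurable_cst|exact: measurable_id].
Qed.

Section one_window.
Variables (h1 h2 : Rd -> R[i]).
Hypotheses (ch1 : cintg mu h1) (Lh1 : L2 mu h1) (ch2 : cintg mu h2) (Lh2 : L2 mu h2).

Let k xi := FI h1 xi * (FI h2 xi)^*.

Lemma window_cintg : cintg mu k.
Proof. by apply: cintg_mulJ; exact: FI_L2. Qed.

Lemma window_L2 : L2 mu k.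
Proof.
apply: (@L2_bounded _ _ _ _ (norm1 h2) _ (FI h1)).
- exact: cintg_meas window_cintg.
- exact: FI_L2.
- by move=> x; rewrite /k normcM normcJ mulrC ler_wpM2r ?normc_ge0// FI_bound.
Qed.

(** Plancherel applied to [h2] and the translate of [h1]: the transform of the product window is
    their correlation. *)
Lemma window_FI y : FI k y =
  ((2 * pi) ^+ d)%:C * cint mu (fun x => h1 (x - y) * (h2 x)^*).
Proof.
have c1 : cintg mu (fun x => h1 (x - y)) by exact: cintg_translate.
have L1 : L2 mu (fun x => h1 (x - y)) by exact: L2_translate.
have := plancherel c1 L1 ch2 Lh2; rewrite /inner => <-.
apply: eq_cint => xi; rewrite FI_translate// /k dotRNl (dotRC xi).
by rewrite mulrC mulrA.
Qed.

Hypothesis disj : forall y x, cube d rho y -> h1 (x - y) * (h2 x)^* = 0.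

Lemma window_orth : cint mu (fun y => phi y * cint mu (fun x => h1 (x - y) * (h2 x)^*)) = 0.
Proof.
have ck := window_cintg; have Lk := window_L2.
have FIk0 y : cube d rho y -> FI k y = 0.
  move=> yr; rewrite window_FI.
  by rewrite (eq_cint mu (g := fun=> 0)) ?cint0 ?mulr0// => x; exact: disj.
(* Pairing [k] with an exponential sum gives values of [FI k] at its frequencies, all of which lie
   in the cube where [FI k] vanishes. *)
have Pk0 m : cint mu (fun xi => P m xi * k xi) = 0.
  have [s [hs Fs]] := Pexp m.
  under eq_fun do rewrite Fs mulr_suml.
  rewrite cint_sum; last first.
    move=> p; under eq_fun do rewrite -mulrA; apply: cintgZ.
    under eq_fun do rewrite mulrC; apply: cintg_unimod => //; apply: measurableT_comp => //.
    by apply: measurable_dotR; [exact: measurable_cst|exact: measurable_id].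
  rewrite big_seq big1// => p ps.
  rewrite (eq_cint mu (g := fun xi => p.1 * (k xi * expi (- dotR xi p.2)))); last first.
    by move=> xi; rewrite (dotRC xi); ring.
  rewrite cintZ; last exact: FI_cintg.
  by rewrite -/(FI k p.2) FIk0 ?mulr0//; exact: hs.
have lim : ccvg (fun m => cint mu (fun xi => P m xi * k xi)) (cint mu (fun xi => g xi * k xi)).
  apply: (@cint_dct _ _ _ mu _ _ (fun xi => normc (k xi))).
  - by move=> m; apply: cmeasM; [exact: exp_sum_meas (Pexp m)|exact: cintg_meas ck].
  - by apply: cmeasM; [exact: Lg.1|exact: cintg_meas ck].
  - exact: cintg_normc.
  - by apply: filterS Pg => xi h; apply: ccvgM => //; exact: ccvg_cst.
  - by move=> m xi; rewrite normcM ler_piMl ?normc_ge0.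
have gk0 : cint mu (fun xi => g xi * k xi) = 0.
  apply: ccvg_unique lim _; apply: ccvg_near_eq (ccvg_cst 0) => m; by rewrite Pk0.
have := isF_duality phig ck Lk; rewrite gk0.
rewrite (eq_cint mu (g := fun y => ((2 * pi) ^+ d)%:C * (phi y * cint mu (fun x => h1 (x - y) * (h2 x)^*)))); last first.
  by move=> y; rewrite window_FI mulrCA.
have c0 : ((2 * pi) ^+ d)%:C != 0 :> R[i].
  by rewrite -(rmorph0 (real_complex R)) (inj_eq (@complexI R)) gt_eqF// twopi_gt0.
rewrite cintZ.
  by move/esym/eqP; rewrite mulf_eq0 (negbTE c0) /= => /eqP.
have LFk := FI_L2 ck Lk.
have := cintgZ ((((2 * pi) ^+ d)%:C)^-1) (cintg_mul Lphi LFk); congr cintg.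
by apply/funext => y; rewrite window_FI; field.
Qed.

End one_window.

(** The margin 1 covers the width of the bumps [h1], which live on [0, 1/(n + 1)]^d: a point of the
    cube of size [rho] moved by a bump stays within [rho] + 1, where [h2] is zero. *)
Lemma weak_csupp : {ae mu, forall x, ~ cube d (rho + 1) x -> phi x = 0}.
Proof.
have key (m : nat) : {ae mu, forall x, cube d m%:R x -> ~ cube d (rho + 1) x -> phi x = 0}.
  pose S : set Rd := cube d m%:R `\` cube d (rho + 1).
  have mS : measurable S by apply: measurableD; exact: measurable_cube.
  pose h2 x := phi x * cindic S x.
  have Lh2 : L2 mu h2.
    apply: (L2_le _ Lphi); first by apply: cmeasM; [exact: Lphi.1|exact: cmeas_cindic].
    move=> x; rewrite normcM normc_real indicE; case: (_ \in _);
      by rewrite ?normr1 ?normr0 ?mulr1 ?mulr0 ?normc_ge0.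
  have ch2 : cintg mu h2.
    apply: L2_bsupp_cintg => //; exists m%:R => x xm.
    by rewrite /h2 /cindic indicE memNset ?mulr0// => -[].
  pose a n := n.+1%:R^-1 : R.
  have orth n : cint mu (fun s => cindic ubox s * inner mu phi (fun x => h2 (x + a n *: s))) = 0.
    rewrite (cint_correlation (a n) Lphi Lh2 ubox_cintg).
    have n0 : n.+1%:R != 0 :> R by rewrite pnatr_eq0.
    pose h1 x : R[i] := cindic ubox (n.+1%:R *: x).
    have h1E : h1 = fun x => cindic ubox ((n.+1%:R)%:M *m x + 0).
      by apply/funext => x; rewrite /h1 mul_scalar_mx addr0.
    have ch1 : cintg mu h1.
      by rewrite h1E; apply: cintg_linear; [exact: scal_det_neq0|exact: ubox_cintg].
    have Lh1 : L2 mu h1.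
      by rewrite h1E; apply: L2_linear; [exact: scal_det_neq0|exact: ubox_L2].
    have disj y x : cube d rho y -> h1 (x - y) * (h2 x)^* = 0.
      move=> /cubeE yr; rewrite /h1 /h2.
      have [xyu|nu] := pselect (ubox (n.+1%:R *: (x - y))); last first.
        by rewrite {1}/cindic indicE memNset// mul0r.
      rewrite [cindic S x]/cindic indicE memNset ?mulr0 ?conjc0 ?rmorph0 ?mulr0//.
      move=> [_]; apply; apply/cubeE => i.
      have := xyu i; rewrite in_itv/= !mxE => /andP[].
      rewrite pmulr_rge0 ?ltr0n// => h3 h4.
      have h5 : x i ord0 - y i ord0 <= 1.
        by apply: le_trans h4; rewrite ler_peMl// ler1n.
      have := yr i; rewrite !ler_norml => /andP[h6 h7]; apply/andP; split; lra.
    have := window_orth ch1 Lh1 ch2 Lh2 disj.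
    set W := fun y => cint mu (fun x => h1 (x - y) * (h2 x)^*) => phiW.
    pose c : R[i] := (n.+1%:R ^+ d)%:C.
    have c0 : c != 0.
      by rewrite -(rmorph0 (real_complex R)) (inj_eq (@complexI R)) expf_neq0.
    (* Substituting z = x + s/(n + 1) turns the average of [h2] over small shifts into its
       correlation with [h1], up to the Jacobian [c]. *)
    have pw x : cint mu (fun s => cindic ubox s * (phi x * (h2 (x + a n *: s))^*)) =
        c * (phi x * W x).
      pose G s := cindic ubox s * (h2 (x + a n *: s))^*.
      have cG : cintg mu G.
        apply: (@cintg_boundedM _ _ 1); first exact: ubox_L2.1.
          by move=> y; rewrite normc_real indicE; case: (_ \in _); rewrite ?normr1 ?normr0.
        apply: cintgJ; have := cintg_linear x (scal_det_neq0 (nV_neq0 n)) ch2.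
        by congr cintg; apply/funext => s; rewrite mul_scalar_mx addrC.
      transitivity (phi x * cint mu G).
        by rewrite -cintZ//; apply: eq_cint => s; rewrite /G mulrCA.
      rewrite mulrCA; congr (_ * _).
      have := cint_linear (- (n.+1%:R *: x)) (scal_det_neq0 n0) cG.
      move=> /(congr1 (fun z => c * z)).
      have cV : c * (`|\det ((n.+1%:R)%:M : 'M[R]_d)|^-1)%:C = 1.
        rewrite det_scalar ger0_norm; last by apply: exprn_ge0; exact: ler0n.
        rewrite /c -real_complexM [X in X%:C]divff//; exact: expf_neq0.
      rewrite [RHS]mulrA cV [RHS]mul1r => <-.
      congr (_ * _); apply: eq_cint => z; rewrite /G /h1.
      have -> : (n.+1%:R)%:M *m z - n.+1%:R *: x = n.+1%:R *: (z - x).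
        by rewrite mul_scalar_mx scalerBr.
      by rewrite /a scalerA mulVf// scale1r [x + _]addrC subrK.
    rewrite (eq_cint mu pw) cintZ ?phiW ?mulr0//.
    have := cintg_fubini2 (cmeas_correlation (a n) Lphi Lh2 ubox_cintg)
      (integrable_correlation (a n) Lphi Lh2 ubox_cintg).
    move=> /(cintgZ c^-1); congr cintg; apply/funext => x /=.
    by rewrite pw mulKf.
  have in0 : inner mu phi h2 = 0.
    have := approx_identity Lphi Lh2 ubox_cintg; rewrite ubox_cint mul1r => h.
    by apply: ccvg_unique h _; apply: ccvg_near_eq (ccvg_cst 0) => n; rewrite orth.
  (* [h2] is [phi] restricted to [S], so its product with [phi] is its own square. *)
  have self : inner mu h2 h2 = 0.
    rewrite -in0; apply: eq_cint => x; rewrite /h2 /cindic indicE.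
    by case: (_ \in _); rewrite ?mulr1// !mulr0 rmorph0 !mulr0.
  have N0 : N2 mu h2 = 0 by move: self; rewrite inner_self// => -[].
  have := N2_eq0 Lh2 N0; apply: filterS => x; rewrite /h2 /cindic indicE => h xm xr.
  by move: h; rewrite mem_set ?mulr1.
have [N [mN N0 hN]] : {ae mu, forall x, forall m : nat, cube d m%:R x -> ~ cube d (rho + 1) x -> phi x = 0}.
  exact/ae_foralln.
exists N; split => // x hx; apply: hN => /= h; apply: hx => xr.
by have [m xm] := cV_norm_bound x; exact: h xm xr.
Qed.

End weak_support.

(** The counterpart of [isF_eq0] in the other direction; it shows that the transform is determined
    almost everywhere by the class of the function. *)
Lemma isF_zero f g : isF f g -> N2 mu f = 0 -> N2 mu g = 0.
Proof.
move=> [Lf Lg [fn [h1 h2 h3]]] f0; pose c : R := (2 * pi) ^+ d.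
have bnd n : N2 mu g <= 2 * N2 mu (fun xi => FI (fn n) xi - g xi) +
    4 * c * N2 mu (fun x => fn n x - f x).
  have [cn Ln] := h1 n; have LF := FI_L2 cn Ln.
  have a1 := N2B LF (L2B LF Lg).
  have a2 := N2D (L2B Ln Lf) Lf.
  have E1 : (fun x => FI (fn n) x - (FI (fn n) x - g x)) = g.
    by apply/funext => x; rewrite opprB addrC subrK.
  have E2 : (fun x => fn n x - f x + f x) = fn n.
    by apply/funext => x; rewrite subrK.
  rewrite E1 FI_N2// -/c in a1; rewrite E2 f0 mulr0 addr0 in a2.
  have c0 : 0 <= c by apply: ltW; exact: twopi_gt0.
  have := ler_wpM2l c0 a2; lra.
have lim0 : (2 * N2 mu (fun xi => FI (fn n) xi - g xi) +
    4 * c * N2 mu (fun x => fn n x - f x)) @[n --> \oo] --> (0 : R).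
  rewrite -[X in _ --> X]addr0 -{1}(mulr0 2) -[X in _ --> _ + X](mulr0 (4 * c)).
  by apply: cvgD; apply: cvgMr.
apply: N2_le0_eq; rewrite -(cvg_lim _ lim0)//; apply: limr_ge.
  by apply/cvg_ex; eexists; exact: lim0.
by apply: nearW => n; exact: bnd.
Qed.

Lemma isF_unique f g f' g' : isF f g -> isF f' g' -> {ae mu, forall x, f x = f' x} ->
  {ae mu, forall xi, g xi = g' xi}.
Proof.
move=> h h' ff'.
have hB : isF (fun x => f x + -1 * f' x) (fun x => g x + -1 * g' x).
  by apply: isFD => //; exact: isFZ.
have [Lf Lg _] := hB.
have f0 : N2 mu (fun x => f x + -1 * f' x) = 0.
  have -> : N2 mu (fun x => f x + -1 * f' x) = N2 mu (fun=> (0 : R[i])).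
    congr fine; apply: sq_ae; [exact: Lf.1|exact: cmeas_cst|].
    by apply: filterS ff' => x ->; rewrite mulN1r subrr.
  by rewrite /N2 /sq; under eq_integral do rewrite normc0 expr0n/=; rewrite integral0.
have := N2_eq0 Lg (isF_zero hB f0); apply: filterS => x /eqP.
by rewrite mulN1r subr_eq0 => /eqP.
Qed.

(** A representative which vanishes everywhere off the cube is integrable, and [FI] applies to
    it. *)
Lemma csupp_cut f rho : L2 mu f -> {ae mu, forall x, ~ cube d rho x -> f x = 0} ->
  let f1 := fun x => f x * cindic (cube d rho) x in
  [/\ L2 mu f1, cintg mu f1, forall x, ~ cube d rho x -> f1 x = 0 &
      {ae mu, forall x, f x = f1 x}].
Proof.
move=> Lf fr f1.
have f10 x : ~ cube d rho x -> f1 x = 0.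
  by move=> xr; rewrite /f1 /cindic indicE memNset// mulr0.
have L1 : L2 mu f1.
  apply: (L2_le _ Lf).
    by apply: cmeasM; [exact: Lf.1|apply: cmeas_cindic; exact: measurable_cube].
  move=> x; rewrite normcM normc_real indicE; case: (_ \in _);
    by rewrite ?normr1 ?normr0 ?mulr1 ?mulr0 ?normc_ge0.
split => //; first by apply: L2_bsupp_cintg => //; exists rho.
apply: filterS fr => x h; rewrite /f1 /cindic indicE.
have [|/negP xr] := boolP (x \in cube d rho); first by rewrite mulr1.
by rewrite mulr0 h// => xr'; apply: xr; rewrite inE.
Qed.

Section refinable_function.
Variables (M : 'M[int]_d) (a : zmask R d) (phi : Rd -> R[i]).
Hypothesis dM : dilation_matrix (R := R) M.
Hypothesis a0 : mask_hat a (0 : Rd) = 1.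
Hypothesis a1 : forall xi : Rd, normc (mask_hat a xi) <= 1.
Hypothesis Lphi : L2 mu phi.
Hypothesis phiE : {ae mu, forall xi, fourier phi xi = mask_product M a xi}.

Lemma refinable_csupp : csupp phi.
Proof.
have [rho hrho] := pprod_exp_sum a dM.
exists (rho + 1); apply: (weak_csupp (fourierP Lphi) hrho).
  by move=> m xi; exact: pprod_le1.
by apply: filterS phiE => xi ->; exact: pprod_cvg.
Qed.

(** The transform of the truncated representative and the infinite product agree only almost
    everywhere, so they cannot be compared at 0. Both are within a constant times |xi| of their
    values at 0, and a small cube of positive measure contains points where they agree. *)
Lemma refinable_cint : cint mu phi = 1.
Proof.
have [rho0 hr0] := refinable_csupp.
pose rho := `|rho0|.
have hr : {ae mu, forall x, ~ cube d rho x -> phi x = 0}.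
  apply: filterS hr0 => x h xr; apply: h; apply: contra_not xr; apply: cube_le.
  exact: ler_norm.
have [L1 c1 z1 e1'] := csupp_cut Lphi hr.
set phi1 := fun x => _ in L1 c1 z1 e1'.
have -> : cint mu phi = cint mu phi1.
  by apply: cint_ae => //; [exact: Lphi.1|exact: L1.1].
have FE : {ae mu, forall xi, FI phi1 xi = mask_product M a xi}.
  have := isF_unique (fourierP Lphi) (isF_FI c1 L1) e1'.
  by apply: filterS2 phiE => xi -> ->.
have [C C0 hC] := mask_product_near1 dM a0 a1.
pose D := norm1 phi1 * rho.
have lip xi : normc (FI phi1 xi - cint mu phi1) <= D * onorm xi.
  rewrite /FI -cintB//; last exact: FI_cintg.
  have cB : cintg mu (fun x => phi1 x * expi (- dotR x xi) - phi1 x).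
    by apply: cintgB => //; exact: FI_cintg.
  rewrite -lee_fin; apply: le_trans (cint_normc_le cB) _.
  have RO0 : 0 <= rho * onorm xi by rewrite mulr_ge0 ?normr_ge0 ?onorm_ge0.
  have mphi : measurable_fun setT (fun x => (normc (phi1 x))%:E).
    by apply/measurable_EFinP/cmeas_normc; exact: L1.1.
  rewrite /D -mulrA [norm1 _ * _]mulrC EFinM norm1E// -ge0_integralZl//; last first.
    by move=> x _; rewrite lee_fin normc_ge0.
  apply: ge0_le_integral => //.
  - by move=> x _; rewrite lee_fin normc_ge0.
  - by apply/measurable_EFinP/cmeas_normc; exact: cintg_meas cB.
  - by apply: emeasurable_funM.
  move=> x _; rewrite -EFinM lee_fin -{2}(mulr1 (phi1 x)) -mulrBr normcM.
  have [xr|xr] := pselect (cube d rho x); last by rewrite (z1 x xr : phi1 x = 0) normc0 mul0r mulr0.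
  rewrite [leRHS]mulrC ler_wpM2l ?normc_ge0//.
  apply: le_trans (normc_expi_sub1 _) _.
  by rewrite normrN dotR_le.
have bnd : {ae mu, forall xi, normc (cint mu phi1 - 1) <= (D + C) * onorm xi}.
  apply: filterS FE => xi fe.
  have -> : cint mu phi1 - 1 = (cint mu phi1 - FI phi1 xi) + (FI phi1 xi - 1) by ring.
  apply: le_trans (le_normcD _ _) _; rewrite mulrDl; apply: lerD.
    by rewrite -normcN opprB.
  by rewrite fe.
have K0 : 0 <= D + C by rewrite addr_ge0// mulr_ge0 ?normr_ge0 ?norm1_ge0.
suff : normc (cint mu phi1 - 1) = 0.
  by move/eq0_normc/eqP; rewrite subr_eq0 => /eqP.
apply/eqP; rewrite eq_le normc_ge0 andbT leNgt; apply/negP => p0.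
set p := normc _ in bnd p0.
(* On the cube of this size the linear bound is at most (D + C) d e, which is less than p; the
   summand 1 keeps the denominator positive. *)
pose e := p / (2 * ((D + C) * d%:R + 1)).
have q0 : 0 < (D + C) * d%:R + 1 by rewrite ltr_wpDl// mulr_ge0.
have e0 : 0 < e by rewrite divr_gt0// mulr_gt0.
have [N [mN N0 hN]] := bnd.
have mc : (0 < mu (cube d e))%E.
  rewrite /cube lebesgue_cV_box; last by move=> i; rewrite !mxE; lra.
  by rewrite lte_fin; apply: prodr_gt0 => i _; rewrite !mxE; lra.
have : (mu (cube d e) <= mu N)%E.
  apply: le_measure; rewrite ?inE//; first exact: measurable_cube.
  move=> xi /cubeE xe; apply: hN => /= h; move: h; apply/negP; rewrite -ltNge.
  apply: le_lt_trans (_ : (D + C) * (d%:R * e) < _).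
    rewrite ler_wpM2l// /onorm (le_trans (ler_sum _ (fun i _ => xe i)))//.
    by rewrite sumr_const card_ord mulr_natl.
  have -> : p = e * (2 * ((D + C) * d%:R + 1)) by rewrite /e divfK// gt_eqF// mulr_gt0.
  nra.
by rewrite N0 leNgt mc.
Qed.

End refinable_function.

End compact_support.

(** * Sampling on lattices *)

Section lattice.
Context {R : realType}.

Definition floorV d (x : 'cV[R]_d) : 'cV[int]_d := \col_i Num.floor (x i ord0).
(** The half-open unit cube with lower corner [k]; half-open, so that the cells partition the
    space. *)
Definition cell d (k : 'cV[int]_d) : set 'cV[R]_d := [set x | floorV x = k].

Lemma floorV_frac d (x : 'cV[R]_d) i : 0 <= (x - Zd_R (floorV x)) i ord0 <= 1.
Proof.
have /andP[h1 h2] := floor_itv (x i ord0).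
rewrite 3!mxE mxE subr_ge0 h1 lerBlDr; apply: ltW; move: h2.
by rewrite intrD addrC.
Qed.

Lemma cellE d (k : 'cV[int]_d) (x : 'cV[R]_d) :
  cell k x <-> forall i, x i ord0 \in `[(k i ord0)%:~R, (k i ord0 + 1)%:~R[.
Proof.
split=> [<- i|h]; first by rewrite in_itv/= mxE floor_itv.
by apply/colP => i; rewrite mxE; apply: floor_def; have := h i; rewrite in_itv.
Qed.

Lemma measurable_cell d (k : 'cV[int]_d) : measurable (cell k).
Proof.
rewrite (_ : cell k = \big[setI/setT]_i
    ((fun x : 'cV[R]_d => x i ord0) @^-1` `[(k i ord0)%:~R, (k i ord0 + 1)%:~R[%classic)).
  apply: bigsetI_measurable => i _; rewrite -[X in measurable X]setTI.
  exact: measurable_coord.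
apply/seteqP; split => [x /cellE xab|x].
  by rewrite -bigcap_seq => i _ /=; exact: xab.
by rewrite -bigcap_seq => xab; apply/cellE => i; apply: xab => /=; rewrite mem_index_enum.
Qed.

Lemma lebesgue_cV_cell d (k : 'cV[int]_d) : lebesgue_cV R d (cell k) = 1%:E.
Proof.
elim: d k => [|d IH] k /=.
  by rewrite diracE mem_set//; apply/cellE => -[].
rewrite /lebesgue_cV_step /pushforward.
pose tl : 'cV[int]_d := \col_(i < d) k (lift ord0 i) ord0.
rewrite (_ : _ @^-1` _ =
    `[(k ord0 ord0)%:~R, (k ord0 ord0 + 1)%:~R[%classic `*` cell tl); last first.
  apply/seteqP; split => -[t x] /=.
    move=> /cellE H; split => [|/=].
      by have := H ord0; rewrite /cV_cons mxE unlift_none.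
    by apply/cellE => i; have := H (lift ord0 i); rewrite /cV_cons !mxE liftK.
  move=> [/= t0 /cellE H]; apply/cellE => i; rewrite /cV_cons mxE.
  case: unliftP => [j ->|->] //=.
  by have := H j; rewrite !mxE.
rewrite product_measure1E//; last exact: measurable_cell.
rewrite IH mule1; apply: etrans (lebesgue_measure_itv _) _ => /=.
by rewrite lte_fin ltr_int ltrDl ltr01 -EFinB intrD addrC addKr.
Qed.

Lemma int_cube_finite d (K : R) : exists s : seq 'cV[int]_d,
  uniq s /\ forall k, cube d K (Zd_R k) -> k \in s.
Proof.
pose N := Num.truncn `|K|.
pose v (g : {ffun 'I_d -> 'I_(N + N).+1}) : 'cV[int]_d := \col_i ((g i : nat)%:Z - N%:Z).
exists (undup [seq v g | g <- enum {ffun 'I_d -> 'I_(N + N).+1}]).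
split; first exact: undup_uniq.
move=> k /cubeE kK; rewrite mem_undup; apply/mapP.
have kN i : (`|k i ord0| <= N%:Z)%R.
  have := kK i; rewrite mxE -intr_norm => h.
  have : (`|k i ord0|%N%:R : R) <= `|K|.
    by rewrite natr_absz; apply: le_trans h (ler_norm K).
  rewrite -truncn_ge_nat// -/N; lia.
exists [ffun i => inord `|(k i ord0 + N%:Z)%R|%N]; first by rewrite mem_enum.
apply/colP => i; rewrite mxE ffunE; have := kN i => h.
have b : (`|(k i ord0 + N%:Z)%R|%N < (N + N).+1)%N by lia.
rewrite inordK// -[LHS]/(k i ord0); move: (k i ord0) h => z; lia.
Qed.

Lemma esum_seq (T : choiceType) (s : seq T) (h : T -> \bar R) : uniq s ->
  (forall k, 0 <= h k)%E -> (forall k, k \notin s -> h k = 0%E) ->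
  (\esum_(k in [set: T]) h k = \sum_(k <- s) h k)%E.
Proof.
move=> us h0 hs.
have -> : (\esum_(k in [set: T]) h k = \esum_(k in [set` s]) h k)%E.
  rewrite [RHS]esum_mkcond; apply: eq_esum => k _.
  case: ifPn => // ks; apply: hs; apply: contra ks => ks.
  by rewrite inE.
by rewrite esum_fset// [RHS]fsbig_seq.
Qed.

Lemma floorV_simple (A : zmodType) d (s : seq 'cV[int]_d) (h : 'cV[int]_d -> A)
    (x : 'cV[R]_d) : uniq s -> (forall k, k \notin s -> h k = 0) ->
  h (floorV x) = \sum_(k <- s) (if floorV x == k then h k else 0).
Proof.
move=> us hs; have [xs|xs] := boolP (floorV x \in s).
  rewrite (bigD1_seq _ xs us)/= eqxx big1 ?addr0// => k.
  by rewrite eq_sym => /negbTE ->.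
rewrite hs// big_seq big1// => k ks; case: eqP => // e.
by rewrite e ks in xs.
Qed.

Lemma indic_cell d (k : 'cV[int]_d) (x : 'cV[R]_d) :
  \1_(cell k) x = (floorV x == k)%:R :> R.
Proof.
rewrite indicE; congr (nat_of_bool _)%:R.
by apply/idP/eqP => [|h]; rewrite inE.
Qed.

Lemma cmeas_floorV d (s : seq 'cV[int]_d) (h : 'cV[int]_d -> R[i]) : uniq s ->
  (forall k, k \notin s -> h k = 0) -> cmeas (fun x : 'cV[R]_d => h (floorV x)).
Proof.
move=> us hs; under eq_fun do rewrite (floorV_simple _ us hs).
apply: cmeas_sum => k.
have -> : (fun x : 'cV[R]_d => if floorV x == k then h k else 0) =
    (fun x => h k * cindic (cell k) x).
  apply/funext => x; rewrite /cindic indic_cell; case: eqP => _ /=.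
    by rewrite rmorph1 mulr1.
  by rewrite rmorph0 mulr0.
by apply: cmeasZ; apply: cmeas_cindic; exact: measurable_cell.
Qed.

Lemma integral_floorV d (s : seq 'cV[int]_d) (h : 'cV[int]_d -> R) : uniq s ->
  (forall k, 0 <= h k) -> (forall k, k \notin s -> h k = 0) ->
  (\int[lebesgue_cV R d]_x (h (floorV x))%:E = (\sum_(k <- s) h k)%:E)%E.
Proof.
move=> us h0 hs.
have E x : ((h (floorV x))%:E = \sum_(k <- s) (h k)%:E * (\1_(cell k) x)%:E)%E.
  rewrite (floorV_simple _ us hs) -sumEFin; apply: eq_bigr => k _.
  by rewrite indic_cell -EFinM; case: eqP => _; rewrite ?mulr1 ?mulr0.
under eq_integral do rewrite E.
have m1 k : measurable_fun [set: 'cV[R]_d] (fun x => (\1_(cell k) x)%:E : \bar R).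
  by apply/measurable_EFinP; apply: measurable_indic; exact: measurable_cell.
rewrite ge0_integral_sum//; last 2 first.
- by move=> k; apply: emeasurable_funM.
- by move=> k x _; rewrite -EFinM lee_fin mulr_ge0.
rewrite -sumEFin; apply: eq_bigr => k _.
rewrite ge0_integralZl ?lee_fin//.
rewrite (_ : (\int[_]_x (\1_(cell k) x)%:E)%E = 1%:E) ?mule1//.
rewrite -(lebesgue_cV_cell k); apply: integral_indicT; exact: measurable_cell.
Qed.

End lattice.

(** * Frame coefficients and the sampling operator *)

Section coefficients.
Context {R : realType} {n : nat}.
Local Notation d := n.+1.
Local Notation Rd := 'cV[R]_d.
Local Notation Zd := 'cV[int]_d.
Local Notation mu := (lebesgue_cV R d).
Implicit Types (f g : Rd -> R[i]) (U : 'M[R]_d) (k : Zd).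

Definition coef f g U k : R[i] := inner mu f (dilshift g U k).

Lemma dilshift_L2 g U k : \det U != 0 -> L2 mu g -> L2 mu (dilshift g U k).
Proof. by move=> U0 Lg; apply: L2Z; exact: L2_linear. Qed.

Lemma coefE f g U k : \det U != 0 -> L2 mu f -> L2 mu g ->
  coef f g U k = (Num.sqrt `|\det U| * `|\det U|^-1)%:C *
    cint mu (fun y => f (invmx U *m (y + Zd_R k)) * (g y)^*).
Proof.
move=> U0 Lf Lg; have Uu : U \in unitmx by rewrite unitmxE unitfE.
have V0 : \det (invmx U) != 0 by rewrite det_inv invr_eq0.
rewrite /coef /dilshift innerZr//; last exact: L2_linear.
rewrite -[(Num.sqrt _)%:C^*]/(conjc _) conjc_real real_complexM -mulrA; congr (_ * _).
have Lf' : L2 mu (fun y => f (invmx U *m (y + Zd_R k))).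
  have := L2_linear (invmx U *m Zd_R k) V0 Lf.
  by under eq_fun do rewrite -mulmxDr.
rewrite -(cint_linear (- Zd_R k) U0); last exact: cintg_mulJ.
by apply: eq_cint => x; rewrite subrK mulKmx.
Qed.

(** After y = U x - k the normalisation |det U|^(1/2) and the Jacobian leave |det U|^-1, which is
    the volume of a sampling cell. *)
Lemma coef_normc f g U k : \det U != 0 -> L2 mu f -> L2 mu g ->
  normc (coef f g U k) ^+ 2 = `|\det U|^-1 *
    normc (cint mu (fun y => f (invmx U *m (y + Zd_R k)) * (g y)^*)) ^+ 2.
Proof.
move=> U0 Lf Lg; rewrite coefE// normcM exprMn normc_real; congr (_ * _).
rewrite ger0_norm; last by rewrite mulr_ge0 ?sqrtr_ge0 ?invr_ge0.
rewrite exprMn sqr_sqrtr// expr2 mulrA mulfV ?mul1r// normr_eq0//.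
Qed.

Lemma coef_ae f g g' U k : \det U != 0 -> L2 mu f -> L2 mu g -> L2 mu g' ->
  {ae mu, forall x, g x = g' x} -> coef f g U k = coef f g' U k.
Proof.
move=> U0 Lf Lg Lg' gg'; apply: inner_aer.
- exact: Lf.1.
- by have [] := dilshift_L2 k U0 Lg.
- by have [] := dilshift_L2 k U0 Lg'.
- by have := ae_linear (- Zd_R k) U0 gg'; apply: filterS => x h; rewrite /dilshift h.
Qed.

Lemma mulmx_cube U (x : Rd) (B : R) : 0 <= B -> cube d B x ->
  cube d ((\sum_i \sum_j `|U i j|) * B) (U *m x).
Proof.
move=> B0 /cubeE xB; apply/cubeE => i; rewrite mxE.
apply: le_trans (ler_norm_sum _ _ _) _.
apply: (@le_trans _ _ ((\sum_j `|U i j|) * B)).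
  by rewrite mulr_suml; apply: ler_sum => j _; rewrite normrM ler_wpM2l.
rewrite ler_wpM2r// [leRHS](bigD1 i)//= lerDl.
by apply: sumr_ge0 => j _; apply: sumr_ge0.
Qed.

Lemma cubeD (x y : Rd) (A B : R) : cube d A x -> cube d B y -> cube d (A + B) (x + y).
Proof.
move=> /cubeE h1 /cubeE h2; apply/cubeE => i; rewrite mxE.
by apply: le_trans (ler_normD _ _) _; apply: lerD.
Qed.

Lemma cubeN (x : Rd) (A : R) : cube d A x -> cube d A (- x).
Proof. by move=> /cubeE h1; apply/cubeE => i; rewrite mxE normrN. Qed.

(** A nonzero coefficient forces some x in the support of [f] with U x - k in that of [g], so k lies
    in a bounded set. *)
Lemma coef_finite f g U : \det U != 0 -> L2 mu f -> bsupp f -> L2 mu g -> csupp g ->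
  exists s : seq Zd, uniq s /\ forall k, k \notin s -> coef f g U k = 0.
Proof.
move=> U0 Lf [B fB] Lg [rho grho].
have [s [us hs]] := @int_cube_finite R d ((\sum_i \sum_j `|U i j|) * `|B| + rho).
exists s; split => // k /negP ks.
have L1 := dilshift_L2 k U0 Lg.
rewrite /coef /inner -(cint0 mu); apply: cint_ae.
- by apply: cmeasM; [exact: Lf.1|apply: cmeasJ; exact: L1.1].
- exact: cmeas_cst.
have := ae_linear (- Zd_R k) U0 grho; apply: filterS => x h.
have [xB|xB] := pselect (cube d `|B| x); last first.
  rewrite fB ?mul0r// => xB'; apply: xB; exact: cube_le (ler_norm _) _ xB'.
rewrite /dilshift h ?mulr0 ?rmorph0 ?mulr0// => xr; apply: ks; apply: hs.
have -> : Zd_R k = U *m x + - (U *m x - Zd_R k) by rewrite opprB addrC subrK.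
by apply: cubeD; [exact: mulmx_cube|exact: cubeN].
Qed.

Definition energy f g U : \bar R :=
  (\esum_(k in [set: Zd]) (normc (coef f g U k) ^+ 2)%:E)%E.

Lemma energy_ae f g g' U : \det U != 0 -> L2 mu f -> L2 mu g -> L2 mu g' ->
  {ae mu, forall x, g x = g' x} -> energy f g U = energy f g' U.
Proof.
by move=> *; apply: eq_esum => k _; congr (normc _ ^+ 2)%:E; exact: coef_ae.
Qed.

(* The energy is the squared norm of a step function which is constant on the
   cells U^-1 (k + [0,1)^d) and approximates [f] when U^-1 is small. *)
Definition sampled f g U (x : Rd) : R[i] :=
  cint mu (fun y => f (invmx U *m (y + Zd_R (floorV (U *m x)))) * (g y)^*).

(** The factor |det U|^-1 in [coef_normc] is exactly the Jacobian that turns the sum over k, as an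
    integral over unit cells, into an integral over cells of U^-1 Z^d. *)
Lemma energy_sampled f g U : \det U != 0 -> L2 mu f -> bsupp f -> L2 mu g -> csupp g ->
  cmeas (sampled f g U) /\ energy f g U = sq mu (sampled f g U).
Proof.
move=> U0 Lf bf Lg sg; have [s [us hs]] := coef_finite U0 Lf bf Lg sg.
pose H k := cint mu (fun y => f (invmx U *m (y + Zd_R k)) * (g y)^*).
have D0 : `|\det U|^-1 != 0 by rewrite invr_eq0 normr_eq0.
have Hs k : k \notin s -> H k = 0.
  move=> ks; apply: eq0_normc; apply/eqP; rewrite -sqrf_eq0.
  have := coef_normc k U0 Lf Lg; rewrite hs// normc0 expr0n/= => /esym/eqP.
  by rewrite mulf_eq0 (negbTE D0).
split.
  have := cmeas_linear U 0 (cmeas_floorV us Hs).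
  by under eq_fun do rewrite addr0.
rewrite /energy (@esum_seq _ _ s)//; last 2 first.
- by move=> k; rewrite lee_fin sqr_ge0.
- by move=> k ks; rewrite hs// normc0 expr0n.
have h0 k : 0 <= normc (H k) ^+ 2 by exact: sqr_ge0.
have hs2 k : k \notin s -> normc (H k) ^+ 2 = 0 by move=> ks; rewrite Hs// normc0 expr0n.
rewrite sumEFin; under eq_bigr do rewrite coef_normc// -/(H _).
rewrite -mulr_sumr EFinM -(integral_floorV us h0 hs2).
rewrite -(ge0_integral_linear 0 U0); first by apply: eq_integral => x _; rewrite addr0.
  apply/measurable_EFinP; apply: measurable_funX; apply: cmeas_normc.
  exact: cmeas_floorV us Hs.
by move=> x; rewrite lee_fin.
Qed.

End coefficients.

(** * Convergence of the low-pass energies to the squared norm *)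

Section lowpass.
Context {R : realType} {n : nat}.
Local Notation d := n.+1.
Local Notation Rd := 'cV[R]_d.
Local Notation mu := (lebesgue_cV R d).
Variable M : 'M[int]_d.
Hypothesis dM : dilation_matrix (R := R) M.
Local Notation U := (mx_R M : 'M[R]_d).

Let w j : R := \sum_i \sum_l `|(invmx U ^+ j) i l|.

Let w_ge0 j : 0 <= w j.
Proof. by apply: sumr_ge0 => i _; apply: sumr_ge0. Qed.

Lemma dilation_pow_cvg : w j @[j --> \oo] --> (0 : R).
Proof.
have [C hC] := dilation_bsum dM.
apply: cvg_series_cvg_0; apply: nondecreasing_is_cvgn.
  by apply: nondecreasing_series => k _ _; exact: w_ge0.
by exists C => _ [k _ <-]; rewrite /series /= big_mkord; exact: hC.
Qed.

Lemma dilation_pow_bounded : exists2 C : R, 0 <= C & forall j, w j <= C.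
Proof.
have [C hC] := dilation_bsum dM.
have C0 : 0 <= C by have := hC 0%N; rewrite big_ord0.
exists C => // j; apply: le_trans (hC j.+1); rewrite big_ord_recr/= lerDr.
by apply: sumr_ge0 => i _; exact: w_ge0.
Qed.

Lemma pow_unit j : U ^+ j \in unitmx.
Proof. by have := dilation_unit dM; exact: unitrX. Qed.

Lemma pow_det_neq0 j : \det (U ^+ j) != 0.
Proof. by rewrite -unitfE -unitmxE pow_unit. Qed.

Lemma pow_inv j : invmx (U ^+ j) = invmx U ^+ j.
Proof. by rewrite -[invmx U]/(U^-1) exprVn. Qed.

(** The displacement is the j-th inverse power applied to y minus the fractional part of U^j x, a
    bounded vector. *)
Lemma sample_point_dist j (x y : Rd) (K : R) : 0 <= K -> cube d K y ->
  cube d (w j * (K + 1)) (invmx (U ^+ j) *m (y + Zd_R (floorV (U ^+ j *m x))) - x).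
Proof.
move=> K0 yK; set z := U ^+ j *m x.
have -> : invmx (U ^+ j) *m (y + Zd_R (floorV z)) - x =
    (invmx U ^+ j) *m (y - (z - Zd_R (floorV z))).
  rewrite opprB addrA mulmxBr pow_inv /z; congr (_ - _).
  by rewrite -pow_inv mulKmx// pow_unit.
apply: mulmx_cube; first by rewrite addr_ge0.
apply: cubeD => //; apply: cubeN; apply/cubeE => i.
have /andP[h1 h2] := floorV_frac z i.
by rewrite ger0_norm.
Qed.

(** For fixed x the sample points tend to x, so the sampled function tends to f(x) times the
    conjugate of the integral of [phi], which is 1. The samples are bounded uniformly and live on
    one cube, which justifies both limits. *)
Lemma lowpass_limit f phi : test_fun f -> L2 mu phi -> csupp phi -> cint mu phi = 1 ->
  energy f phi (U ^+ j) @[j --> \oo] --> sq mu f.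
Proof.
move=> tf Lphi0 [rho0 phi0] phi01.
have [mf [C fC] [B fB] sf] := tf; have Lf := test_L2 tf.
pose rho := `|rho0|.
have hr : {ae mu, forall x, ~ cube d rho x -> phi x = 0}.
  apply: filterS phi0 => x h xr; apply: h; apply: contra_not xr; apply: cube_le.
  exact: ler_norm.
have [Lp cp zp pE] := csupp_cut Lphi0 hr.
set p := fun x => _ in Lp cp zp pE.
have p1 : cint mu p = 1.
  by rewrite -phi01; apply: cint_ae => //; [exact: Lp.1|exact: Lphi0.1|apply: filterS pE => x ->].
have bf : bsupp f by exists B.
have sp : csupp p by exists rho; apply: aeW => x; exact: zp.
have C0 : 0 <= C by apply: le_trans (fC 0); rewrite normc_ge0.
pose F j := sampled f p (U ^+ j).
have EF j : cmeas (F j) /\ energy f phi (U ^+ j) = sq mu (F j).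
  rewrite (energy_ae (pow_det_neq0 j) Lf Lphi0 Lp pE).
  exact: energy_sampled (pow_det_neq0 j) Lf bf Lp sp.
have Flim x : ccvg (F ^~ x) (f x).
  have -> : f x = cint mu (fun y => f x * (p y)^*).
    rewrite cintZ; last exact: cintgJ.
    by rewrite cintJ// p1 rmorph1 mulr1.
  apply: (@cint_dct _ _ _ mu _ _ (fun y => C * normc (p y))).
  - move=> j; apply: cmeasM; last by apply: cmeasJ; exact: Lp.1.
    have := cmeas_linear (invmx (U ^+ j)) (invmx (U ^+ j) *m Zd_R (floorV (U ^+ j *m x))) mf.
    by under eq_fun do rewrite -mulmxDr.
  - by apply: cmeasZ; apply: cmeasJ; exact: Lp.1.
  - by apply: integrable_mulr; exact: cintg_normc.
  - apply: aeW => y; apply: ccvgM; last exact: ccvg_cst.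
    apply: sf => i; have [K yK] := cV_norm_bound y.
    have K0 : 0 <= K%:R :> R by [].
    apply/cvgrPdist_le => e e0.
    have h0 : (w j * (K%:R + 1)) @[j --> \oo] --> (0 : R).
      by rewrite -(mul0r (K%:R + 1)); apply: cvgMl; exact: dilation_pow_cvg.
    move/cvgrPdist_le : h0 => /(_ _ e0).
    apply: filterS => j; rewrite sub0r normrN => h.
    have /cubeE/(_ i) := sample_point_dist j x K0 yK.
    rewrite distrC mxE [in X in _ + X]mxE => h2; apply: le_trans h2 _.
    by apply: le_trans h; rewrite ler_norm.
  - by move=> j y; rewrite normcM normcJ ler_wpM2r ?normc_ge0.
have [W W0 hW] := dilation_pow_bounded.
(* A sample point in the support of [f] is within W (rho + 1) of x, whatever j, so the sampled
   functions all vanish off this cube. *)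
pose B' := `|B| + W * (rho + 1).
have rho0' : 0 <= rho by exact: normr_ge0.
have F0 j x : ~ cube d B' x -> F j x = 0.
  move=> xB; rewrite /F /sampled; rewrite -(cint0 mu); apply: eq_cint => y.
  have [yr|yr] := pselect (cube d rho y); last by rewrite (zp y yr : p y = 0) rmorph0 mulr0.
  rewrite fB ?mul0r// => zB; apply: xB.
  set z := invmx _ *m _ in zB.
  have -> : x = z - (z - x) by rewrite opprB addrC subrK.
  apply: cubeD; first exact: cube_le (ler_norm _) _ zB.
  apply: cubeN; apply: cube_le (sample_point_dist j x rho0' yr).
  by rewrite ler_wpM2r// addr_ge0.
have FC j x : normc (F j x) <= C * norm1 p.
  have Lf' : L2 mu (fun y => f (invmx (U ^+ j) *m (y + Zd_R (floorV (U ^+ j *m x))))).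
    have V0 : \det (invmx (U ^+ j)) != 0 by rewrite det_inv invr_eq0 pow_det_neq0.
    have := L2_linear (invmx (U ^+ j) *m Zd_R (floorV (U ^+ j *m x))) V0 Lf.
    by under eq_fun do rewrite -mulmxDr.
  have cF := cintg_mulJ Lf' Lp.
  rewrite -lee_fin; apply: le_trans (cint_normc_le cF) _.
  have mp : measurable_fun setT (fun x => (normc (p x))%:E).
    by apply/measurable_EFinP/cmeas_normc; exact: Lp.1.
  rewrite EFinM norm1E// -ge0_integralZl ?lee_fin//; last first.
    by move=> y _; rewrite lee_fin normc_ge0.
  apply: ge0_le_integral => //.
  - by move=> y _; rewrite lee_fin normc_ge0.
  - by apply/measurable_EFinP/cmeas_normc; exact: cintg_meas cF.
  - by apply: emeasurable_funM.
  - by move=> y _; rewrite -EFinM lee_fin normcM normcJ ler_wpM2r ?normc_ge0.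
pose D := C * norm1 p.
have D0 : 0 <= D by rewrite mulr_ge0// norm1_ge0.
have LF j : L2 mu (F j).
  have LD : L2 mu (fun x => D%:C * cindic (cube d B') x).
    by apply: L2Z; apply: L2_cindic; [exact: measurable_cube|exact: cube_lty].
  apply: (L2_le (EF j).1 LD) => x; rewrite normcM !normc_real (ger0_norm D0).
  have [xB|xB] := pselect (cube d B' x).
    by rewrite indicE mem_set// normr1 mulr1.
  by rewrite F0// normc0 mulr_ge0.
have lim : ccvg (fun j => cint mu (fun x => F j x * (F j x)^*)) (cint mu (fun x => f x * (f x)^*)).
  apply: (@cint_dct _ _ _ mu _ _ (fun x => D ^+ 2 * normc (cindic (cube d B') x))).
  - by move=> j; apply: cmeasM; [exact: (EF j).1|apply: cmeasJ; exact: (EF j).1].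
  - by apply: cmeasM => //; exact: cmeasJ.
  - apply: integrable_mulr; apply: cintg_normc; apply: L2_bsupp_cintg.
      by apply: L2_cindic; [exact: measurable_cube|exact: cube_lty].
    by exists B' => x xB; rewrite /cindic indicE memNset.
  - by apply: aeW => x; apply: ccvgM; [exact: Flim|apply: ccvgJ; exact: Flim].
  - move=> j x; rewrite normcM normcJ normc_real.
    have [xB|xB] := pselect (cube d B' x).
      rewrite indicE mem_set// normr1 mulr1 -expr2.
      by rewrite lerXn2r ?nnegrE ?normc_ge0//; exact: FC.
    by rewrite F0// normc0 mul0r mulr_ge0 ?sqr_ge0.
have {}lim : N2 mu (F j) @[j --> \oo] --> N2 mu f.
  have e g : L2 mu g -> complex.Re (cint mu (fun x => g x * (g x)^*)) = N2 mu g.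
    by move=> Lg; rewrite -[cint mu _]/(inner mu g g) inner_self.
  by case: lim => + _; rewrite e//; under eq_fun do rewrite e//.
under eq_fun do rewrite (EF _).2 sqE//.
by rewrite sqE//; apply: cvg_EFin => //; exact: nearW.
Qed.

End lowpass.

(** * Filter banks *)

Section cosets.
Context {R : realType} {n : nat}.
Local Notation d := n.+1.
Local Notation Rd := 'cV[R]_d.
Local Notation Zd := 'cV[int]_d.
Local Notation mu := (lebesgue_cV R d).

Lemma Zd_RD (k l : Zd) : Zd_R (k + l) = Zd_R k + Zd_R l :> Rd.
Proof. by rewrite /Zd_R map_mxD. Qed.
Lemma Zd_RN (k : Zd) : Zd_R (- k) = - Zd_R k :> Rd.
Proof. by rewrite /Zd_R map_mxN. Qed.
Lemma Zd_R0 : Zd_R 0 = 0 :> Rd.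
Proof. by rewrite /Zd_R map_mx0. Qed.
Lemma Zd_RM (M : 'M[int]_d) (k : Zd) : Zd_R (M *m k) = mx_R M *m Zd_R k :> Rd.
Proof. by rewrite /Zd_R map_mxM. Qed.
Lemma Zd_R_inj : injective (Zd_R : Zd -> Rd).
Proof. by move=> k l /matrixP h; apply/colP => i; have := h i ord0; rewrite !mxE => /intr_inj. Qed.

Lemma floorV_addZ (x : Rd) (z : Zd) : floorV (x + Zd_R z) = floorV x + z.
Proof. by apply/colP => i; rewrite !mxE floorDrz ?intr_int// intrKfloor. Qed.

Lemma floorV_Z (z : Zd) : floorV (Zd_R z : Rd) = z.
Proof. by apply/colP => i; rewrite !mxE intrKfloor. Qed.

Variable A : 'M[int]_d.
Hypothesis A0 : \det (mx_R A : 'M[R]_d) != 0.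
Local Notation iA := (invmx (mx_R A) : 'M[R]_d).

Let Au : (mx_R A : 'M[R]_d) \in unitmx. Proof. by rewrite unitmxE unitfE. Qed.

(* [repr 0] selects the representatives of Z^d / A Z^d lying in A [0,1)^d. *)
Definition repr (x : Rd) (k : Zd) : bool := floorV (iA *m (x + Zd_R k)) == 0.
(** Moves [k] by an element of A Z^d into the set of representatives selected by [x]. *)
Definition reduce (x : Rd) (k : Zd) : Zd := k - A *m floorV (iA *m (x + Zd_R k)).

Lemma floorV_shift (x : Rd) (k z : Zd) :
  floorV (iA *m (x + Zd_R (k + A *m z))) = floorV (iA *m (x + Zd_R k)) + z.
Proof. by rewrite Zd_RD addrA mulmxDr Zd_RM mulKmx// floorV_addZ. Qed.

Lemma repr_reduce x k : repr x (reduce x k).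
Proof. by rewrite /repr /reduce -mulmxN floorV_shift subrr. Qed.

(** Equal reductions mean that the points differ by an element of A Z^d, and two representatives
    attached to the same [y] in the same coset coincide. *)
Lemma reduce_inj x y : {in repr y &, injective (reduce x)}.
Proof.
move=> k l; rewrite -!topredE/= => /eqP yk /eqP yl.
move=> /eqP; rewrite /reduce subr_eq addrAC -addrA -mulmxN -mulmxDr => /eqP e.
move: yk; rewrite e floorV_shift yl add0r => ->.
by rewrite mulmx0 addr0.
Qed.

Lemma floorV0_cube (x : Rd) : floorV x = 0 -> cube d 1 x.
Proof.
move=> x0; apply/cubeE => i; have /andP[h1 h2] := floorV_frac x i.
by move: h1 h2; rewrite x0 Zd_R0 subr0 => h1 h2; rewrite ger0_norm.
Qed.

Let K : R := (\sum_i \sum_j `|(mx_R A : 'M[R]_d) i j|) * 1.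

Lemma repr_cube x k : repr x k -> cube d K (x + Zd_R k).
Proof.
move=> /eqP/floorV0_cube/(mulmx_cube (mx_R A) ler01).
by rewrite mulKVmx.
Qed.

Lemma coset_reps : exists s : seq Zd, uniq s /\ s =i repr 0.
Proof.
have [s [us hs]] := @int_cube_finite R d K.
exists [seq k <- s | repr 0 k]; split; first exact: filter_uniq.
move=> k; rewrite mem_filter -[RHS]topredE/=; case: (boolP (repr 0 k)) => //= rk.
by apply: hs; have := repr_cube rk; rewrite add0r.
Qed.

(** Reduction injects the representatives attached to [y] into those attached to [x]; used in both
    directions it shows that their number does not depend on the base point. *)
Lemma reps_size_le (s t : seq Zd) x y : uniq s -> {subset s <= repr y} ->
  {subset repr x <= t} -> (size s <= size t)%N.
Proof.
move=> us sy xt; rewrite -(size_map (reduce x)); apply: uniq_leq_size.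
  by rewrite map_inj_in_uniq// => k l ks ls; apply: (@reduce_inj x y); exact: sy.
by move=> _ /mapP[k _ ->]; apply: xt; exact: repr_reduce.
Qed.

(** Translation by [l] acts injectively on cosets, hence permutes them since they are finitely
    many. *)
Lemma reps_perm (s : seq Zd) l : uniq s -> s =i repr 0 ->
  perm_eq [seq reduce 0 (k + l) | k <- s] s.
Proof.
move=> us hs.
have ur : uniq [seq reduce 0 (k + l) | k <- s].
  rewrite map_inj_in_uniq// => k k' ks ks' e.
  have sl m : m \in s -> m + l \in repr (- Zd_R l).
    rewrite hs -!topredE/= /repr Zd_RD add0r.
    by rewrite [- _ + _]addrC addrK.
  by apply: (@addIr _ l); apply: (@reduce_inj 0 (- Zd_R l)) e; exact: sl.
apply: uniq_perm => //.
apply: (uniq_min_size ur _ _).2; last by rewrite size_map.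
by move=> _ /mapP[k _ ->]; rewrite hs; exact: repr_reduce.
Qed.

(* The volume of A [0,1)^d is computed by cutting it along the cells k + [0,1)^d
   and translating the pieces back to [0,1)^d, where they overlap [size s] times. *)
Lemma reps_size (s : seq Zd) : uniq s -> s =i repr 0 ->
  (size s)%:R = `|\det (mx_R A : 'M[R]_d)|.
Proof.
move=> us hs; pose h (x : Rd) : R := \1_(cell 0) (iA *m x).
have iA0 : \det iA != 0 by rewrite det_inv invr_eq0.
have mh : measurable_fun setT h.
  by apply: measurableT_comp (measurable_mulmx iA); apply: measurable_indic; exact: measurable_cell.
have hE x k : h (x + Zd_R k) = (repr x k)%:R by rewrite /h indic_cell.
have mI k : measurable_fun [set: Rd] (fun x => \1_(cell k) x : R).
  by apply: measurable_indic; exact: measurable_cell.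
have i1 : (\int[mu]_x (\1_(cell 0) x)%:E = 1%:E)%E.
  by rewrite -(lebesgue_cV_cell (0 : Zd)); apply: integral_indicT; exact: measurable_cell.
have [t [ut ht]] := @int_cube_finite R d (K + 1).
have int1 : (\int[mu]_x (h x)%:E = `|\det (mx_R A : 'M[R]_d)|%:E)%E.
  have m1 : measurable_fun [set: Rd] (fun x => (\1_(cell 0) x)%:E : \bar R) by exact/measurable_EFinP.
  have p1 (x : Rd) : (0 <= (\1_(cell 0) x : R)%:E)%E by rewrite lee_fin.
  have := ge0_integral_linear 0 iA0 m1 p1.
  by under eq_integral do rewrite addr0; rewrite i1 mule1 det_inv normfV invrK.
have hs2 (x : Rd) : h x = \sum_(k <- t) \1_(cell k) x * h x.
  have [h0|] := eqVneq (h x) 0.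
    by rewrite h0; under eq_bigr do rewrite mulr0; rewrite big1.
  rewrite -{1}(addr0 x) -Zd_R0 hE pnatr_eq0 eqb0 negbK => /repr_cube.
  rewrite Zd_R0 addr0 => xK.
  rewrite -mulr_suml (bigD1_seq (floorV x))//=; last first.
    apply: ht; have -> : Zd_R (floorV x) = x + - (x - Zd_R (floorV x)) by rewrite opprB addrC subrK.
    apply: cubeD => //; apply: cubeN; apply/cubeE => i.
    by have /andP[h1 h2] := floorV_frac x i; rewrite ger0_norm.
  rewrite indic_cell eqxx big1 ?addr0 ?mul1r// => k.
  by rewrite indic_cell eq_sym => /negbTE ->.
have tr k : (\int[mu]_x (\1_(cell k) x * h x)%:E =
    \int[mu]_x (\1_(cell 0) x * h (x + Zd_R k))%:E)%E.
  have m1 : measurable_fun [set: Rd] (fun x => (\1_(cell k) x * h x)%:E).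
    by apply/measurable_EFinP; apply: measurable_funM.
  have p1 (x : Rd) : (0 <= (\1_(cell k) x * h x)%:E)%E by rewrite lee_fin mulr_ge0.
  have := ge0_integral_linear (Zd_R k) det1_neq0 m1 p1.
  rewrite det1 normr1 invr1 mul1e => <-; apply: eq_integral => x _.
  have e : (floorV x + k == k) = (floorV x == 0) by rewrite -{2}(add0r k) (inj_eq (addIr k)).
  by rewrite mul1mx !indic_cell floorV_addZ e.
suff int2 : (\int[mu]_x (h x)%:E = (size s)%:R%:E)%E.
  by apply: EFin_inj; rewrite -int1 -int2.
under eq_integral do rewrite hs2 -sumEFin.
rewrite ge0_integral_sum//; last 2 first.
- by move=> k; apply/measurable_EFinP; apply: measurable_funM.
- by move=> k x _; rewrite lee_fin mulr_ge0.
under eq_bigr do rewrite tr.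
rewrite -ge0_integral_sum//; last 2 first.
- move=> k; apply/measurable_EFinP; apply: measurable_funM => //.
  exact: measurableT_comp mh (measurable_translation _).
- by move=> k x _; rewrite lee_fin mulr_ge0.
transitivity (\int[mu]_x ((size s)%:R%:E * (\1_(cell (0 : Zd)) x)%:E))%E; last first.
  rewrite ge0_integralZl ?lee_fin//; last exact/measurable_EFinP.
  by rewrite i1 mule1.
apply: eq_integral => x _; rewrite sumEFin -EFinM -mulr_sumr mulrC; congr (_%:E).
rewrite indic_cell; case: eqP => [x0|_]; last by rewrite !mulr0.
rewrite !mulr1; under eq_bigr do rewrite hE.
rewrite -natr_sum -big_mkcond /= sum1_count -size_filter; congr (_%:R).
have ut' : uniq [seq k <- t | repr x k] by exact: filter_uniq.
apply/eqP; rewrite eqn_leq; apply/andP; split.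
  apply: (@reps_size_le _ _ 0 x) => // k.
    by rewrite mem_filter => /andP[].
  by rewrite hs.
apply: (@reps_size_le _ _ x 0) => //; first by move=> k; rewrite hs.
move=> k; rewrite -[k \in repr x]topredE/= => rk.
rewrite mem_filter rk /=; apply: ht.
have -> : Zd_R k = (x + Zd_R k) + - x by rewrite addrAC subrr add0r.
apply: cubeD; first exact: repr_cube.
by apply: cubeN; exact: floorV0_cube.
Qed.

End cosets.

(** * Orthogonality and independence of characters *)

Section characters.
Context {R : realType} {n : nat}.
Local Notation d := n.+1.
Local Notation Rd := 'cV[R]_d.
Local Notation Zd := 'cV[int]_d.

Lemma expi_int (z : int) : expi (2 * pi * z%:~R) = 1 :> R[i].
Proof.
have e1 : expi (2 * pi) = 1 :> R[i].
  by apply: cext; rewrite /= mulr_natl ?cos2pi ?sin2pi.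
have en (m : nat) : expi (2 * pi * m%:R) = 1 :> R[i].
  elim: m => [|m IH]; first by rewrite mulr0 expi0.
  have -> : m.+1%:R = m%:R + 1 :> R by rewrite -natr1.
  by rewrite mulrDr mulr1 expiD IH e1 mulr1.
case: z => m; first exact: en.
by rewrite NegzE mulrNz mulrN expiN en rmorph1.
Qed.

(** For the fractional part s one has cos(2 pi s) = 1 - 2 sin(pi s)^2, and sin(pi s) is positive for
    0 < s < 1. *)
Lemma expi_eq1 (t : R) : expi (2 * pi * t) = 1 :> R[i] -> t = (Num.floor t)%:~R.
Proof.
move=> h; have /andP[h1 h2] := floor_itv t.
pose s := t - (Num.floor t)%:~R.
have es : expi (2 * pi * s) = 1 :> R[i].
  by rewrite mulrBr expiD expiN h expi_int rmorph1 mulr1.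
have s0 : 0 <= s by rewrite subr_ge0.
have s1 : s < 1 by rewrite ltrBlDl -[_ + 1]intrD1.
apply/eqP; rewrite -subr_eq0 -/s; apply/eqP/le_anti; rewrite s0 andbT leNgt.
apply/negP => sp.
have sg : 0 < sin (pi * s).
  by apply: sin_gt0_pi; rewrite mulr_gt0 ?pi_gt0//= gtr_pMr ?pi_gt0.
move: es => [+ _]; rewrite (_ : 2 * pi * s = pi * s + pi * s); last by ring.
rewrite cosD; have := cos2Dsin2 (pi * s); rewrite !expr2.
have := mulr_gt0 sg sg; lra.
Qed.

Lemma dotR_int (z k : Zd) : exists m : int, dotR (Zd_R z) (Zd_R k) = m%:~R :> R.
Proof.
exists (\sum_i z i ord0 * k i ord0); rewrite rmorph_sum /dotR.
by apply: eq_bigr => i _; rewrite !mxE -rmorphM.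
Qed.

Lemma dotR_delta (x : Rd) i : dotR x (Zd_R (delta_mx i ord0 : Zd)) = x i ord0.
Proof.
rewrite /dotR (bigD1 i)//= !mxE !eqxx/= mulr1 big1 ?addr0// => j ji.
by rewrite !mxE (negbTE ji)/= mulr0.
Qed.

(** Membership in M Z^d as a boolean, so that it can serve as a 0-1 coefficient in finite sums. *)
Definition inlat (M : 'M[int]_d) (k : Zd) : bool :=
  k == M *m floorV (invmx (mx_R M) *m Zd_R k : Rd).

Lemma inlatP (M : 'M[int]_d) (k : Zd) : \det (mx_R M : 'M[R]_d) != 0 ->
  reflect (exists z, k = M *m z) (inlat M k).
Proof.
move=> M0; apply: (iffP eqP) => [->|[z ->]]; first by eexists.
by rewrite Zd_RM mulKmx ?unitmxE ?unitfE// floorV_Z.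
Qed.

Section character_sum.
Variable M : 'M[int]_d.
Hypothesis M0 : \det (mx_R M : 'M[R]_d) != 0.
Local Notation iM := (invmx ((mx_R M)^T) : 'M[R]_d).

Let trE : mx_R M^T = (mx_R M)^T :> 'M[R]_d.
Proof. by rewrite /mx_R map_trmx. Qed.

Let T0 : \det (mx_R M^T : 'M[R]_d) != 0.
Proof. by rewrite trE det_tr. Qed.

(** For [k] in M Z^d every term is 1 and the number of terms is |det M| by [reps_size]. Otherwise
    some character value chi(m) differs from 1, and permuting the representatives by m gives S =
    chi(m) S. *)
Lemma character_sum (s : seq Zd) (k : Zd) : uniq s -> s =i repr M^T (0 : Rd) ->
  \sum_(l <- s) expi (2 * pi * dotR (Zd_R k) (iM *m Zd_R l)) =
  (if inlat M k then `|\det (mx_R M : 'M[R]_d)| else 0)%:C.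
Proof.
move=> us hs; have Mu : (mx_R M : 'M[R]_d) \in unitmx by rewrite unitmxE unitfE.
case: (inlatP k M0) => [[z ->]|kM].
  have E l : expi (2 * pi * dotR (Zd_R (M *m z) : Rd) (iM *m Zd_R l)) = 1.
    rewrite Zd_RM dotR_tr mulKVmx ?unitmx_tr//.
    by have [m ->] := dotR_int z l; exact: expi_int.
  under eq_bigr do rewrite E.
  have := reps_size T0 us hs; rewrite trE det_tr => <-.
  by rewrite big_const_seq count_predT iter_addr_0 -[RHS]/(real_complex R _) rmorph_nat.
pose chi l := expi (2 * pi * dotR (Zd_R k : Rd) (iM *m Zd_R l)).
have chiD l m : chi (l + m) = chi l * chi m.
  by rewrite /chi Zd_RD mulmxDr dotRDr mulrDr expiD.
have chiR l : chi (reduce M^T (0 : Rd) l) = chi l.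
  rewrite /reduce chiD -mulmxN [X in _ * X](_ : _ = 1) ?mulr1//.
  rewrite /chi Zd_RM trE mulKmx ?unitmx_tr//.
  by have [m ->] := dotR_int k (- floorV (invmx (mx_R M)^T *m (0 + Zd_R l : Rd))); exact: expi_int.
have shift m : (\sum_(l <- s) chi l) = chi m * \sum_(l <- s) chi l.
  rewrite -{1}(perm_big _ (reps_perm T0 m us hs))/= big_map mulr_sumr.
  by apply: eq_bigr => l _; rewrite chiR chiD mulrC.
have [m cm] : exists m, chi m != 1.
  apply: contrapT => h; apply: kM; exists (floorV (invmx (mx_R M) *m Zd_R k : Rd)).
  apply: (@Zd_R_inj R); rewrite Zd_RM.
  suff -> : Zd_R (floorV (invmx (mx_R M) *m Zd_R k : Rd)) = invmx (mx_R M) *m Zd_R k :> Rd.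
    by rewrite mulKVmx.
  apply/colP => i; rewrite [LHS]mxE [X in X%:~R = _]mxE; apply/esym/expi_eq1.
  rewrite -(dotR_delta (invmx (mx_R M) *m Zd_R k)) dotR_tr trmx_inv.
  apply/eqP; apply: contraT => hh; exfalso; apply: h.
  by exists (delta_mx i ord0).
apply/eqP; have /eqP := shift m; rewrite -subr_eq0 -{1}(mul1r (\sum_(l <- s) chi l)) -mulrBl mulf_eq0.
by rewrite subr_eq0 eq_sym (negbTE cm) /= rmorph0.
Qed.

End character_sum.

(** Evaluating at xi + x and subtracting the value at xi times the character of [q] eliminates the
    term of [q]; the induction hypothesis handles the remaining sum. *)
Lemma characters_free (s : seq Zd) (c : Zd -> R[i]) : uniq s ->
  (forall xi : Rd, \sum_(p <- s) c p * expi (- dotR (Zd_R p) xi) = 0) ->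
  forall p, p \in s -> c p = 0.
Proof.
elim: s c => [//|q s IH] c /= /andP[qs us] h.
have cs p : p \in s -> c p = 0.
  move=> ps; have pq : p - q != 0 by rewrite subr_eq0; apply: contraNneq qs => <-.
  have [i pqi] : exists i, (p - q) i ord0 != 0.
    apply: contrapT => hh; move/eqP: pq; apply; apply/colP => i; rewrite [RHS]mxE.
    by apply/eqP; apply: contraT => hi; exfalso; apply: hh; exists i.
  (* The shift is chosen so that the character of p - q takes the value -1, which makes the
     multiplier of [c p] equal to -2 times a unimodular number. *)
  pose x : Rd := (pi / ((p - q) i ord0)%:~R) *: Zd_R (delta_mx i ord0 : Zd).
  have nR : ((p - q) i ord0)%:~R != 0 :> R by rewrite intr_eq0.
  have px : dotR (Zd_R p) x = dotR (Zd_R q) x + pi.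
    have <- : dotR (Zd_R (p - q)) x = pi.
      by rewrite dotRZr dotR_delta [Zd_R (p - q) i ord0]mxE divfK.
    by rewrite -dotRDl -Zd_RD addrC subrK.
  pose e r := expi (- dotR (Zd_R r) x).
  have := IH (fun p => c p * (e p - e q)) us _ p ps.
  have ep : e p = - e q.
    rewrite /e px opprD expiD; have -> : expi (- pi) = -1 :> R[i].
      by apply: cext; rewrite /= ?cosN ?sinN ?cospi ?sinpi ?oppr0.
    by rewrite mulrN1.
  rewrite ep => H; have {}H : c p * (- e q - e q) = 0.
    apply: H => xi.
    have h1 := h (xi + x); have h2 := h xi; move: h1 h2; rewrite !big_cons.
    move=> /eqP; rewrite addr_eq0 => /eqP h1 /eqP; rewrite addr_eq0 => /eqP h2.
    under eq_bigr => r _ do rewrite mulrAC mulrBr.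
    rewrite sumrB -mulr_suml.
    have -> : \sum_(r <- s) c r * expi (- dotR (Zd_R r) xi) * e r =
       \sum_(r <- s) c r * expi (- dotR (Zd_R r) (xi + x)).
      by apply: eq_bigr => r _; rewrite -mulrA /e -expiD dotRDr opprD.
    have -> : \sum_(r <- s) c r * expi (- dotR (Zd_R r) (xi + x)) = - (c q * expi (- dotR (Zd_R q) (xi + x))).
      by rewrite h1 opprK.
    have -> : \sum_(r <- s) c r * expi (- dotR (Zd_R r) xi) = - (c q * expi (- dotR (Zd_R q) xi)).
      by rewrite h2 opprK.
    by rewrite dotRDr opprD expiD /e; ring.
  have eq0 : e q != 0.
    apply/eqP => e0; have := normc_expi (- dotR (Zd_R q) x); rewrite -/(e q) e0 normc0.
    by move/eqP; rewrite eq_sym oner_eq0.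
  apply/eqP; move/eqP: H; rewrite mulf_eq0 -opprD oppr_eq0 -mulr2n mulrn_eq0 (negbTE eq0).
  by rewrite !orbF.
move=> p; rewrite inE => /orP[/eqP ->|]; last exact: cs.
have := h 0; rewrite big_cons dotR0r oppr0 expi0 mulr1 big_seq big1 ?addr0// => r rs.
by rewrite cs// mul0r.
Qed.

End characters.

(** * Perfect reconstruction as an isometry of finitely supported sequences *)

Section filter_bank.
Context {R : realType} {n : nat}.
Local Notation d := n.+1.
Local Notation Rd := 'cV[R]_d.
Local Notation Zd := 'cV[int]_d.

Lemma sum_delta (T : eqType) (s : seq T) (m : T) (F : T -> R[i]) : uniq s -> m \in s ->
  \sum_(k <- s) (m == k)%:R * F k = F m.
Proof.
move=> us ms; rewrite (bigD1_seq m)//= eqxx mul1r big1 ?addr0// => k.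
by rewrite eq_sym => /negbTE ->; rewrite mul0r.
Qed.

Lemma floorV_eq0 (x : Rd) : floorV x = 0 <-> forall i, 0 <= x i ord0 < 1.
Proof.
split=> [x0 i|h].
  have : cell 0 x by [].
  by move/cellE => /(_ i); rewrite in_itv/= !mxE add0r.
suff : cell 0 x by [].
by apply/cellE => i; rewrite in_itv/= !mxE add0r.
Qed.

Variables (I : eqType) (s : seq I) (M : I -> 'M[int]_d) (a : I -> zmask R d).
Local Notation D i := (`|\det (mx_R (M i) : 'M[R]_d)|).
Hypothesis s_ex : exists i, i \in s.
Hypothesis M0 : forall i, i \in s -> \det (mx_R (M i) : 'M[R]_d) != 0.
Hypothesis PR : forall omega xi : Rd, (exists2 i, i \in s & Omega (M i) omega) ->
  \sum_(i <- s | `[< Omega (M i) omega >])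
    mask_hat (a i) xi * (mask_hat (a i) (xi + (2 * pi) *: omega))^* = (omega == 0)%:R.

(** With w(q) = exp(2 pi i q.omega) this is the coefficient of exp(-i k.xi) in the product of masks
    occurring in [PR]. *)
Let pairsum i (w : Zd -> R[i]) (k : Zd) : R[i] :=
  \sum_(p <- finsupp (a i)) \sum_(q <- finsupp (a i))
    (p - q == k)%:R * (a i p * (a i q)^* * w q).

(** Both sides of [PR] are trigonometric polynomials in xi, so their coefficients agree by
    [characters_free]; the list [T] collects 0 and all differences of mask indices. *)
Lemma PR_frequency (omega : Rd) (k : Zd) : (exists2 i, i \in s & Omega (M i) omega) ->
  \sum_(i <- s | `[< Omega (M i) omega >])
    pairsum i (fun q => expi (2 * pi * dotR (Zd_R q) omega)) k =
  (omega == 0)%:R * (0 == k)%:R.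
Proof.
move=> hom.
pose T := undup (0 :: flatten [seq [seq p - q | p <- finsupp (a i), q <- finsupp (a i)] | i <- s]).
have uT : uniq T by exact: undup_uniq.
have T0 : 0 \in T by rewrite mem_undup inE eqxx.
have Ti i p q : i \in s -> p \in finsupp (a i) -> q \in finsupp (a i) -> p - q \in T.
  move=> is_ pa qa; rewrite mem_undup inE; apply/orP; right; apply/flattenP.
  by eexists; [apply: map_f; exact: is_|apply: allpairs_f].
clearbody T; have [kT|kT] := boolP (k \in T); last first.
  rewrite (_ : (0 == k) = false) ?mulr0; last by apply/negbTE; apply: contraNneq kT => <-.
  rewrite big_seq_cond big1// => i /andP[is_ _].
  rewrite /pairsum big_seq big1// => p pa; rewrite big_seq big1// => q qa.
  rewrite (_ : (p - q == k) = false) ?mul0r//.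
  by apply/negbTE; apply: contraNneq kT => <-; exact: Ti pa qa.
pose c k := \sum_(i <- s | `[< Omega (M i) omega >])
    pairsum i (fun q => expi (2 * pi * dotR (Zd_R q) omega)) k -
  (omega == 0)%:R * (0 == k)%:R.
suff : c k = 0 by move/eqP; rewrite subr_eq0 => /eqP.
apply: (characters_free uT _ kT) => xi.
have E1 i : i \in s -> \sum_(k <- T) pairsum i (fun q => expi (2 * pi * dotR (Zd_R q) omega)) k *
    expi (- dotR (Zd_R k) xi) =
    mask_hat (a i) xi * (mask_hat (a i) (xi + (2 * pi) *: omega))^*.
  move=> is_; under eq_bigr do rewrite mulr_suml.
  rewrite exchange_big /mask_hat conjc_sum mulr_suml big_seq [RHS]big_seq.
  apply: eq_bigr => p pa; under eq_bigr do rewrite mulr_suml.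
  rewrite exchange_big mulr_sumr big_seq [RHS]big_seq; apply: eq_bigr => q qa.
  under eq_bigr do rewrite -mulrA.
  rewrite (sum_delta (fun k => a i p * (a i q)^* * expi (2 * pi * dotR (Zd_R q) omega) * expi (- dotR (Zd_R k) xi)))//; last exact: Ti pa qa.
  rewrite conjcM -expiN opprK dotRDr dotRZr expiD Zd_RD Zd_RN dotRDl dotRNl opprD opprK expiD.
  by rewrite !mulrA; ring.
rewrite /c; under eq_bigr do rewrite mulrBl mulr_suml.
rewrite sumrB exchange_big/= big_seq_cond.
under eq_bigr => i /andP[is_ _] do rewrite E1//.
rewrite -big_seq_cond PR//.
under eq_bigr do rewrite -mulrA mulrCA.
by rewrite sum_delta// Zd_R0 dotRC dotR0r oppr0 expi0 mulr1 subrr.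
Qed.

(* Multiplying by the character of [- m] and summing over all frequencies turns
   the frequency condition into a coset condition on [q]. *)
Lemma PR_coset_sum (k m : Zd) :
  \sum_(i <- s) (D i)%:C * \sum_(p <- finsupp (a i)) \sum_(q <- finsupp (a i))
    ((p - q == k) && inlat (R := R) (M i) (q - m))%:R * (a i p * (a i q)^*) = (0 == k)%:R.
Proof.
have [om homs] : {om : I -> seq Zd & forall i, i \in s ->
    uniq (om i) /\ om i =i repr (M i)^T (0 : Rd)}.
  apply: (@choice _ _ (fun i o => i \in s -> uniq o /\ o =i repr (M i)^T (0 : Rd))) => i.
  have [is_|is_] := boolP (i \in s); last by exists [::].
  have T0 : \det (mx_R (M i)^T : 'M[R]_d) != 0.
    by rewrite (_ : mx_R (M i)^T = (mx_R (M i))^T) ?det_tr ?M0// /mx_R map_trmx.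
  by have [t ht] := coset_reps T0; exists t.
pose iM i : 'M[R]_d := invmx ((mx_R (M i))^T).
have Mu i : i \in s -> (mx_R (M i) : 'M[R]_d) \in unitmx.
  by move=> is_; rewrite unitmxE unitfE M0.
pose fr i := [seq iM i *m Zd_R k | k <- om i].
(* The condition that w lies in [0,1)^d says [floorV w = 0], so the frequencies of a node are the
   images under M^-T of the representatives modulo its transpose. *)
have frE i (w : Rd) : i \in s -> Omega (M i) w <-> w \in fr i.
  move=> is_; have [uo ho] := homs i is_.
  have rE l : (l \in om i) = (floorV (iM i *m Zd_R l) == 0).
    have trE : mx_R (M i)^T = (mx_R (M i))^T :> 'M[R]_d by rewrite /mx_R map_trmx.
    by rewrite ho -[LHS]topredE/= /repr add0r /iM trE.
  split=> [[[l ->] h]|/mapP[l lo ->]].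
    by apply: map_f; rewrite rE; apply/eqP; apply/floorV_eq0.
  by split; [exists l|apply/floorV_eq0/eqP; rewrite -rE].
have ufr i : i \in s -> uniq (fr i).
  move=> is_; have [uo _] := homs i is_; rewrite map_inj_uniq// => x y /(congr1 (mulmx ((mx_R (M i))^T))).
  by rewrite !mulKVmx ?unitmx_tr ?Mu// => /Zd_R_inj.
(* The union of all frequency sets; 0 belongs to it because the list of nodes is not empty, and it
   is the only frequency that contributes to the right-hand side. *)
pose W := undup (flatten [seq fr i | i <- s]).
have WE w : w \in W -> exists2 i, i \in s & Omega (M i) w.
  rewrite mem_undup => /flattenP[_ /mapP[i is_ ->] wi]; exists i => //.
  exact/frE.
have W0 : 0 \in W.
  have [i is_] := s_ex; rewrite mem_undup; apply/flattenP; exists (fr i); first exact: map_f.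
  by apply/frE => //; exact: Omega0.
pose e (q : Zd) (w : Rd) : R[i] := expi (2 * pi * dotR (Zd_R q) w).
transitivity (\sum_(w <- W) e (- m) w * ((w == 0)%:R * (0 == k)%:R)); last first.
  rewrite (bigD1_seq 0)/= ?undup_uniq// big1 ?addr0; last first.
    by move=> w /negbTE ->; rewrite mul0r mulr0.
  by rewrite eqxx mul1r /e dotR0r mulr0 expi0 mul1r.
transitivity (\sum_(w <- W) e (- m) w * \sum_(i <- s | `[< Omega (M i) w >]) pairsum i (e ^~ w) k);
    last first.
  rewrite big_seq [RHS]big_seq; apply: eq_bigr => w wW.
  by rewrite PR_frequency//; exact: WE.
under [RHS]eq_bigr do rewrite mulr_sumr big_mkcond.
rewrite exchange_big/= big_seq [RHS]big_seq; apply: eq_bigr => i is_.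
rewrite -[RHS]big_mkcond -[RHS]big_filter [RHS](perm_big (fr i)); last first.
  apply: uniq_perm; [exact/filter_uniq/undup_uniq|exact: ufr|move=> w].
  rewrite mem_filter; apply/andP/idP => [[/asboolP/frE h _]|wi]; first exact: h.
  split; first by apply/asboolP/frE.
  by rewrite mem_undup; apply/flattenP; exists (fr i) => //; exact: map_f.
rewrite big_map; under [RHS]eq_bigr do rewrite mulr_sumr.
rewrite [RHS]exchange_big [LHS]mulr_sumr; apply: eq_bigr => p _.
under [RHS]eq_bigr do rewrite mulr_sumr.
rewrite [RHS]exchange_big [LHS]mulr_sumr; apply: eq_bigr => q _.
under [RHS]eq_bigr => l _.
  rewrite (_ : _ * _ = ((p - q == k)%:R * (a i p * (a i q)^*)) * e (q - m) (iM i *m Zd_R l)).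
    over.
  by rewrite /e Zd_RD dotRDl [_ * (dotR _ _ + _)]mulrDr expiD; ring.
have [uo ho] := homs i is_.
rewrite -mulr_sumr (character_sum (M0 is_) _ uo ho).
by case: (p - q == k); case: inlat; rewrite /= ?mul1r ?mul0r ?mulr0// mulrC.
Qed.

(** Expanding the squares gives a form in v(x) conj(v(y)) whose coefficient is the sum of
    [PR_coset_sum] at y - x, hence 1 for x = y and 0 otherwise. Finite support makes all sums
    finite. *)
Lemma filter_bank_isometry (v : Zd -> R[i]) (t : seq Zd) : uniq t ->
  (forall k, k \notin t -> v k = 0) ->
  (\sum_(i <- s) \esum_(k in [set: Zd])
     (D i * normc (\sum_(p <- finsupp (a i)) (a i p)^* * v (M i *m k + p)) ^+ 2)%:E =
   \esum_(k in [set: Zd]) (normc (v k) ^+ 2)%:E)%E.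
Proof.
move=> ut vt.
pose z i k := \sum_(p <- finsupp (a i)) (a i p)^* * v (M i *m k + p).
pose K i := undup [seq floorV (invmx (mx_R (M i)) *m Zd_R (x - p) : Rd) | x <- t, p <- finsupp (a i)].
have Kin i k x p : i \in s -> x \in t -> p \in finsupp (a i) -> M i *m k + p = x -> k \in K i.
  move=> is_ xt pa e; rewrite mem_undup; apply/allpairsP; exists (x, p); split => //=.
  by rewrite -e addrK Zd_RM mulKmx ?floorV_Z// unitmxE unitfE M0.
have zK i k : i \in s -> k \notin K i -> z i k = 0.
  move=> is_ kK; rewrite /z big_seq big1// => p pa; rewrite vt ?mulr0//.
  by apply: contra kK => h; exact: Kin h pa erefl.
(* The equation M k + p = x has at most one solution k, and has one exactly when p - x is in M Z^d;
   the second equation then reads q - p = y - x. *)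
have count i x y p q : i \in s -> x \in t -> p \in finsupp (a i) ->
    \sum_(k <- K i) ((M i *m k + p == x)%:R * (M i *m k + q == y)%:R) =
    ((q - p == y - x) && inlat (R := R) (M i) (p - x))%:R :> R[i].
  move=> is_ xt pa; case: (inlatP (p - x) (M0 is_)) => [[w pw]|h]; last first.
    rewrite andbF big1// => k _; case: eqP => [e|]; last by rewrite mul0r.
    by exfalso; apply: h; exists (- k); rewrite -e mulmxN opprD addrCA subrr addr0.
  have e0 : M i *m (- w) + p = x by rewrite mulmxN -pw opprB subrK.
  have eqk k : (M i *m k + p == x) = (- w == k).
    apply/eqP/eqP => [e|<-//]; apply: (@Zd_R_inj R).
    have : M i *m (- w) = M i *m k by apply: (@addIr _ p); rewrite e0 e.
    move/(congr1 (Zd_R : Zd -> Rd)); rewrite !Zd_RM => /(congr1 (mulmx (invmx (mx_R (M i))))).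
    by rewrite !mulKmx// unitmxE unitfE M0.
  under eq_bigr do rewrite eqk.
  rewrite (sum_delta (fun k => (M i *m k + q == y)%:R)) ?undup_uniq//; last exact: Kin e0.
  rewrite andbT; congr (_%:R); congr nat_of_bool.
  by rewrite mulmxN -pw opprB -addrA addrC -(inj_eq (addIr (- x))) addrK [- p + q]addrC.
have vE k : v k = \sum_(x <- t) (k == x)%:R * v x.
  have [kt|kt] := boolP (k \in t); first by rewrite sum_delta.
  rewrite vt// big_seq big1// => x xt; case: eqP => [e|]; last by rewrite mul0r.
  by rewrite e xt in kt.
have main : \sum_(i <- s) (D i)%:C * \sum_(k <- K i) (z i k * (z i k)^*) =
    \sum_(x <- t) v x * (v x)^*.
  have E i : i \in s -> \sum_(k <- K i) (z i k * (z i k)^*) =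
      \sum_(x <- t) \sum_(y <- t) v x * (v y)^* *
       \sum_(p <- finsupp (a i)) \sum_(q <- finsupp (a i))
         ((p - q == y - x) && inlat (R := R) (M i) (q - x))%:R * (a i p * (a i q)^*).
    move=> is_.
    transitivity (\sum_(k <- K i) \sum_(x <- t) \sum_(y <- t)
       \sum_(p <- finsupp (a i)) \sum_(q <- finsupp (a i))
         v x * (v y)^* * (a i p * (a i q)^*) *
          ((M i *m k + q == x)%:R * (M i *m k + p == y)%:R)).
      apply: eq_bigr => k _.
      have zE : z i k = \sum_(x <- t) v x * \sum_(q <- finsupp (a i)) (M i *m k + q == x)%:R * (a i q)^*.
        rewrite /z; under eq_bigr do rewrite (vE (_ + _)) mulr_sumr.
        rewrite exchange_big; apply: eq_bigr => x _; rewrite mulr_sumr.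
        by apply: eq_bigr => q _; ring.
      rewrite zE conjc_sum mulr_suml; apply: eq_bigr => x _.
      rewrite mulr_sumr; apply: eq_bigr => y _.
      rewrite conjcM conjc_sum mulrACA mulr_suml exchange_big mulr_sumr.
      rewrite [LHS](_ : _ = \sum_(q <- finsupp (a i)) v x * (v y)^* *
         ((M i *m k + q == x)%:R * (a i q)^* * \sum_(p <- finsupp (a i)) ((M i *m k + p == y)%:R * (a i p)^*)^*)) //.
      apply: eq_bigr => q _; rewrite !mulr_sumr.
      apply: eq_bigr => p _; rewrite conjcM conjc_conjc rmorph_nat.
      ring.
    rewrite exchange_big big_seq [RHS]big_seq; apply: eq_bigr => x xt.
    rewrite exchange_big; apply: eq_bigr => y _.
    rewrite exchange_big mulr_sumr; apply: eq_bigr => p _.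
    rewrite exchange_big mulr_sumr big_seq [RHS]big_seq; apply: eq_bigr => q qa.
    by rewrite -mulr_sumr count// -mulrA; congr (_ * _); rewrite mulrC.
  rewrite big_seq; under eq_bigr => i is_ do rewrite E// mulr_sumr.
  rewrite -big_seq exchange_big big_seq [RHS]big_seq; apply: eq_bigr => x xt.
  under eq_bigr do rewrite mulr_sumr.
  rewrite exchange_big.
  under eq_bigr do under eq_bigr do rewrite mulrCA.
  under eq_bigr do rewrite -mulr_sumr PR_coset_sum eq_sym subr_eq0 eq_sym mulrC.
  by rewrite (sum_delta (fun y => v x * (v y)^*)).
have mainR : \sum_(i <- s) D i * \sum_(k <- K i) normc (z i k) ^+ 2 =
    \sum_(x <- t) normc (v x) ^+ 2.
  move: main => /(congr1 (@complex.Re R)); rewrite !Re_sum => h.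
  transitivity (\sum_(i <- s) complex.Re ((D i)%:C * \sum_(k <- K i) (z i k * (z i k)^*))).
    apply: eq_bigr => i _; rewrite ReM /= mul0r subr0 Re_sum; congr (_ * _).
    by apply: eq_bigr => k _; rewrite mulcJ.
  by rewrite h; apply: eq_bigr => x _; rewrite mulcJ.
rewrite (@esum_seq _ _ t)//; last 2 first.
- by move=> k; rewrite lee_fin sqr_ge0.
- by move=> k kt; rewrite vt// normc0 expr0n.
rewrite sumEFin -mainR -sumEFin big_seq [RHS]big_seq; apply: eq_bigr => i is_.
rewrite (@esum_seq _ _ (K i))//; last 3 first.
- exact: undup_uniq.
- by move=> k; rewrite lee_fin mulr_ge0 ?normr_ge0 ?sqr_ge0.
- by move=> k kK; rewrite -/(z i k) zK// normc0 expr0n mulr0.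
by rewrite sumEFin mulr_sumr.
Qed.

Local Notation mu := (lebesgue_cV R d).

(** By the two-scale relation the coefficients of a child are the filtered and decimated
    coefficients of [g], scaled by the square root of |det N|: the factor |det N| of the relation
    against |det N|^(-1/2) from the normalisation. *)
Lemma energy_split (f g : Rd -> R[i]) (psi : I -> Rd -> R[i]) (U : 'M[R]_d) :
  L2 mu f -> bsupp f -> L2 mu g -> csupp g -> \det U != 0 ->
  (forall i, i \in s -> L2 mu (psi i)) ->
  (forall i, i \in s -> {ae mu, forall x, psi i x = (D i)%:C *
     \sum_(k <- finsupp (a i)) a i k * g (mx_R (M i) *m x - Zd_R k)}) ->
  (energy f g U = \sum_(i <- s) energy f (psi i) (invmx (mx_R (M i)) *m U))%E.
Proof.
move=> Lf bf Lg sg U0 Lpsi psiE.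
have [t [ut ht]] := coef_finite U0 Lf bf Lg sg.
rewrite /energy -(filter_bank_isometry ut ht) big_seq [RHS]big_seq.
apply: eq_bigr => i is_; apply: eq_esum => k _; congr (_%:E).
have Di := M0 is_; set N := mx_R (M i) in Di *.
have Nu : N \in unitmx by rewrite unitmxE unitfE.
have V0 : \det (invmx N *m U) != 0 by rewrite det_mulmx det_inv mulf_neq0 ?invr_eq0.
have Lsum : L2 mu (fun x => \sum_(p <- finsupp (a i)) a i p * dilshift g U (M i *m k + p) x).
  by apply: L2_sum => p; apply: L2Z; exact: dilshift_L2.
have -> : coef f (psi i) (invmx N *m U) k =
    (Num.sqrt `|\det N|)%:C * \sum_(p <- finsupp (a i)) (a i p)^* * coef f g U (M i *m k + p).
  rewrite /coef (@inner_aer _ _ _ mu _ _ (fun x => (Num.sqrt `|\det N|)%:C *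
     \sum_(p <- finsupp (a i)) a i p * dilshift g U (M i *m k + p) x)).
  - rewrite innerZr// -[(_ %:C)^*]/(conjc _) conjc_real inner_sumr//; last first.
      by move=> p; apply: L2Z; exact: dilshift_L2.
    by congr (_ * _); apply: eq_bigr => p _; rewrite innerZr//; exact: dilshift_L2.
  - exact: Lf.1.
  - by have [] := dilshift_L2 k V0 (Lpsi _ is_).
  - by have [] := L2Z (Num.sqrt `|\det N|)%:C Lsum.
  have := ae_linear (- Zd_R k) V0 (psiE _ is_); apply: filterS => x h.
  rewrite /dilshift h !mulr_sumr; apply: eq_bigr => p _.
  rewrite mulmxDr -mulmxA mulKVmx// mulmxN -Zd_RM -/N -addrA -opprD -Zd_RD.
  rewrite det_mulmx det_inv normrM normfV.
  have -> : Num.sqrt (`|\det N|^-1 * `|\det U|) = Num.sqrt `|\det N|^-1 * Num.sqrt `|\det U|.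
    by rewrite sqrtrM// invr_ge0.
  have e : (Num.sqrt `|\det N|^-1)%:C * (`|\det N|)%:C = (Num.sqrt `|\det N|)%:C :> R[i].
    rewrite -real_complexM sqrtrV//; congr (_%:C).
    have p0 : Num.sqrt `|\det N| != 0 by rewrite sqrtr_eq0 -ltNge normr_gt0.
    by rewrite -{2}(sqr_sqrtr (normr_ge0 (\det N))) expr2 mulKf.
  by rewrite -e real_complexM; ring.
rewrite normcM exprMn normc_real real_normK ?num_real// sqr_sqrtr//.
Qed.

End filter_bank.

(** * From test functions to all of L2 *)

Section young.
Context {R : realType}.

Lemma young_sqr (s a b : R) : 0 < s ->
  (a + b) ^+ 2 <= (1 + s) * a ^+ 2 + (1 + s^-1) * b ^+ 2.
Proof.
move=> s0; rewrite -subr_ge0.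
have -> : (1 + s) * a ^+ 2 + (1 + s^-1) * b ^+ 2 - (a + b) ^+ 2 = s^-1 * (s * a - b) ^+ 2.
  by field; rewrite gt_eqF.
by rewrite mulr_ge0 ?sqr_ge0// invr_ge0 ltW.
Qed.

Lemma young_normc (s : R) (z w : R[i]) : 0 < s ->
  normc (z + w) ^+ 2 <= (1 + s) * normc z ^+ 2 + (1 + s^-1) * normc w ^+ 2.
Proof.
move=> s0; rewrite !normcE2 !ReImE.
have := young_sqr (complex.Re z) (complex.Re w) s0.
have := young_sqr (complex.Im z) (complex.Im w) s0; lra.
Qed.

Lemma young_N2 dsp (T : measurableType dsp) (m : {measure set T -> \bar R})
    (f g : T -> R[i]) (s : R) : 0 < s -> L2 m f -> L2 m g ->
  N2 m (fun x => f x + g x) <= (1 + s) * N2 m f + (1 + s^-1) * N2 m g.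
Proof.
move=> s0 Lf Lg; have t0 : 0 < s^-1 by rewrite invr_gt0.
rewrite -lee_fin EFinD !EFinM -!sqE//; last exact: L2D.
have mf := measurable_sq Lf.1; have mg := measurable_sq Lg.1.
have k1 : 0 <= 1 + s by apply: addr_ge0 => //; exact: ltW.
have k2 : 0 <= 1 + s^-1 by apply: addr_ge0 => //; exact: ltW.
have Z (c : R) (h : T -> R[i]) : 0 <= c -> L2 m h ->
    (c%:E * sq m h = \int[m]_x (c%:E * (normc (h x) ^+ 2)%:E))%E.
  move=> c0 Lh; rewrite /sq ge0_integralZl ?lee_fin//; first exact: measurable_sq Lh.1.
  by move=> x _; rewrite lee_fin sqr_ge0.
rewrite !Z//.
rewrite -ge0_integralD//; first last.
- by apply: emeasurable_funM.
- by move=> x _; rewrite -EFinM lee_fin mulr_ge0 ?sqr_ge0.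
- by apply: emeasurable_funM.
- by move=> x _; rewrite -EFinM lee_fin mulr_ge0 ?sqr_ge0.
apply: ge0_le_integral => //.
- by move=> x _; rewrite lee_fin sqr_ge0.
- by apply: measurable_sq; exact: (L2D Lf Lg).1.
- by apply: emeasurable_funD; apply: emeasurable_funM.
- by move=> x _; rewrite -!EFinM -EFinD lee_fin; exact: young_normc.
Qed.

(** The error [e] is sent to 0 first, for fixed [s], and then [s]. The coefficient 1 + 3s comes from
    applying Young's inequality twice, as (1 + s)^2 <= 1 + 3s for s <= 1. *)
Lemma le_eps (A B C : R) : 0 <= B -> 0 <= C ->
  (forall s e : R, 0 < s -> s <= 1 -> 0 < e -> A <= (1 + 3 * s) * B + (1 + s^-1) * C * e) ->
  A <= B.
Proof.
move=> B0 C0 h; rewrite leNgt; apply/negP => BA.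
pose p := A - B; have p0 : 0 < p by rewrite subr_gt0.
(* With p = A - B this makes 3 s B at most p/2, while the choice of [e] keeps the other error below
   p/3; together they stay below p. *)
pose s := Num.min 1 (p / (6 * (B + 1))).
have s0 : 0 < s by rewrite lt_min ltr01 divr_gt0// mulr_gt0//; lra.
have s1 : s <= 1 by rewrite ge_min lexx.
have sp : s * (6 * (B + 1)) <= p.
  rewrite -ler_pdivlMr; last by rewrite mulr_gt0//; lra.
  by rewrite ge_min lexx orbT.
have t0 : 0 < 1 + s^-1 by rewrite addr_gt0// invr_gt0.
pose k := (1 + s^-1) * C + 1.
have k0 : 0 < k by rewrite ltr_wpDl// mulr_ge0// ltW.
have e0 : 0 < p / (3 * k) by rewrite divr_gt0// mulr_gt0.
have := h s _ s0 s1 e0.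
have : (1 + s^-1) * C * (p / (3 * k)) <= p / 3.
  rewrite mulrA ler_pdivrMr; last by rewrite mulr_gt0.
  have -> : p / 3 * (3 * k) = p * k by field.
  by rewrite mulrC ler_wpM2l ?ltW// /k ltrDl.
move=> h1 h2.
have h3 : A <= (1 + 3 * s) * B + p / 3 by apply: le_trans h2 _; rewrite lerD2l.
have h4 : 0 <= s * B by rewrite mulr_ge0// ltW.
have E1 : s * (6 * (B + 1)) = 6 * (s * B) + 6 * s by ring.
have E2 : (1 + 3 * s) * B = B + 3 * (s * B) by ring.
have E3 : p = A - B by [].
by rewrite E1 in sp; rewrite E2 in h3; lra.
Qed.

End young.

Section density.
Context {R : realType} {n : nat}.
Local Notation d := n.+1.
Local Notation Rd := 'cV[R]_d.
Local Notation mu := (lebesgue_cV R d).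

(** Bessel's inequality is extended first, on finite subfamilies, where continuity is elementary. It
    then controls the coefficients of the difference between f and an approximating test function,
    which gives the converse inequality. *)
Lemma tight_dense (I : choiceType) (D : set I) (g : I -> Rd -> R[i]) :
  (forall i, D i -> L2 mu (g i)) ->
  (forall h, test_fun h -> sq mu h = (\esum_(i in D) (normc (inner mu h (g i)) ^+ 2)%:E)%E) ->
  forall f, L2 mu f -> sq mu f = (\esum_(i in D) (normc (inner mu f (g i)) ^+ 2)%:E)%E.
Proof.
move=> Lg0 tight f Lf.
pose P (F : {fset I}) h := \sum_(i <- F) normc (inner mu h (g i)) ^+ 2.
have esumE h (K : R) : (forall F : {fset I}, [set` F] `<=` D -> P F h <= K) ->
    (\esum_(i in D) (normc (inner mu h (g i)) ^+ 2)%:E <= K%:E)%E.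
  move=> hK; apply: ge_ereal_sup => _ [A [finA AD] <-].
  rewrite fsbig_finite// sumEFin lee_fin; apply: hK.
  by rewrite fset_setK.
have leP (F : {fset I}) h : [set` F] `<=` D ->
    ((P F h)%:E <= \esum_(i in D) (normc (inner mu h (g i)) ^+ 2)%:E)%E.
  move=> FD; apply: ereal_sup_ubound; exists [set` F]; first by split.
  by rewrite fsbig_finite// set_fsetK sumEFin.
have PY F k1 k2 s : [set` F] `<=` D -> 0 < s -> L2 mu k1 -> L2 mu k2 ->
    P F k1 <= (1 + s) * P F k2 + (1 + s^-1) * P F (fun x => k1 x - k2 x).
  move=> FD s0 L1 L2'; rewrite /P !mulr_sumr -!big_split ![\sum_(i <- F) _]big_seq.
  apply: ler_sum => i iF.
  rewrite innerBl//; last by apply: Lg0; exact: FD.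
  have := young_normc (inner mu k2 (g i)) (inner mu k1 (g i) - inner mu k2 (g i)) s0.
  by rewrite addrC subrK.
have PleT F h : [set` F] `<=` D -> test_fun h -> P F h <= N2 mu h.
  by move=> FD th; rewrite -lee_fin -sqE ?tight//; [exact: leP|exact: test_L2].
have NY k h s : 0 < s -> L2 mu k -> L2 mu h ->
    N2 mu k <= (1 + s) * N2 mu h + (1 + s^-1) * N2 mu (fun x => k x - h x).
  move=> s0 Lk Lh; apply: le_trans (young_N2 s0 Lh (L2B Lk Lh)).
  rewrite le_eqVlt; apply/orP; left; apply/eqP; congr (N2 mu _).
  by apply/funext => x; rewrite addrC subrK.
(* On a finite subfamily Cauchy-Schwarz bounds the energy by [G] times the squared norm; [G] depends
   on the subfamily, but disappears as the approximation error tends to 0. *)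
have up k : L2 mu k -> forall F : {fset I}, [set` F] `<=` D -> P F k <= N2 mu k.
  move=> Lk F FD; pose G := \sum_(i <- F) N2 mu (g i).
  have G0 : 0 <= G by apply: sumr_ge0 => i _; exact: N2_ge0.
  have PG h : L2 mu h -> P F h <= N2 mu h * G.
    move=> Lh; rewrite /P /G mulr_sumr ![\sum_(i <- F) _]big_seq; apply: ler_sum => i iF.
    by apply: CS => //; apply: Lg0; exact: FD.
  apply: (@le_eps _ _ _ (2 + G)); [exact: N2_ge0|by rewrite addr_ge0|].
  move=> s e s0 s1 e0; have [_ /(_ e e0)[h [th he]]] := L2_appr Lk.
  have Lh := test_L2 th.
  have a1 := PY F k h s FD s0 Lk Lh; have a2 := PleT F h FD th.
  have a3 := PG _ (L2B Lk Lh); have a4 := NY h k s s0 Lh Lk.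
  rewrite N2BC in a4.
  have t0 : 0 < s^-1 by rewrite invr_gt0.
  have Nk := N2_ge0 mu k.
  apply: le_trans a1 _.
  apply: (@le_trans _ _ ((1 + s) * ((1 + s) * N2 mu k + (1 + s^-1) * e) + (1 + s^-1) * (e * G))).
    apply: lerD; (apply: ler_wpM2l; first by rewrite addr_ge0// ltW).
      apply: le_trans a2 _; apply: le_trans a4 _; rewrite lerD2l.
      by apply: ler_wpM2l; [rewrite addr_ge0// ltW|exact: ltW].
    by apply: le_trans a3 _; apply: ler_wpM2r => //; exact: ltW.
  have b1 : (1 + s) * (1 + s) <= 1 + 3 * s by nra.
  have b2 : (1 + s) * ((1 + s^-1) * e) <= 2 * ((1 + s^-1) * e).
    by apply: ler_wpM2r; [apply: mulr_ge0; [rewrite addr_ge0// ltW|exact: ltW]|lra].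
  have b3 := ler_wpM2r Nk b1.
  have -> : (1 + s) * ((1 + s) * N2 mu k + (1 + s^-1) * e) + (1 + s^-1) * (e * G) =
    (1 + s) * (1 + s) * N2 mu k + (1 + s) * ((1 + s^-1) * e) + (1 + s^-1) * (e * G) by ring.
  have -> : (1 + 3 * s) * N2 mu k + (1 + s^-1) * (2 + G) * e =
    (1 + 3 * s) * N2 mu k + 2 * ((1 + s^-1) * e) + (1 + s^-1) * (e * G) by ring.
  lra.
set S := (X in _ = X).
have S0 : (0 <= S)%E by apply: esum_ge0 => i _; rewrite lee_fin sqr_ge0.
have SN : (S <= (N2 mu f)%:E)%E by apply: esumE; exact: up.
have Sf : S \is a fin_num by rewrite ge0_fin_numE// (le_lt_trans SN)// ltry.
apply/eqP; rewrite eq_le [in X in _ && X]sqE// SN andbT sqE// -(fineK Sf) lee_fin.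
apply: (@le_eps _ _ _ 3) => //; first exact: fine_ge0.
move=> s e s0 s1 e0; have [_ /(_ e e0)[h [th he]]] := L2_appr Lf.
have Lh := test_L2 th; have a1 := NY f h s s0 Lf Lh.
have t0 : 0 < s^-1 by rewrite invr_gt0.
(* Tightness for the test function [h], with the energy of h - f estimated by the Bessel bound
   [up]. *)
have a2 : N2 mu h <= (1 + s) * fine S + (1 + s^-1) * e.
  rewrite -lee_fin -sqE// tight//; apply: esumE => F FD.
  apply: le_trans (PY F h f s FD s0 Lh Lf) _; apply: lerD.
    apply: ler_wpM2l; first by rewrite addr_ge0// ltW.
    by rewrite -lee_fin fineK//; exact: leP.
  apply: ler_wpM2l; first by rewrite addr_ge0// ltW.
  apply: le_trans (up _ (L2B Lh Lf) F FD) _.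
  by rewrite N2BC ltW.
have S0' : 0 <= fine S by exact: fine_ge0.
apply: le_trans a1 _.
apply: (@le_trans _ _ ((1 + s) * ((1 + s) * fine S + (1 + s^-1) * e) + (1 + s^-1) * e)).
  apply: lerD; (apply: ler_wpM2l; first by rewrite addr_ge0// ltW) => //; exact: ltW.
have b1 : (1 + s) * (1 + s) <= 1 + 3 * s by nra.
have b2 : (1 + s) * ((1 + s^-1) * e) <= 2 * ((1 + s^-1) * e).
  by apply: ler_wpM2r; [apply: mulr_ge0; [rewrite addr_ge0// ltW|exact: ltW]|lra].
have b3 := ler_wpM2r S0' b1.
have -> : (1 + s) * ((1 + s) * fine S + (1 + s^-1) * e) + (1 + s^-1) * e =
  (1 + s) * (1 + s) * fine S + (1 + s) * ((1 + s^-1) * e) + (1 + s^-1) * e by ring.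
have -> : (1 + s^-1) * 3 * e = 2 * ((1 + s^-1) * e) + (1 + s^-1) * e by ring.
lra.
Qed.

End density.

(** * Wavelets and decomposition trees *)

Section refined_functions.
Context {R : realType} {n : nat}.
Local Notation d := n.+1.
Local Notation Rd := 'cV[R]_d.
Local Notation mu := (lebesgue_cV R d).

Lemma ae_seq (T : eqType) (s : seq T) (P : T -> Rd -> Prop) :
  (forall k, k \in s -> {ae mu, forall x, P k x}) ->
  {ae mu, forall x, forall k, k \in s -> P k x}.
Proof.
elim: s => [_|k s IH h]; first by apply: aeW => x k; rewrite in_nil.
have h1 := h k (mem_head _ _).
have h2 : {ae mu, forall x, forall l, l \in s -> P l x}.
  by apply: IH => l ls; apply: h; rewrite inE ls orbT.
by apply: filterS2 h1 h2 => x a1 a2 l; rewrite inE => /orP[/eqP ->|/a2].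
Qed.

(** If N x - k lies in a bounded set for some k of the mask, then x = N^-1 (N x) does too. *)
Lemma refined_csupp (M : 'M[int]_d) (b : zmask R d) (g psi : Rd -> R[i]) (c : R[i]) :
  \det (mx_R M : 'M[R]_d) != 0 -> csupp g ->
  {ae mu, forall x, psi x = c * \sum_(k <- finsupp b) b k * g (mx_R M *m x - Zd_R k)} ->
  csupp psi.
Proof.
set N := mx_R M => N0 [rho grho] psiE.
have Nu : N \in unitmx by rewrite unitmxE unitfE.
have [K K0 hK] := mask_cube b.
exists ((\sum_i \sum_j `|invmx N i j|) * (`|rho| + K)).
have g0 : {ae mu, forall x, forall k, k \in finsupp b -> ~ cube d rho (N *m x - Zd_R k) -> g (N *m x - Zd_R k) = 0}.
  by apply: ae_seq => k _; exact: (ae_linear (- Zd_R k) N0 grho).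
apply: filterS2 psiE g0 => x -> h xB.
rewrite big_seq big1 ?mulr0// => k kb; rewrite h ?mulr0// => xr; apply: xB.
rewrite -(mulKmx Nu x); apply: mulmx_cube; first by rewrite addr_ge0.
rewrite -(subrK (Zd_R k) (N *m x)); apply: cubeD; last exact: hK.
by apply: cube_le xr; exact: ler_norm.
Qed.

(** Applying M^T cancels one inverse power, so the partial product with m + 1 factors at M^T xi is
    the mask at xi times the one with m factors at xi. *)
Lemma mask_product_refine (M : 'M[int]_d) (a : zmask R d) (xi : Rd) :
  dilation_matrix (R := R) M -> mask_hat a (0 : Rd) = 1 ->
  (forall xi : Rd, normc (mask_hat a xi) <= 1) ->
  mask_product M a ((mx_R M)^T *m xi) = mask_hat a xi * mask_product M a xi.
Proof.
move=> dM a0 a1; have Mu := dilation_unit dM.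
have E m : pprod M a m.+1 ((mx_R M)^T *m xi) = mask_hat a xi * pprod M a m xi.
  have K m' : invmx ((mx_R M)^T) ^+ m'.+1 *m ((mx_R M)^T *m xi) = invmx ((mx_R M)^T) ^+ m' *m xi.
    by rewrite exprSr -[_ * invmx _]/(_ *m invmx _) -mulmxA mulKmx ?unitmx_tr.
  elim: m => [|m IH]; first by rewrite pprodS !pprod0 mul1r mulr1 K expr0 mul1mx.
  by rewrite pprodS IH K [pprod _ _ m.+1 xi]pprodS mulrA.
have h1 := pprod_cvg dM a0 a1 xi.
have h2 := pprod_cvg dM a0 a1 ((mx_R M)^T *m xi).
have h3 : ccvg (fun m => pprod M a m.+1 ((mx_R M)^T *m xi)) (mask_product M a ((mx_R M)^T *m xi)).
  by case: h2 => p q; split; [move: p|move: q]; rewrite -cvg_shiftS.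
apply: ccvg_unique h3 _; under eq_fun do rewrite E.
by apply: ccvgM => //; exact: ccvg_cst.
Qed.

Lemma esumU (T : choiceType) (A B : set T) (h : T -> \bar R) :
  (forall i, 0 <= h i)%E -> A `&` B = set0 ->
  (\esum_(i in A `|` B) h i = \esum_(i in A) h i + \esum_(i in B) h i)%E.
Proof.
move=> h0 AB; rewrite (esumID A)//; congr (_ + _)%E; congr esum.
  by rewrite setIUl setIid setIC -[X in _ `|` X]setIC setUidPl// => x [].
apply/seteqP; split => x /=; first by move=> [[]].
by move=> Bx; split; [right|move=> Ax; rewrite -[False]/(set0 x) -AB].
Qed.

Lemma energy_ge0 f g U : (0 <= energy (n := n) f g U :> \bar R)%E.
Proof. by apply: esum_ge0 => k _; rewrite lee_fin sqr_ge0. Qed.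

Lemma energy_fin f g U : \det U != 0 -> L2 mu f -> bsupp f -> L2 mu g -> csupp g ->
  energy f g U \is a fin_num.
Proof.
move=> U0 Lf bf Lg sg; have [s [us hs]] := coef_finite U0 Lf bf Lg sg.
rewrite /energy (@esum_seq _ _ s) ?sumEFin//.
- by move=> k; rewrite lee_fin sqr_ge0.
- by move=> k ks; rewrite hs// normc0 expr0n.
Qed.

End refined_functions.

Section wavelets.
Context {R : realType} {n r : nat}.
Local Notation d := n.+1.
Local Notation Rd := 'cV[R]_d.
Local Notation mu := (lebesgue_cV R d).
Variables (M0 : 'M[int]_d) (a : zmask R d) (b : 'I_r -> zmask R d).
Variables (phi : Rd -> R[i]) (psi : 'I_r -> Rd -> R[i]).
Hypothesis dM : dilation_matrix (R := R) M0.
Hypothesis a0 : mask_hat a (0 : Rd) = 1.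
Hypothesis Lphi : L2 mu phi.
Hypothesis phiE : {ae mu, forall xi, fourier phi xi = mask_product M0 a xi}.
Hypothesis PR : wavelet_PR M0 a b.
Hypothesis Lpsi : forall l, L2 mu (psi l).
Hypothesis psiE : forall l, {ae mu, forall xi,
  fourier (psi l) ((mx_R M0)^T *m xi) = mask_hat (b l) xi * fourier phi xi}.
Local Notation U := (mx_R M0 : 'M[R]_d).

Let a1 (xi : Rd) : normc (mask_hat a xi) <= 1.
Proof. exact: wavelet_mask_le1 PR. Qed.

Let Uu : U \in unitmx. Proof. exact: dilation_unit. Qed.
Let U0 : \det U != 0. Proof. by rewrite -unitfE -unitmxE. Qed.

Lemma phi_csupp : csupp phi.
Proof. exact: refinable_csupp dM a0 a1 Lphi phiE. Qed.

Lemma phi_refinement : {ae mu, forall x, phi x = (`|\det U|)%:C *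
  \sum_(k <- finsupp a) a k * phi (U *m x - Zd_R k)}.
Proof.
apply: refinement => //.
have T0 : \det (U^T) != 0 by rewrite det_tr.
have := ae_linear 0 T0 phiE; apply: filterS2 phiE => xi h1.
by rewrite addr0 h1 => ->; exact: mask_product_refine.
Qed.

(** One application of [energy_split] with the same matrix on every branch: [None] stands for the
    low-pass mask and [Some l] for the wavelet filters. *)
Lemma wavelet_step f j : test_fun f -> (energy f phi (U ^+ j.+1) =
  energy f phi (U ^+ j) + \sum_(l < r) energy f (psi l) (U ^+ j))%E.
Proof.
move=> tf; have bf : bsupp f by case: tf.
pose s : seq (option 'I_r) := None :: [seq Some l | l <- index_enum 'I_r].
have Ustep : invmx U *m U ^+ j.+1 = U ^+ j.
  by rewrite exprS -[U * _]/(U *m _) mulKmx.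
rewrite (@energy_split _ _ _ s (fun=> M0) (oapp b a) _ _ _ f phi (oapp psi phi))//.
- by rewrite big_cons big_map /= Ustep.
- by exists None; rewrite inE eqxx.
- move=> omega xi [_ _ hom]; rewrite asboolT// big_cons big_map /=.
  exact: PR.
- exact: test_L2.
- exact: phi_csupp.
- exact: pow_det_neq0.
- by move=> [l|] _; [exact: Lpsi|exact: Lphi].
- move=> [l|] _ /=; last exact: phi_refinement.
  exact: (refinement U0 Lphi (Lpsi l) (psiE l)).
Qed.

(** By telescoping, the wavelet energies from [J] up to m - 1 together with the low-pass energy at
    [J] equal the low-pass energy at m, whose limit is known. Finiteness of the low-pass energy at
    [J] lets it be added to a possibly infinite limit. *)
Lemma wavelet_sum f J : test_fun f ->
  (\sum_(l < r) \esum_(j in [set j | (J <= j)%N]) energy f (psi l) (U ^+ j) +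
   energy f phi (U ^+ J) = sq mu f)%E.
Proof.
move=> tf; have bf : bsupp f by case: tf.
have Lf := test_L2 tf.
pose W j := (\sum_(l < r) energy f (psi l) (U ^+ j))%E.
pose V j := energy f phi (U ^+ j).
have W0 j : (0 <= W j)%E by apply: sume_ge0 => l _; exact: energy_ge0.
have Vfin j : V j \is a fin_num.
  by apply: energy_fin => //; [exact: pow_det_neq0|exact: phi_csupp].
rewrite -esum_sum; last by move=> j l _ _; exact: energy_ge0.
rewrite -(nneseries_esum (a := W) (P := fun j => (J <= j)%N))//.
have partial m : (J <= m)%N -> (\sum_(0 <= j < m | (J <= j)%N) W j + V J = V m)%E.
  elim: m => [|m IH]; first by rewrite leqn0 => /eqP ->; rewrite big_geq// add0e.
  rewrite leq_eqVlt => /orP[/eqP ->|Jm].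
    rewrite big_nat_cond big1 ?add0e// => j /andP[/andP[_ jm] mj].
    by move: (leq_ltn_trans mj jm); rewrite ltnn.
  rewrite big_mkcond big_nat_recr//= -big_mkcond (_ : (J <= m)%N = true)//.
  by rewrite addeAC IH// /V wavelet_step.
have lim : V j @[j --> \oo] --> sq mu f.
  by apply: lowpass_limit => //; [exact: phi_csupp|exact: refinable_cint dM a0 a1 Lphi phiE].
have hcv := is_cvg_nneseries_cond (u_ := W) (P := fun j => (J <= j)%N) (N := 0%N) (fun j _ _ => W0 j).
have sum_lim : (\sum_(0 <= j < m | (J <= j)%N) W j + V J)%E @[m --> \oo] -->
    (\sum_(j <oo | (J <= j)%N) W j + V J)%E.
  apply: cvgeD => //; last exact: cvg_cst.
  by rewrite fin_num_adde_defl.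
apply: cvg_unique sum_lim _ => //.
apply: cvg_trans lim; apply: near_eq_cvg; near=> m; apply/esym/partial.
by near: m; exists J.
Unshelve. all: by end_near.
Qed.

End wavelets.

(** * Levels, parents and children in the index tree *)

Section tree_combinatorics.
Variables (J : nat) (sT rT : tindex J -> nat).
Hypothesis vs : valid_sizes sT rT.
Implicit Types alpha beta : tindex J.

(** The nonzero entries are exactly the first j. This invariant is what allows [level] and [parent],
    defined from the entries alone, to recover the position of a node. *)
Definition at_level (j : nat) alpha := forall i : 'I_J, (alpha i == 0%N) = (j <= i)%N.

Lemma set_entry_at_level j alpha l : at_level j alpha -> (0 < l)%N ->
  at_level j.+1 (set_entry alpha j.+1 l).
Proof.
move=> ha l0 i; rewrite ffunE eqSS; case: (eqVneq (i : nat) j) => [ij|ij].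
  by rewrite ij ltnn -leqn0 leqNgt l0.
by rewrite ha ltn_neqAle eq_sym ij.
Qed.

Lemma level_at_level j alpha : (j <= J)%N -> at_level j alpha -> level alpha = j.
Proof.
move=> jJ ha; rewrite /level -sum1_card.
under eq_bigl => i do rewrite inE ha -ltnNge.
rewrite -(big_ord_widen J (fun=> 1%N) jJ).
by rewrite sum1_card card_ord.
Qed.

Lemma parent_child j alpha l : (j < J)%N -> at_level j alpha -> (0 < l)%N ->
  parent (set_entry alpha j.+1 l) = alpha.
Proof.
move=> jJ ha l0; rewrite /parent (level_at_level jJ (set_entry_at_level ha l0)).
apply/ffunP => i; rewrite !ffunE eqSS; case: eqP => // ij.
by apply/esym/eqP; rewrite ha ij.
Qed.

Lemma set_entry_inj j alpha : (j < J)%N -> injective (set_entry alpha j.+1).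
Proof.
move=> jJ l l' /ffunP/(_ (Ordinal jJ)); by rewrite !ffunE eqxx.
Qed.

Lemma low_at_level j alpha : low sT j alpha -> at_level j alpha.
Proof.
elim: j alpha => [|j IH] alpha /=; first by move=> -> i; rewrite ffunE.
move=> [beta hb [l /andP[l0 _] <-]]; exact: set_entry_at_level (IH _ hb) l0.
Qed.

Lemma childrenP j alpha beta : split_node sT j alpha ->
  children sT rT j alpha beta <->
  exists2 l, (0 < l <= rT alpha)%N & beta = set_entry alpha j l.
Proof.
move=> /vs[sr _ _]; split=> [[[l /andP[l1 l2] <-]|[l /andP[l1 l2] <-]]|[l /andP[l1 l2] ->]].
- by exists l => //; rewrite l1 (leq_trans l2).
- by exists l => //; rewrite (leq_ltn_trans _ l1).
- have [ls|sl] := leqP l (sT alpha); first by left; exists l => //=; rewrite l1.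
  by right; exists l => //=; rewrite sl.
Qed.

Definition child_seq j alpha : seq (tindex J) :=
  [seq set_entry alpha j l | l <- iota 1 (rT alpha)].

Lemma child_seqE j alpha : split_node sT j alpha ->
  children sT rT j alpha = [set` child_seq j alpha].
Proof.
move=> sp; apply/seteqP; split => beta /=.
  move/(childrenP _ sp) => [l hl ->]; apply: map_f.
  by rewrite mem_iota add1n ltnS.
move=> /mapP[l]; rewrite mem_iota add1n ltnS => hl ->.
by apply/(childrenP _ sp); exists l.
Qed.

Lemma child_seq_uniq j alpha : (j < J)%N -> uniq (child_seq j.+1 alpha).
Proof. by move=> jJ; rewrite map_inj_uniq ?iota_uniq//; exact: set_entry_inj. Qed.

Lemma child_at_level j alpha beta : split_node sT j.+1 alpha ->
  children sT rT j.+1 alpha beta -> at_level j.+1 beta.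
Proof.
move=> sp /(childrenP _ sp)[l /andP[l0 _] ->]; case: sp => _ /low_at_level ha.
exact: set_entry_at_level.
Qed.

Lemma child_parent j alpha beta : split_node sT j.+1 alpha ->
  children sT rT j.+1 alpha beta -> parent beta = alpha.
Proof.
move=> sp /(childrenP _ sp)[l /andP[l0 _] ->]; case: sp => /= jJ /low_at_level ha.
exact: parent_child.
Qed.

Lemma child_node j alpha beta : split_node sT j.+1 alpha ->
  children sT rT j.+1 alpha beta -> nodes sT rT beta.
Proof.
move=> [jJ la] [h|h]; exists j.+1 => //; first by left; exists alpha.
by right; exists alpha.
Qed.

Definition high_upto (k : nat) : set (tindex J) :=
  \bigcup_(j in [set j : nat | (1 <= j <= k)%N]) high sT rT j.

Lemma high_at_level j beta : (1 <= j <= J)%N -> high sT rT j beta -> at_level j beta.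
Proof.
case: j => // j jJ [alpha la hb].
by apply: (@child_at_level j alpha); [split|right].
Qed.

(** A common element would have level k on both sides, hence the same parent, and its last entry
    would be at most s and greater than s. *)
Lemma low_high_disjoint k : (k <= J)%N -> low sT k `&` high_upto k = set0.
Proof.
move=> kJ; rewrite -subset0 => beta [lb [j /andP[j1 jk] hb]].
have jJ : (1 <= j <= J)%N by rewrite j1 (leq_trans jk).
have e : j = k.
  rewrite -(level_at_level kJ (low_at_level lb)).
  by rewrite (level_at_level _ (high_at_level jJ hb))//; case/andP: jJ.
case: k kJ lb jk e => [|k] kJ lb jk e; first by rewrite e in j1.
rewrite {}e /= in hb jJ.
case: lb => alpha la lab; case: hb => alpha' la' hab.
have pa : parent beta = alpha by apply: (@child_parent k) => //; left.
have pa' : parent beta = alpha' by apply: (@child_parent k) => //; right.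
rewrite -pa' pa in hab; case: lab => l /andP[_ ls] lE.
case: hab => l' /andP[sl _]; rewrite -lE => /(set_entry_inj kJ) e.
by move: (leq_ltn_trans ls sl); rewrite e ltnn.
Qed.

Lemma next_level_disjoint k : (k < J)%N ->
  high_upto k `&` (low sT k.+1 `|` high sT rT k.+1) = set0.
Proof.
move=> kJ; rewrite -subset0 => beta [[j /andP[j1 jk] hb] h].
have jJ : (j <= J)%N by apply: leq_trans jk _; exact: ltnW.
have e1 : level beta = j by apply: level_at_level => //; apply: high_at_level hb; rewrite j1.
have e2 : level beta = k.+1.
  by apply: level_at_level => //; case: h => [/low_at_level//|/high_at_level]; apply.
by move: jk; rewrite -e1 e2 ltnn.
Qed.

Lemma children_cover k : low sT k.+1 `|` high sT rT k.+1 =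
  \bigcup_(alpha in low sT k) children sT rT k.+1 alpha.
Proof. by rewrite bigcupU. Qed.

Lemma high_uptoS k : high_upto k.+1 = high_upto k `|` high sT rT k.+1.
Proof.
apply/seteqP; split => beta.
  move=> [j /andP[j1]]; rewrite leq_eqVlt => /orP[/eqP -> hb|jk hb]; first by right.
  by left; exists j => //=; rewrite j1.
move=> [[j /andP[j1 jk] hb]|hb]; last by exists k.+1 => /=.
by exists j => //=; rewrite j1 leqW.
Qed.

End tree_combinatorics.

(** * Energy along the decomposition tree *)

Section tree_energy.
Context {R : realType} {n J : nat}.
Local Notation d := n.+1.
Local Notation Rd := 'cV[R]_d.
Local Notation mu := (lebesgue_cV R d).
Variables (sT rT : tindex J -> nat) (M : tindex J -> 'M[int]_d).
Variables (aT : tindex J -> zmask R d) (psiT : tindex J -> Rd -> R[i]).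
Hypothesis vs : valid_sizes sT rT.
Hypothesis Mu : forall beta, nodes sT rT beta -> mx_R (R := R) (M beta) \in unitmx.
Hypothesis PR : tree_PR sT rT M aT.
Hypothesis Lroot : L2 mu (psiT (troot J)).
Hypothesis sroot : csupp (psiT (troot J)).
Hypothesis LT : forall beta, nodes sT rT beta -> L2 mu (psiT beta).
Hypothesis psiTE : forall beta, nodes sT rT beta -> {ae mu, forall xi,
    fourier (psiT beta) ((mx_R (M beta))^T *m xi) =
    mask_hat (aT beta) xi * fourier (psiT (parent beta)) xi}.

Let N beta : 'M[R]_d := node_mx M beta.

Let det_node beta : nodes sT rT beta -> \det (mx_R (M beta) : 'M[R]_d) != 0.
Proof. by move=> /Mu; rewrite unitmxE unitfE. Qed.

Lemma node_mx_root : N (troot J) = 1%:M.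
Proof.
rewrite /N /node_mx (@level_at_level _ 0)//; first by rewrite big_ord0.
by move=> i; rewrite ffunE.
Qed.

Lemma node_mx_child j alpha beta : split_node sT j.+1 alpha ->
  children sT rT j.+1 alpha beta -> N beta = invmx (mx_R (M beta)) *m N alpha.
Proof.
move=> sp hb; have [/= jJ la] := sp.
rewrite /N /node_mx (level_at_level jJ (child_at_level vs sp hb)).
rewrite (level_at_level (ltnW jJ) (low_at_level la)) big_ord_recl.
congr (_ * _); apply: eq_bigr => i _.
by rewrite /= -iterS iterSr (child_parent vs sp hb).
Qed.

(** What [energy_split] requires of the node being split; it is inherited by all children through
    their two-scale relations. *)
Definition good_node alpha := [/\ L2 mu (psiT alpha), csupp (psiT alpha) & \det (N alpha) != 0].

Lemma child_refinement j alpha beta : split_node sT j.+1 alpha ->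
  children sT rT j.+1 alpha beta -> L2 mu (psiT alpha) ->
  {ae mu, forall x, psiT beta x = (`|\det (mx_R (M beta) : 'M[R]_d)|)%:C *
     \sum_(k <- finsupp (aT beta)) aT beta k * psiT alpha (mx_R (M beta) *m x - Zd_R k)}.
Proof.
move=> sp hb La; have nb := child_node sp hb.
apply: refinement => //; [exact: det_node|exact: LT|].
by rewrite -(child_parent vs sp hb); exact: psiTE.
Qed.

Lemma good_child j alpha beta : split_node sT j.+1 alpha ->
  children sT rT j.+1 alpha beta -> good_node alpha -> good_node beta.
Proof.
move=> sp hb [La sa da]; have nb := child_node sp hb; split; first exact: LT.
  exact: refined_csupp (det_node nb) sa (child_refinement sp hb La).
by rewrite (node_mx_child sp hb) det_mulmx mulf_neq0// det_inv invr_eq0 det_node.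
Qed.

Lemma good_low k alpha : (k <= J)%N -> low sT k alpha -> good_node alpha.
Proof.
elim: k alpha => [|k IH] alpha kJ /=.
  by move=> ->; split => //; rewrite node_mx_root det1 oner_eq0.
move=> [beta lb hab]; apply: (@good_child k beta) => //; last exact: IH (ltnW kJ) lb.
by left.
Qed.

Lemma good_leaf beta : leaves sT rT beta -> good_node beta.
Proof.
move=> [lb|[[//|j] /= jJ [alpha la hb]]]; first exact: good_low lb.
apply: (@good_child j alpha); [by split|by right|].
exact: good_low (ltnW jJ) la.
Qed.

Variables (f : Rd -> R[i]) (U : 'M[R]_d).
Hypothesis tf : test_fun f.
Hypothesis U0 : \det U != 0.

Let E beta : \bar R := energy f (psiT beta) (N beta *m U).

Lemma congr_big_seq (T : eqType) (s : seq T) (F G : T -> \bar R) :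
  (forall i, i \in s -> F i = G i) -> (\sum_(i <- s) F i = \sum_(i <- s) G i)%E.
Proof. by move=> h; rewrite big_seq [RHS]big_seq; exact: eq_bigr. Qed.

Lemma energy_children k alpha : split_node sT k.+1 alpha ->
  (E alpha = \esum_(beta in children sT rT k.+1 alpha) E beta)%E.
Proof.
move=> sp; have [/= kJ la] := sp; have [La sa da] := good_low (ltnW kJ) la.
have bf : bsupp f by case: tf.
have uc : uniq (child_seq rT k.+1 alpha) by exact: child_seq_uniq.
have cE := child_seqE vs sp.
have ch beta : beta \in child_seq rT k.+1 alpha -> children sT rT k.+1 alpha beta.
  by rewrite cE.
have ex : exists beta, beta \in child_seq rT k.+1 alpha.
  have [_ r1 _] := vs sp; exists (set_entry alpha k.+1 1); apply: map_f.
  by rewrite mem_iota /= add1n ltnS.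
have dets beta : beta \in child_seq rT k.+1 alpha -> \det (mx_R (M beta) : 'M[R]_d) != 0.
  by move=> /ch hb; apply: det_node; exact: child_node sp hb.
have prs (omega xi : Rd) : (exists2 beta, beta \in child_seq rT k.+1 alpha & Omega (M beta) omega) ->
    \sum_(beta <- child_seq rT k.+1 alpha | `[< Omega (M beta) omega >])
      mask_hat (aT beta) xi * (mask_hat (aT beta) (xi + (2 * pi) *: omega))^* = (omega == 0)%:R.
  move=> [beta /ch hb hom].
  rewrite -(@PR _ _ sp omega xi (ex_intro2 _ _ beta hb hom)).
  rewrite -big_filter fsbig_seq ?filter_uniq//; apply: eq_fsbigl.
  apply/seteqP; split => gamma /=; rewrite mem_filter.
    by move=> /andP[/asboolP h /ch].
  by rewrite cE => -[h1 h2]; apply/andP; split => //; exact/asboolP.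
have Ls beta : beta \in child_seq rT k.+1 alpha -> L2 mu (psiT beta).
  by move=> /ch hb; apply: LT; exact: child_node sp hb.
have refs beta : beta \in child_seq rT k.+1 alpha -> {ae mu, forall x,
    psiT beta x = (`|\det (mx_R (M beta) : 'M[R]_d)|)%:C *
     \sum_(k <- finsupp (aT beta)) aT beta k * psiT alpha (mx_R (M beta) *m x - Zd_R k)}.
  by move=> /ch hb; exact: child_refinement sp hb La.
have NU0 : \det (N alpha *m U) != 0 by rewrite det_mulmx mulf_neq0.
have H := energy_split ex dets prs (test_L2 tf) bf La sa NU0 Ls refs.
rewrite cE esum_fset; last 2 first.
- exact: finite_seq.
- by move=> i _; exact: energy_ge0.
rewrite -(fsbig_seq _ _ uc); move: H; rewrite -/(E alpha) => ->.
apply: congr_big_seq => beta hb.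
rewrite /E.
congr energy.
rewrite (node_mx_child sp (ch _ hb)).
exact: mulmxA.
Qed.

(** Each low node is replaced by its children. The families of children are disjoint because
    [parent] recovers the node, so the double sum reindexes to a sum over their union. *)
Lemma energy_level k : (k < J)%N ->
  (\esum_(alpha in low sT k) E alpha =
   \esum_(beta in low sT k.+1 `|` high sT rT k.+1) E beta)%E.
Proof.
move=> kJ; have sp alpha : low sT k alpha -> split_node sT k.+1 alpha by split.
have EA alpha : low sT k alpha -> E alpha = (\esum_(beta in children sT rT k.+1 alpha) E beta)%E.
  by move=> la; exact: energy_children (sp _ la).
rewrite (eq_esum EA) children_cover.
rewrite (esum_esum (a := fun _ => E)); last by move=> i j _ _; exact: energy_ge0.
apply/esym; apply: (@reindex_esum _ _ _ _ _ snd); split.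
- by move=> [alpha beta] [/= h1 h2]; exists alpha.
- move=> [a1 b1] [a2 b2]; rewrite !inE/= => -[l1 c1] [l2 c2] b12.
  by rewrite -(child_parent vs (sp _ l1) c1) -(child_parent vs (sp _ l2) c2) /= b12.
- by move=> beta [alpha h1 h2]; exists (alpha, beta).
Qed.

(** The induction runs over the tree cut at depth k: the low nodes of level k together with all high
    nodes found so far. Its energy is constant, it is the root for k = 0 and the set of leaves for k
    = J. *)
Lemma energy_leaves : (\esum_(beta in leaves sT rT) E beta = energy f (psiT (troot J)) U)%E.
Proof.
have E0 beta : (0 <= E beta)%E by exact: energy_ge0.
suff H k : (k <= J)%N -> (\esum_(beta in low sT k `|` high_upto sT rT k) E beta =
    energy f (psiT (troot J)) U)%E by exact: H.
elim: k => [|k IH] kJ.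
  rewrite (_ : _ `|` _ = [set troot J]); last first.
    apply/seteqP; split => beta; last by left.
    by move=> [//|[j /andP[j1]]]; rewrite leqn0 => /eqP j0; rewrite j0 in j1.
  by rewrite esum_set1 ?E0 /E ?node_mx_root ?mul1mx.
rewrite -(IH (ltnW kJ)) high_uptoS [high_upto _ _ _ `|` _]setUC setUA.
rewrite setUC (esumU E0 (next_level_disjoint vs kJ)) (esumU E0 (low_high_disjoint vs (ltnW kJ))).
by rewrite (energy_level kJ) addeC.
Qed.

End tree_energy.

Section system_energy.
Context {R : realType} {n r J : nat}.
Local Notation d := n.+1.
Local Notation Zd := 'cV[int]_d.
Variables sT rT : tindex J -> nat.

Lemma esum_pair (T1 T2 : choiceType) (P : set T1) (Q : T1 -> set T2) (h : T1 * T2 -> \bar R) :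
  (forall p, 0 <= h p)%E ->
  (\esum_(p in P `*`` Q) h p = \esum_(i in P) \esum_(j in Q i) h (i, j))%E.
Proof.
move=> h0; rewrite (esum_esum (a := fun i j => h (i, j))) => [|i j _ _]; last exact: h0.
by apply: eq_esum => -[].
Qed.

Lemma esum_system (h : AS_index (d := d) r J -> \bar R) : (forall i, 0 <= h i)%E ->
  (\esum_(i in AS_range sT rT) h i =
   \sum_(l < r) \esum_(j in [set j | (J <= j)%N]) \esum_(k in [set: Zd]) h (inl (l, j, k)) +
   \esum_(beta in leaves sT rT) \esum_(k in [set: Zd]) h (inr (beta, k)))%E.
Proof.
move=> h0.
pose A : set ('I_r * nat * Zd) := [set p | (J <= p.1.2)%N].
pose B : set (tindex J * Zd) := [set p | leaves sT rT p.1].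
have -> : AS_range sT rT = (inl @` A) `|` (inr @` B).
  apply/seteqP; split => [[[[l j] k]|[beta k]] hi|i].
  - by left; exists (l, j, k).
  - by right; exists (beta, k).
  - by move=> [[[[l j] k] /= hA <-]|[[beta k] /= hB <-]].
rewrite esumU//; last first.
  by rewrite -subset0 => i [[p _ <-] [q _]].
congr (_ + _)%E.
  rewrite esum_image; last by move=> x y _ _ [].
  pose A' : set ('I_r * nat) := [set q | (J <= q.2)%N].
  have -> : A = A' `*`` (fun=> setT) by apply/seteqP; split => -[[l j] k] //= [].
  rewrite esum_pair => [|p]; last exact: h0.
  have -> : A' = [set: 'I_r] `*`` (fun=> [set j | (J <= j)%N]).
    by apply/seteqP; split => -[l j] //= [].
  rewrite esum_pair => [|p]; last by apply: esum_ge0 => k _; exact: h0.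
  rewrite (@esum_seq _ _ (index_enum 'I_r)) => [//||k|k]; first exact: index_enum_uniq.
    by apply: esum_ge0 => j _; apply: esum_ge0 => k' _; exact: h0.
  by rewrite mem_index_enum.
rewrite esum_image; last by move=> x y _ _ [].
have -> : B = leaves sT rT `*`` (fun=> setT) by apply/seteqP; split => -[beta k] //= [].
by rewrite esum_pair => [//|p]; exact: h0.
Qed.

End system_energy.

(** Positive dimension is built into the type so that square matrices form a ring with powers. The
    tree contributes the low-pass energy at scale [J], which is what [wavelet_sum] lacks to reach
    the squared norm. *)
Lemma tight_system (R : realType) (n r J : nat)
    (M0 : 'M[int]_n.+1) (a : zmask R n.+1) (b : 'I_r -> zmask R n.+1)
    (phi : 'cV[R]_n.+1 -> R[i]) (psi : 'I_r -> 'cV[R]_n.+1 -> R[i])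
    (sT rT : tindex J -> nat) (M : tindex J -> 'M[int]_n.+1)
    (aT : tindex J -> zmask R n.+1) (psiT : tindex J -> 'cV[R]_n.+1 -> R[i]) :
  dilation_matrix (R := R) M0 ->
  mask_hat a 0 = 1 ->
  inL2 phi ->
  {ae lebesgue_cV R n.+1, forall xi, fourier phi xi = mask_product M0 a xi} ->
  wavelet_PR M0 a b ->
  (forall l, inL2 (psi l)) ->
  (forall l, {ae lebesgue_cV R n.+1, forall xi,
    fourier (psi l) ((mx_R M0)^T *m xi) = mask_hat (b l) xi * fourier phi xi}) ->
  valid_sizes sT rT ->
  (forall beta, nodes sT rT beta -> mx_R (R := R) (M beta) \in unitmx) ->
  tree_PR sT rT M aT ->
  psiT (troot J) = phi ->
  (forall beta, nodes sT rT beta -> inL2 (psiT beta)) ->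
  (forall beta, nodes sT rT beta -> {ae lebesgue_cV R n.+1, forall xi,
    fourier (psiT beta) ((mx_R (M beta))^T *m xi) =
    mask_hat (aT beta) xi * fourier (psiT (parent beta)) xi}) ->
  tight_frame (AS_range sT rT) (AS M0 psi M psiT).
Proof.
move=> dM a0 Lphi phiE PR Lpsi psiE vs Mu PRT root LT psiTE.
set mu := lebesgue_cV R n.+1.
have U0 : \det (mx_R M0 ^+ J : 'M[R]_n.+1) != 0 by exact: pow_det_neq0.
have sphi : csupp phi by exact: phi_csupp dM a0 Lphi phiE PR.
have Lroot : L2 mu (psiT (troot J)) by rewrite root; exact: Lphi.
have sroot : csupp (psiT (troot J)) by rewrite root; exact: sphi.
have L0 i : AS_range sT rT i -> L2 mu (AS M0 psi M psiT i).
  case: i => [[[l j] k] _|[beta k] hb]; first by apply: dilshift_L2; [exact: pow_det_neq0|exact: Lpsi].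
  have [Lb _ db] := good_leaf vs Mu Lroot sroot LT psiTE hb.
  by apply: dilshift_L2 => //; rewrite det_mulmx mulf_neq0.
apply: (tight_dense L0) => f tf.
rewrite esum_system => [|i]; last by rewrite lee_fin sqr_ge0.
rewrite (energy_leaves vs Mu PRT Lroot sroot LT psiTE tf U0) root.
by rewrite (wavelet_sum dM a0 Lphi phiE PR Lpsi psiE J tf).
Qed.

Theorem theorem3p3 (R : realType) (d r J : nat)
    (M0 : 'M[int]_d) (a : zmask R d) (b : 'I_r -> zmask R d)
    (phi : 'cV[R]_d -> R[i]) (psi : 'I_r -> 'cV[R]_d -> R[i])
    (sT rT : tindex J -> nat) (M : tindex J -> 'M[int]_d)
    (aT : tindex J -> zmask R d) (psiT : tindex J -> 'cV[R]_d -> R[i]) :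
  (0 < d)%N -> (0 < J)%N ->
  dilation_matrix (R := R) M0 ->
  mask_hat a 0 = 1 ->
  inL2 phi ->
  {ae lebesgue_cV R d, forall xi, fourier phi xi = mask_product M0 a xi} ->
  wavelet_PR M0 a b ->
  (forall l, inL2 (psi l)) ->
  (forall l, {ae lebesgue_cV R d, forall xi,
    fourier (psi l) ((mx_R M0)^T *m xi) = mask_hat (b l) xi * fourier phi xi}) ->
  valid_sizes sT rT ->
  (forall beta, nodes sT rT beta -> mx_R (R := R) (M beta) \in unitmx) ->
  (forall beta, nodes sT rT beta -> forall k, aT beta k \is Num.real) ->
  tree_PR sT rT M aT ->
  psiT (troot J) = phi ->
  (forall beta, nodes sT rT beta -> inL2 (psiT beta)) ->
  (forall beta, nodes sT rT beta -> {ae lebesgue_cV R d, forall xi,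
    fourier (psiT beta) ((mx_R (M beta))^T *m xi) =
    mask_hat (aT beta) xi * fourier (psiT (parent beta)) xi}) ->
  tight_frame (AS_range sT rT) (AS M0 psi M psiT).
Proof.
case: d M0 a b phi psi M aT psiT => // n M0 a b phi psi M aT psiT.
move=> _ _ dM a0 Lphi phiE PR Lpsi psiE vs Mu _ PRT root LT psiTE.
exact: tight_system dM a0 Lphi phiE PR Lpsi psiE vs Mu PRT root LT psiTE.
Qed.
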